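(* Let $d\ge 3$, $1 \le p \le \frac{4}{3}$ and $f \in L^p(\mathbb{R}^d)$. Then $\sigma$-almost every point of the unit sphere $\mathbb{S}^{d-1}$ is a Lebesgue point of $\widehat{f}$, and for $\sigma$-almost every $x \in \mathbb{S}^{d-1}$ the regularised value of $\widehat{f}$ at $x$ coincides with $\mathcal{R}f(x)$.
   Context: $\sigma$ denotes the standard surface measure on $\mathbb{S}^{d-1}$. For $f\in L^p(\mathbb{R}^d)$ with $1\le p\le 2$, $\widehat f$ is the Fourier transform, a locally integrable function (in $L^{p'}$ by Hausdorff–Young). A point $x$ is a Lebesgue point of $\widehat f$ if there is a number $c$ (the regularised value of $\widehat f$ at $x$) with $\lim_{r\to 0}\frac{1}{|B(x,r)|}\int_{B(x,r)}|\widehat f(y)-c|\,\mathrm{d}y=0$. The restriction operator $\mathcal{R}$ is the unique bounded linear operator from $L^p(\mathbb{R}^d)$ to $L^1(\mathbb{S}^{d-1},\sigma)$ which agrees with $f\mapsto\widehat f|_{\mathbb{S}^{d-1}}$ on Schwartz functions. *)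

(* Defs.v *)
From HB Require Import structures.
From mathcomp Require Import all_boot all_algebra.
From mathcomp Require Import all_classical all_reals all_analysis.
From mathcomp Require Import complex.

Set Implicit Arguments.
Unset Strict Implicit.
Unset Printing Implicit Defensive.

Import GRing.Theory Num.Theory.
Local Open Scope classical_set_scope.
Local Open Scope ring_scope.

Section Defs.
Variables (R : realType) (d : nat).

(* R^d, with its Borel (= product) sigma-algebra from mathcomp-analysis *)
Definition Rd := d.-tuple R.

Definition coord (x : Rd) (i : 'I_d) : R := tnth x i.

Definition dotp (x y : Rd) : R := \sum_(i < d) coord x i * coord y i.

Definition enorm (x : Rd) : R := Num.sqrt (dotp x x).

Definition edist (x y : Rd) : R :=
  Num.sqrt (\sum_(i < d) (coord x i - coord y i) ^+ 2).

Definition eball (x : Rd) (r : R) : set Rd := [set y | edist x y < r].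

Definition sphere : set Rd := [set x | dotp x x = 1].

Definition cabs (z : R[i]) : R := Num.sqrt (complex.Re z ^+ 2 + complex.Im z ^+ 2).

End Defs.

(* Lebesgue integral on R^d, computed as the iterated one-dimensional Lebesgue
   integral (Tonelli/Fubini: agrees with the d-dimensional Lebesgue integral
   for Borel measurable nonnegative or integrable functions). *)
Fixpoint iint (R : realType) (n : nat) : (n.-tuple R -> \bar R) -> \bar R :=
  match n return (n.-tuple R -> \bar R) -> \bar R with
  | 0 => fun g => g [tuple]
  | n'.+1 => fun g =>
      (\int[@lebesgue_measure R]_(t in [set: R])
          iint (fun s : n'.-tuple R => g [tuple of t :: s]))%E
  end.

Section Defs2.
Variables (R : realType) (d : nat).
Local Notation Rd := (Rd R d).
Local Notation C := (R[i]).

Definition lebd (A : set Rd) : \bar R := iint (fun x => (\1_A x)%:E).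

Definition cint (f : Rd -> C) : C :=
  Complex (fine (iint (fun x => (complex.Re (f x))%:E)))
          (fine (iint (fun x => (complex.Im (f x))%:E))).

Definition cmeasurable (D : set Rd) (f : Rd -> C) : Prop :=
  measurable_fun D (fun x => complex.Re (f x)) /\ measurable_fun D (fun x => complex.Im (f x)).

Definition Lp (p : R) (f : Rd -> C) : Prop :=
  cmeasurable setT f /\ (iint (fun x => (powR (cabs (f x)) p)%:E) < +oo)%E.

Definition Lpnorm (p : R) (f : Rd -> C) : R :=
  powR (fine (iint (fun x => (powR (cabs (f x)) p)%:E))) p^-1.

Definition cexpi (t : R) : C := Complex (cos t) (sin t).

Definition fourier (g : Rd -> C) (xi : Rd) : C :=
  cint (fun x => g x * cexpi (- (2 * pi * dotp x xi))).

Definition shift (x : Rd) (i : 'I_d) (h : R) : Rd :=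
  [tuple coord x j + (if j == i then h else 0) | j < d].

Definition pderiv (i : 'I_d) (g : Rd -> R) (x : Rd) : R :=
  derive1 (fun h : R => g (shift x i h)) 0.

Fixpoint pders (s : seq 'I_d) (g : Rd -> R) : Rd -> R :=
  match s with
  | [::] => g
  | i :: s' => pderiv i (pders s' g)
  end.

Definition schwartzR (g : Rd -> R) : Prop :=
  forall s : seq 'I_d,
    (forall (i : 'I_d) (x : Rd),
        derivable (fun h : R => pders s g (shift x i h)) 0 1) /\
    (forall k : nat, exists M : R, forall x : Rd,
        (1 + enorm x ^+ 2) ^+ k * `|pders s g x| <= M).

Definition schwartz (g : Rd -> C) : Prop :=
  schwartzR (fun x => complex.Re (g x)) /\ schwartzR (fun x => complex.Im (g x)).

(* The Fourier transform of f in L^p (1 <= p <= 2), as a locally integrable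
   function F: distributional definition  \int F phi = \int f \hat phi  for
   every Schwartz function phi. *)
Definition is_fourier_transform (f F : Rd -> C) : Prop :=
  cmeasurable setT F /\
  (forall (x : Rd) (r : R),
      iint (fun y => (\1_(eball x r) y * cabs (F y))%:E) < +oo)%E /\
  (forall phi, schwartz phi ->
      cint (fun x => F x * phi x) = cint (fun x => f x * fourier phi x)).

(* surface measure sigma on S^{d-1} via the cone construction:
   \int_S g dsigma = d * \int_{0 < |x| <= 1} g(x/|x|) dx *)
Definition sproj (x : Rd) : Rd := [tuple coord x i / enorm x | i < d].

Definition sint (g : Rd -> \bar R) : \bar R :=
  ((d%:R)%:E * iint (fun x => if (0 < enorm x <= 1)%R then g (sproj x) else 0))%E.

Definition sigma_null (N : set Rd) : Prop :=
  measurable N /\ sint (fun x => (\1_N x)%:E) = 0%E.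

Definition sigma_ae (P : Rd -> Prop) : Prop :=
  exists N, sigma_null N /\ forall x, @sphere R d x -> ~ N x -> P x.

(* x is a Lebesgue point of F with regularised value c:
   (1/|B(x,r)|) \int_{B(x,r)} |F(y) - c| dy -> 0 as r -> 0 *)
Definition lebesgue_point (F : Rd -> C) (x : Rd) (c : C) : Prop :=
  forall e : R, 0 < e -> exists2 delta : R, 0 < delta &
    forall r : R, 0 < r < delta ->
      (iint (fun y => (\1_(eball x r) y * cabs (F y - c))%:E)
        <= e%:E * lebd (eball x r))%E.

(* T is the restriction operator: a bounded linear operator
   L^p(R^d) -> L^1(S^{d-1}, sigma) agreeing with \hat phi |_S on Schwartz
   functions (operators act on representatives, equalities hold sigma-a.e.) *)
Definition is_restriction_operator (p : R) (T : (Rd -> C) -> Rd -> C) : Prop :=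
  (forall f, Lp p f -> cmeasurable (@sphere R d) (T f)) /\
  (forall f g, Lp p f -> Lp p g ->
      sigma_ae (fun x => T (fun y => f y + g y) x = T f x + T g x)) /\
  (forall (a : C) f, Lp p f ->
      sigma_ae (fun x => T (fun y => a * f y) x = a * T f x)) /\
  (exists K : R, forall f, Lp p f ->
      (sint (fun x => (cabs (T f x))%:E) <= (K * Lpnorm p f)%:E)%E) /\
  (forall phi, schwartz phi -> sigma_ae (fun x => T phi x = fourier phi x)).

End Defs2.

(* Main.v *)
(* The sphere enters only through the bound
     sigma^3 {(x, y, z) : |w + x - y - z| < r} <= C r^d   for every w,
   which holds when d >= 3.  Linearise the maximal function: if E is the set of
   points of the sphere at which |G| has average > eta over some ball B(x, r(x)),
   then eta sigma(E) is at most a constant times the integral of |G| W, where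
   W(y) is the integral over E of r(x)^-d 1_(|x - y| < r(x)) dsigma(x).  For any
   radius function, the bound on triples controls, uniformly, the L^2 norm of
   the autocorrelation of W, hence the L^4 norm of the Fourier transform of any
   phi with |phi| <= W.  If G is the Fourier transform of g in L^p, p <= 4/3,
   testing G against sgn(G) W then gives a maximal estimate that tends to 0 with
   the L^p norm of g.

   Split f = f_m + g_m with f_m bounded of bounded support.  The transform of f_m
   is Lipschitz and equals R f_m a.e. on the sphere, the transform of g_m has a
   small maximal function and R g_m is small in L^1(sigma): hence F has the
   regularised value R f(x) at almost every x of the sphere. *)

Require Import Defs.
From HB Require Import structures.
From mathcomp Require Import all_boot all_order all_algebra.
From mathcomp Require Import all_classical all_reals all_analysis.
From mathcomp Require Import measurable_realfun lebesgue_stieltjes_measure.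
From mathcomp Require Import complex ring lra.

Set Implicit Arguments.
Unset Strict Implicit.
Unset Printing Implicit Defensive.

Import Order.TTheory GRing.Theory Num.Theory.
Import numFieldNormedType.Exports.
Local Open Scope classical_set_scope.
Local Open Scope ring_scope.

(** * Lebesgue measure on tuples *)

(** Where [d >= 3] enters: the intersection of two thin shells lies in a shell cut by a slab, whose
    slices are annuli of dimension [d - 1], and an annulus cut out by the squared radius has volume
    linear in its width only from dimension 2 on. A triple of shell points then costs [r], [r^2] and
    [r^d], and returning to the sphere divides by [r^3]. In the energy two balls of radii [r(x)],
    [r(u)] meet. The volume of the smaller cancels its weight, so only the larger radius, say
    [r(x)], survives; for fixed [x] the other three points obey a triple condition of size [r(x)^d],
    which cancels the last weight. Hence any radius function is allowed. Duality goes through a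
    pointwise inequality with a free parameter [k] in place of Hoelder: it gives
    [dl (N + k) + k^-3 Q], with [dl] the integral of [|g|^p], and [dl] tends to 0 first, [k] to
    infinity afterwards. Two identities are known on Schwartz functions only, the weak form defining
    [F] and the values of [T]; a monotone class argument starting from explicit smooth bumps carries
    them to [sgn(G) W] and to [f_m]. *)

Section prodm.
Local Open Scope ereal_scope.
Context d1 d2 (T1 : measurableType d1) (T2 : measurableType d2) (R : realType).
Variable m1 : {sigma_finite_measure set T1 -> \bar R}.
Variable m2 : {sigma_finite_measure set T2 -> \bar R}.

(* a copy of [m1 \x m2] for which sigma-finiteness is inferred *)
Definition prodm : set (T1 * T2) -> \bar R := (m1 \x m2).

HB.instance Definition _ := Measure.copy prodm (m1 \x m2).

Lemma prodm_sigma_finite : sigma_finite setT prodm.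
Proof.
have /sigma_finiteP[F [TF ndF Foo]] := sigma_finiteT m1.
have /sigma_finiteP[G [TG ndG Goo]] := sigma_finiteT m2.
exists (fun n => F n `*` G n).
  rewrite -setXTT TF TG predeqE => -[x y]; split.
    move=> [/= [n _ Fnx] [k _ Gky]]; exists (maxn n k) => //; split.
    - by move: x Fnx; exact/subsetPset/ndF/leq_maxl.
    - by move: y Gky; exact/subsetPset/ndG/leq_maxr.
  by move=> [n _ []/= ? ?]; split; exists n.
move=> k; have [? ?] := Foo k; have [? ?] := Goo k.
split; first exact: measurableX.
by rewrite /prodm product_measure1E// lte_mul_pinfty// ge0_fin_numE.
Qed.

HB.instance Definition _ := Measure_isSigmaFinite.Build _ _ _ prodm
  prodm_sigma_finite.

End prodm.

Section leb1.
Context (R : realType).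

(* [lebesgue_measure] lives on [measurableTypeR R], whose display differs from
   the one of the canonical measurable structure of [R] used for tuples. *)
Let idR : measurableTypeR R -> R := idfun.

Let measurable_idR : measurable_fun setT idR.
Proof. by move=> _ A mA; rewrite setTI. Qed.

Definition leb1 : set R -> \bar R := pushforward (@lebesgue_measure R) idR.

HB.instance Definition _ := Measure.copy leb1
  (measure_function_pushforward__canonical__measure_function_Measure
    (@lebesgue_measure R) measurable_idR).

Lemma leb1_sigma_finite : sigma_finite setT leb1.
Proof.
have [F FT Foo] := sigma_finiteT (@lebesgue_measure R).
by exists F.
Qed.

HB.instance Definition _ := Measure_isSigmaFinite.Build _ _ _ leb1
  leb1_sigma_finite.

Lemma ge0_integral_leb1 (f : R -> \bar R) :
  measurable_fun setT f -> (forall x, 0 <= f x)%E ->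
  (\int[leb1]_x f x = \int[lebesgue_measure]_x f x)%E.
Proof.
by move=> mf f0; rewrite ge0_integral_pushforward//.
Qed.

Lemma integral_leb1 (f : R -> \bar R) : measurable_fun setT f ->
  (\int[leb1]_x f x = \int[lebesgue_measure]_x f x)%E.
Proof.
move=> mf; rewrite integralE [RHS]integralE; congr (_ - _)%E.
- by apply: ge0_integral_leb1 => //; exact: measurable_funepos.
- by apply: ge0_integral_leb1 => //; exact: measurable_funeneg.
Qed.

End leb1.

Section cons_measure.
Context (R : realType) (n : nat).

Definition tcons (p : R * n.-tuple R) : n.+1.-tuple R := [tuple of p.1 :: p.2].

Lemma measurable_tcons : measurable_fun setT tcons.
Proof. exact: measurable_cons. Qed.

Lemma tcons_thead_behead (x : n.+1.-tuple R) : tcons (thead x, [tuple of behead x]) = x.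
Proof. by rewrite /tcons /= -tuple_eta. Qed.

Lemma tconsK : cancel tcons (fun x => (thead x, [tuple of behead x])).
Proof.
by case=> t s; rewrite /tcons/= theadE; congr pair; exact: val_inj.
Qed.

Variable m : {sigma_finite_measure set (n.-tuple R) -> \bar R}.

(** Putting the new coordinate at the head makes integration unfold in the order in which [iint]
    recurses. *)
Definition cons_measure : set (n.+1.-tuple R) -> \bar R :=
  pushforward (prodm (@leb1 R) m) tcons.

HB.instance Definition _ := Measure.copy cons_measure
  (measure_function_pushforward__canonical__measure_function_Measure
    (prodm (@leb1 R) m) measurable_tcons).

Lemma cons_measure_sigma_finite : sigma_finite setT cons_measure.
Proof.
have [F FT Foo] := sigma_finiteT (prodm (@leb1 R) m).
exists (fun i => tcons @` F i).
  apply/seteqP; split=> // x _.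
  have : [set: R * n.-tuple R] (thead x, [tuple of behead x]) by [].
  rewrite FT => -[i _ Fi]; exists i => //; eexists; first exact: Fi.
  exact: tcons_thead_behead.
move=> i; have [mF Fioo] := Foo i.
have E : tcons @` F i = (fun x : n.+1.-tuple R => (thead x, [tuple of behead x])) @^-1` F i.
  apply/seteqP; split=> [x [[t s] Fts <-]|x Fx] /=.
    by rewrite tconsK.
  by exists (thead x, [tuple of behead x]) => //; exact: tcons_thead_behead.
split.
  rewrite E -[X in measurable X]setTI; apply: measurable_fun_pair => //=.
    exact: measurable_tnth.
  exact: measurable_behead.
rewrite /cons_measure /pushforward.
rewrite (_ : _ @^-1` _ = F i)//; apply/seteqP; split=> x /=; last by exists x.
by move=> [y Fy] /(can_inj tconsK) <-.
Qed.

HB.instance Definition _ := Measure_isSigmaFinite.Build _ _ _ cons_measure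
  cons_measure_sigma_finite.

End cons_measure.

Section dirac_sigma_finite.
Context (R : realType) d (T : measurableType d) (a : T).

(** A renamed Dirac mass to which a sigma-finite instance can be attached; on the one-point space of
    0-tuples it starts the recursion of [lebn]. *)
Definition sdirac : set T -> \bar R := \d_a.
HB.instance Definition _ := Measure.on sdirac.

Lemma sdirac_sigma_finite : sigma_finite setT sdirac.
Proof.
exists (fun=> setT); first by rewrite bigcup_const//; exists 0%N.
by move=> i; split => //; rewrite /sdirac diracT ltry.
Qed.

HB.instance Definition _ := Measure_isSigmaFinite.Build _ _ _ sdirac
  sdirac_sigma_finite.
End dirac_sigma_finite.

(** Realises the iterated integral [iint] by a sigma-finite measure, which gives access to Tonelli,
    Fubini and the convergence theorems. *)
Fixpoint lebn (R : realType) (n : nat) :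
    {sigma_finite_measure set (n.-tuple R) -> \bar R} :=
  match n with
  | 0 => @sdirac R _ _ [tuple]
  | n'.+1 => cons_measure (lebn R n')
  end.

Section lebn_theory.
Context (R : realType).
Local Open Scope ereal_scope.
Local Notation leb := (@leb1 R).

Lemma lebn0_integral (g : 0.-tuple R -> \bar R) : \int[lebn R 0]_x g x = g [tuple].
Proof.
have -> : g = cst (g [tuple]) by apply/funext => x; rewrite (tuple0 x).
rewrite integral_cst//=.
by rewrite /sdirac diracT mule1.
Qed.

Lemma lebnS_integral n (g : n.+1.-tuple R -> \bar R) :
  measurable_fun setT g -> (forall x, 0 <= g x) ->
  \int[lebn R n.+1]_x g x =
  \int[leb]_t \int[lebn R n]_s g [tuple of t :: s].
Proof.
move=> mg g0; rewrite /= ge0_integral_pushforward//; last first.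
  exact: measurable_tcons.
rewrite preimage_setT fubini_tonelli1//; last by move=> x; exact: g0.
by apply: measurableT_comp => //; exact: measurable_tcons.
Qed.

Lemma measurable_section_tcons n d (T : measurableType d) (g : n.+1.-tuple R -> T) t :
  measurable_fun setT g ->
  measurable_fun setT (fun s : n.-tuple R => g [tuple of t :: s]).
Proof.
move=> mg; apply: (measurableT_comp mg).
exact: (@measurable_cons _ _ _ _ (cst t) _ id).
Qed.

(** Needs neither sign nor integrability: the integral is by definition the difference of those of
    the positive and negative parts, and Tonelli gives the measurability of each. *)
Lemma measurable_integral_param d d' (T : measurableType d) (T' : measurableType d')
   (m : {sigma_finite_measure set T' -> \bar R}) (h : T * T' -> \bar R) :
  measurable_fun setT h -> measurable_fun setT (fun x => \int[m]_t h (x, t)).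
Proof.
move=> mh.
under eq_fun do rewrite integralE.
apply: emeasurable_funB.
- under eq_fun do under eq_integral do rewrite funepos_comp/=.
  apply: (measurable_fun_fubini_tonelli_F (h^\+)%E) => //.
  exact: measurable_funepos.
- under eq_fun do under eq_integral do rewrite funeneg_comp/=.
  apply: (measurable_fun_fubini_tonelli_F (h^\-)%E) => //.
  exact: measurable_funeneg.
Qed.

Lemma iint_ge0E n (g : n.-tuple R -> \bar R) :
  measurable_fun setT g -> (forall x, 0 <= g x) ->
  iint g = \int[lebn R n]_x g x.
Proof.
elim: n g => [|n IH] g mg g0; first by rewrite lebn0_integral.
rewrite lebnS_integral//= integral_leb1.
  apply: eq_integral => t _.
  by rewrite IH//; exact: measurable_section_tcons.
apply: (@measurable_integral_param _ _ _ _ (lebn R n) (g \o @tcons R n)).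
by apply: measurableT_comp => //; exact: measurable_tcons.
Qed.

(** The parameter space is arbitrary because the induction moves one coordinate of the tuple into it
    at each step. *)
Lemma measurable_iint d (T : measurableType d) n (g : T * n.-tuple R -> \bar R) :
  measurable_fun setT g -> measurable_fun setT (fun x => iint (fun s => g (x, s))).
Proof.
elim: n d T g => [|n IH] d T g mg /=.
  by apply: (measurableT_comp mg); exact: measurable_fun_pair.
pose h (y : T * R) := iint (fun s => g (y.1, [tuple of y.2 :: s])).
have mh : measurable_fun setT h.
  apply: (IH _ _ (fun z : (T * R) * n.-tuple R => g (z.1.1, [tuple of z.1.2 :: z.2]))).
  apply: (measurableT_comp mg); apply: measurable_fun_pair => /=.
    exact: measurableT_comp.
  by apply: measurable_cons => //; exact: measurableT_comp.
rewrite (_ : (fun _ => _) = (fun x => \int[leb]_t h (x, t))).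
  exact: measurable_integral_param.
apply/funext => x; rewrite integral_leb1//.
by apply: (measurableT_comp mh); exact: pair1_measurable.
Qed.

Lemma lebnS_integrable n (g : n.+1.-tuple R -> \bar R) :
  (lebn R n.+1).-integrable setT g -> (prodm leb (lebn R n)).-integrable setT (g \o @tcons R n).
Proof.
move=> /integrableP[mg goo]; apply/integrableP; split.
  by apply: (measurableT_comp mg); exact: measurable_tcons.
move: goo; rewrite /= ge0_integral_pushforward//; last exact: measurableT_comp.
exact: measurable_tcons.
Qed.

(** By Fubini only almost every section is integrable, so the induction hypothesis applies for
    almost every head coordinate; this suffices for the outer integral. *)
Lemma iint_integrableE n (g : n.-tuple R -> \bar R) :
  (lebn R n).-integrable setT g -> iint g = \int[lebn R n]_x g x.
Proof.
elim: n g => [|n IH] g ig; first by rewrite lebn0_integral.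
have mg := measurable_int _ ig.
have ig' := lebnS_integrable ig.
rewrite [RHS]/= integral_pushforward//; last exact: measurable_tcons.
rewrite preimage_setT -integral12_prod_meas1//=.
have mi : measurable_fun setT (fun t => iint (fun s : n.-tuple R => g [tuple of t :: s])).
  apply: (@measurable_iint _ _ n (fun z => g (tcons z))).
  by apply: (measurableT_comp mg); exact: measurable_tcons.
rewrite -integral_leb1//; apply: ae_eq_integral => //.
- exact: (measurable_fubini_F ig').
- have := ae_integrable1 ig'; apply: filterS => t /= igt _.
  by rewrite IH.
Qed.

End lebn_theory.

Section leb1_affine.
Context (R : realType).
Local Open Scope ereal_scope.

(** By uniqueness of Lebesgue measure it is enough to compare both sides on half-open intervals,
    which an increasing affine map pulls back to half-open intervals. *)
Lemma lebesgue_measure_affine (c a : R) (A : set R) : (0 < c)%R -> measurable A ->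
  lebesgue_measure A =
  c%:E * lebesgue_measure ((fun t : R => (c * t + a)%R) @^-1` A).
Proof.
move=> c0 mA.
pose phi : measurableTypeR R -> measurableTypeR R := fun t => (c * t + a)%R.
have mphi : measurable_fun setT phi.
  apply: measurable_funD => //; apply: measurable_funM => //.
pose nu := mscale (NngNum (ltW c0))
  (measure_function_pushforward__canonical__measure_function_Measure
    (@lebesgue_measure R) mphi).
rewrite (@lebesgue_measure_unique _ nu)// => X /ocitvP[->|[[x y]/= xy ->]].
  by rewrite !measure0.
rewrite /nu /mscale/= /pushforward.
rewrite (_ : _ @^-1` _ = `]((x - a) / c)%R, ((y - a) / c)%R]%classic); last first.
  apply/seteqP; split => t /=; rewrite !in_itv/= /phi ltr_pdivrMr// ler_pdivlMr//;
  by rewrite ltrBlDr lerBrDr (mulrC t).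
rewrite !lebesgue_measure_itv/= !lte_fin ltr_pM2r ?invr_gt0// ltrD2r xy.
rewrite -!EFinD -EFinM; congr EFin.
by rewrite -mulrBl opprB addrA subrK mulrCA divff ?mulr1 ?gt_eqF.
Qed.

Lemma ge0_integral_leb1_affine (c a : R) (f : R -> \bar R) : (0 < c)%R ->
  measurable_fun setT f -> (forall x, 0 <= f x) ->
  \int[@leb1 R]_x f x = c%:E * \int[@leb1 R]_x f (c * x + a)%R.
Proof.
move=> c0 mf f0.
pose phi : R -> R := fun t => (c * t + a)%R.
have mphi : measurable_fun setT phi.
  by apply: measurable_funD => //; exact: measurable_funM.
pose nu := mscale (NngNum (ltW c0))
  (measure_function_pushforward__canonical__measure_function_Measure
    (@leb1 R) mphi).
rewrite (@eq_measure_integral _ _ _ _ nu); last first.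
  by move=> A mA _; exact: lebesgue_measure_affine.
rewrite ge0_integral_mscale//=; congr (_ * _).
rewrite ge0_integral_pushforward//.
Qed.

End leb1_affine.

Section vectors.
Context (R : realType).

Definition vadd n (x y : n.-tuple R) : n.-tuple R := [tuple tnth x i + tnth y i | i < n].
Definition vsub n (x y : n.-tuple R) : n.-tuple R := [tuple tnth x i - tnth y i | i < n].
Definition vscale n (c : R) (x : n.-tuple R) : n.-tuple R := [tuple c * tnth x i | i < n].

Lemma tnth_vadd n (x y : n.-tuple R) i : tnth (vadd x y) i = tnth x i + tnth y i.
Proof. by rewrite tnth_mktuple. Qed.

Lemma tnth_vsub n (x y : n.-tuple R) i : tnth (vsub x y) i = tnth x i - tnth y i.
Proof. by rewrite tnth_mktuple. Qed.

Lemma tnth_vscale n c (x : n.-tuple R) i : tnth (vscale c x) i = c * tnth x i.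
Proof. by rewrite tnth_mktuple. Qed.

Definition tnthE := (tnth_vadd, tnth_vsub, tnth_vscale).

Lemma tnth_tcons0 n t (s : n.-tuple R) : tnth [tuple of t :: s] ord0 = t.
Proof. by []. Qed.

Lemma tnth_tconsS n t (s : n.-tuple R) i : tnth [tuple of t :: s] (lift ord0 i) = tnth s i.
Proof. exact: tnthS. Qed.

Lemma eq_tuple_cons n (x y : n.+1.-tuple R) : tnth x ord0 = tnth y ord0 ->
  (forall i, tnth x (lift ord0 i) = tnth y (lift ord0 i)) -> x = y.
Proof.
move=> xy0 xyS; apply: eq_from_tnth => i.
by case: (unliftP ord0 i) => [j|] ->.
Qed.

Lemma vadd_tcons n t (s : n.-tuple R) (a : n.+1.-tuple R) :
  vadd [tuple of t :: s] a = [tuple of t + thead a :: vadd s [tuple of behead a]].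
Proof.
apply: eq_tuple_cons => [|i].
  by rewrite tnth_vadd tnth_tcons0.
rewrite tnth_vadd tnth_tconsS tnth_tconsS tnth_vadd; congr (_ + _).
by rewrite [in LHS](tuple_eta a) tnthS.
Qed.

Lemma vscale_tcons n c t (s : n.-tuple R) :
  vscale c [tuple of t :: s] = [tuple of c * t :: vscale c s].
Proof.
by apply: eq_tuple_cons => [|i]; rewrite tnth_vscale ?tnth_tconsS ?tnth_vscale.
Qed.

Lemma measurable_vadd d (T : measurableType d) n (f g : T -> n.-tuple R) :
  measurable_fun setT f -> measurable_fun setT g ->
  measurable_fun setT (fun x => vadd (f x) (g x)).
Proof.
move=> mf mg; apply/measurable_fun_tnthP => i.
rewrite (_ : _ \o _ = fun x => tnth (f x) i + tnth (g x) i); last first.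
  by apply/funext => x /=; rewrite tnth_vadd.
apply: measurable_funD; apply: (measurableT_comp (measurable_tnth i)) => //.
Qed.

Lemma measurable_vsub d (T : measurableType d) n (f g : T -> n.-tuple R) :
  measurable_fun setT f -> measurable_fun setT g ->
  measurable_fun setT (fun x => vsub (f x) (g x)).
Proof.
move=> mf mg; apply/measurable_fun_tnthP => i.
rewrite (_ : _ \o _ = fun x => tnth (f x) i - tnth (g x) i); last first.
  by apply/funext => x /=; rewrite tnth_vsub.
apply: measurable_funB; apply: (measurableT_comp (measurable_tnth i)) => //.
Qed.

Lemma measurable_vscale d (T : measurableType d) n (c : T -> R) (f : T -> n.-tuple R) :
  measurable_fun setT c -> measurable_fun setT f ->
  measurable_fun setT (fun x => vscale (c x) (f x)).
Proof.
move=> mc mf; apply/measurable_fun_tnthP => i.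
rewrite (_ : _ \o _ = fun x => c x * tnth (f x) i); last first.
  by apply/funext => x /=; rewrite tnth_vscale.
by apply: measurable_funM => //; apply: (measurableT_comp (measurable_tnth i)).
Qed.

Lemma measurable_dotp d (T : measurableType d) n (f g : T -> n.-tuple R) :
  measurable_fun setT f -> measurable_fun setT g ->
  measurable_fun setT (fun x => dotp (f x) (g x)).
Proof.
move=> mf mg; apply: measurable_sum => i; rewrite /Defs.coord.
by apply: measurable_funM; apply: (measurableT_comp (measurable_tnth i)).
Qed.

Lemma measurable_sqrt d (T : measurableType d) (f : T -> R) :
  measurable_fun setT f -> measurable_fun setT (fun x => Num.sqrt (f x)).
Proof.
move=> mf; apply: (measurableT_comp _ mf).
by apply: continuous_measurable_fun; exact: sqrt_continuous.
Qed.

Lemma measurable_enorm d (T : measurableType d) n (f : T -> n.-tuple R) :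
  measurable_fun setT f -> measurable_fun setT (fun x => enorm (f x)).
Proof. by move=> mf; apply: measurable_sqrt; exact: measurable_dotp. Qed.

Lemma edist_enorm n (x y : n.-tuple R) : Defs.edist x y = enorm (vsub x y).
Proof.
rewrite /Defs.edist /enorm /dotp; congr Num.sqrt; apply: eq_bigr => i _.
by rewrite /Defs.coord tnth_vsub expr2.
Qed.

End vectors.

Section lebn_invariance.
Context (R : realType).
Local Open Scope ereal_scope.
Local Notation leb := (@leb1 R).

Lemma lebn_translate n (a : n.-tuple R) (g : n.-tuple R -> \bar R) :
  measurable_fun setT g -> (forall x, 0 <= g x) ->
  \int[lebn R n]_x g (vadd x a) = \int[lebn R n]_x g x.
Proof.
elim: n a g => [|n IH] a g mg g0.
  by rewrite !lebn0_integral; congr g; exact: tuple0.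
have mt : measurable_fun setT (fun x => g (vadd x a)).
  by apply: (measurableT_comp mg); exact: measurable_vadd.
rewrite (lebnS_integral mt (fun=> g0 _)) (lebnS_integral mg g0).
transitivity (\int[leb]_t \int[lebn R n]_s g [tuple of (t + thead a)%R :: s]).
  apply: eq_integral => t _.
  rewrite -[RHS](IH [tuple of behead a])//; last exact: measurable_section_tcons.
  by apply: eq_integral => s _; rewrite vadd_tcons.
rewrite [RHS](@ge0_integral_leb1_affine _ 1 (thead a))//; last 2 first.
- apply: (@measurable_integral_param _ _ _ _ _ (lebn R n) (g \o @tcons R n)).
  by apply: measurableT_comp => //; exact: measurable_tcons.
- by move=> t; exact: integral_ge0.
by rewrite mul1e; under [RHS]eq_integral do rewrite mul1r.
Qed.

Lemma lebn_dilate n (c : R) (g : n.-tuple R -> \bar R) : (0 < c)%R ->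
  measurable_fun setT g -> (forall x, 0 <= g x) ->
  \int[lebn R n]_x g x = (c ^+ n)%:E * \int[lebn R n]_x g (vscale c x).
Proof.
move=> c0; elim: n g => [|n IH] g mg g0.
  by rewrite !lebn0_integral mul1e; congr g; exact/esym/tuple0.
have ms : measurable_fun setT (fun x => g (vscale c x)).
  by apply: (measurableT_comp mg); exact: measurable_vscale.
rewrite (lebnS_integral ms (fun=> g0 _)) (lebnS_integral mg g0).
rewrite (ge0_integral_leb1_affine 0 c0); last 2 first.
- apply: (@measurable_integral_param _ _ _ _ _ (lebn R n) (g \o @tcons R n)).
  by apply: measurableT_comp => //; exact: measurable_tcons.
- by move=> t; exact: integral_ge0.
rewrite exprS EFinM -muleA; congr (_ * _).
rewrite -ge0_integralZl//; last 3 first.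
- apply: (@measurable_integral_param _ _ _ _ _ (lebn R n) (fun p => g (vscale c (@tcons R n p)))).
  by apply: (measurableT_comp ms); exact: measurable_tcons.
- by move=> t _; exact: integral_ge0.
- by rewrite lee_fin exprn_ge0// ltW.
apply: eq_integral => t _; rewrite addr0 IH//; last exact: measurable_section_tcons.
by congr (_ * _); apply: eq_integral => s _; rewrite vscale_tcons.
Qed.

End lebn_invariance.

(** * Euclidean geometry *)

Section ind.
Context (R : realType).
Local Open Scope ereal_scope.

(** A boolean argument turns products of indicators into [&&] and inequalities between them into
    implications. *)
Definition ind (b : bool) : \bar R := (b%:R)%:E.

Lemma ind_ge0 b : 0 <= ind b.
Proof. by rewrite lee_fin ler0n. Qed.

Lemma ind_le1 b : ind b <= 1.
Proof. by rewrite lee_fin lern1 leq_b1. Qed.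

Lemma le_ind (b c : bool) : (b -> c) -> ind b <= ind c.
Proof. by rewrite lee_fin ler_nat; case: b c => [] [] //= /(_ isT). Qed.

Lemma ind_and b c : ind (b && c) = ind b * ind c.
Proof. by case: b c => [] [] /=; rewrite /ind ?mule0 ?mul0e ?mule1. Qed.

Lemma measurable_ind d (T : measurableType d) (b : T -> bool) :
  measurable_fun setT b -> measurable_fun setT (fun x => ind (b x)).
Proof.
move=> mb; rewrite (_ : (fun _ => _) = fun x => if b x then 1%E else 0%E).
  exact: measurable_fun_ifT.
by apply/funext => x; case: (b x).
Qed.

Lemma integral_indE d (T : measurableType d) (m : {measure set T -> \bar R}) (b : T -> bool) :
  measurable_fun setT b -> \int[m]_x ind (b x) = m [set x | b x].
Proof.
move=> mb; have mB : measurable [set x | b x].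
  by rewrite -[X in measurable X]setTI; exact: (mb measurableT [set true]).
rewrite (_ : m _ = m ([set x | b x] `&` setT)); last by rewrite setIT.
rewrite -integral_indic//.
apply: eq_integral => x _; rewrite /ind indicE; congr ((nat_of_bool _)%:R%:E).
by apply/idP/idP => [bx|/set_mem//]; rewrite inE.
Qed.

End ind.
Arguments ind {R} b.
#[global] Hint Resolve ind_ge0 : core.

Section euclid.
Context (R : realType) (n : nat).
Implicit Types x y z : n.-tuple R.

Lemma dotpC x y : dotp x y = dotp y x.
Proof. by apply: eq_bigr => i _; rewrite mulrC. Qed.

Lemma dotpDl x y z : dotp (vadd x y) z = dotp x z + dotp y z.
Proof.
by rewrite /dotp -big_split; apply: eq_bigr => i _; rewrite /Defs.coord tnth_vadd mulrDl.
Qed.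

Lemma dotpBl x y z : dotp (vsub x y) z = dotp x z - dotp y z.
Proof.
by rewrite /dotp -sumrB; apply: eq_bigr => i _; rewrite /Defs.coord tnth_vsub mulrBl.
Qed.

Lemma dotpZl c x y : dotp (vscale c x) y = c * dotp x y.
Proof.
by rewrite /dotp mulr_sumr; apply: eq_bigr => i _; rewrite /Defs.coord tnth_vscale mulrA.
Qed.

Lemma dotpDr x y z : dotp z (vadd x y) = dotp z x + dotp z y.
Proof. by rewrite !(dotpC z) dotpDl. Qed.

Lemma dotpBr x y z : dotp z (vsub x y) = dotp z x - dotp z y.
Proof. by rewrite !(dotpC z) dotpBl. Qed.

Lemma dotpZr c x y : dotp y (vscale c x) = c * dotp y x.
Proof. by rewrite !(dotpC y) dotpZl. Qed.

Definition dotpE := (dotpDl, dotpDr, dotpBl, dotpBr, dotpZl, dotpZr).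

Lemma dotp_ge0 x : 0 <= dotp x x.
Proof. by apply: sumr_ge0 => i _; rewrite -expr2 sqr_ge0. Qed.

Lemma enorm_ge0 x : 0 <= enorm x.
Proof. exact: sqrtr_ge0. Qed.

Lemma enorm_sqr x : enorm x ^+ 2 = dotp x x.
Proof. by rewrite sqr_sqrtr// dotp_ge0. Qed.

Lemma dotp_eq0 x : dotp x x = 0 -> forall i, tnth x i = 0.
Proof.
move=> /eqP; rewrite psumr_eq0; last by move=> i _; rewrite -expr2 sqr_ge0.
move=> /allP h i; have /= := h i (mem_index_enum i).
by rewrite -expr2 sqrf_eq0 => /eqP.
Qed.

Lemma cauchy_schwarz x y : `|dotp x y| <= enorm x * enorm y.
Proof.
rewrite -ler_sqr ?nnegrE ?mulr_ge0 ?enorm_ge0// exprMn !enorm_sqr real_normK ?num_real//.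
have [x0|xn0] := eqVneq (dotp x x) 0.
  rewrite x0 mul0r (_ : dotp x y = 0) ?expr0n//.
  by rewrite /dotp big1// => i _; rewrite /Defs.coord (dotp_eq0 x0) mul0r.
have xp : 0 < dotp x x by rewrite lt_def xn0 dotp_ge0.
(* With [a = |x|^2], [b = <x, y>], [c = |y|^2], expanding [|a y - b x|^2 >= 0] gives
   [a (a c - b^2) >= 0]. *)
have := dotp_ge0 (vsub (vscale (dotp x x) y) (vscale (dotp x y) x)).
rewrite !dotpE (dotpC y x).
set a := dotp x x; set b := dotp x y; set c := dotp y y => h.
have {}h : 0 <= a * (a * c - b ^+ 2) by move: h; congr (_ <= _); ring.
by move: h; rewrite pmulr_rge0// subr_ge0.
Qed.

Lemma enorm_triangle x y : enorm (vadd x y) <= enorm x + enorm y.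
Proof.
rewrite -ler_sqr ?nnegrE ?addr_ge0 ?enorm_ge0// sqrrD !enorm_sqr !dotpE (dotpC y x).
have := le_trans (ler_norm _) (cauchy_schwarz x y).
by set b := dotp x y; set e := enorm x * enorm y; lra.
Qed.

Lemma enormZ c x : enorm (vscale c x) = `|c| * enorm x.
Proof. by rewrite /enorm !dotpE mulrA -expr2 sqrtrM ?sqr_ge0// sqrtr_sqr. Qed.

Lemma enorm_vsubC x y : enorm (vsub x y) = enorm (vsub y x).
Proof. by rewrite /enorm !dotpE; congr Num.sqrt; ring. Qed.

Lemma enorm_vsub_triangle x y z : enorm (vsub x z) <= enorm (vsub x y) + enorm (vsub y z).
Proof.
rewrite (_ : vsub x z = vadd (vsub x y) (vsub y z)) ?enorm_triangle//.
by apply: eq_from_tnth => i; rewrite !tnthE; ring.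
Qed.

Lemma enorm_vsub_le x y : enorm (vsub x y) <= enorm x + enorm y.
Proof.
rewrite (_ : vsub x y = vadd x (vscale (-1) y)).
  by rewrite (le_trans (enorm_triangle _ _))// enormZ normrN1 mul1r.
by apply: eq_from_tnth => i; rewrite !tnthE; ring.
Qed.

Lemma enorm_coord x i : `|tnth x i| <= enorm x.
Proof.
rewrite -ler_sqr ?nnegrE ?enorm_ge0// enorm_sqr real_normK ?num_real// /dotp (bigD1 i)//=.
rewrite expr2 lerDl; apply: sumr_ge0 => j _; by rewrite -expr2 sqr_ge0.
Qed.

End euclid.

Section ball_volume.
Context (R : realType).
Local Open Scope ereal_scope.

(** Sup-norm balls serve as the model of bounded sets: they are products of intervals, so their
    volume is explicit. *)
Definition incube n (M : R) (x : n.-tuple R) : bool := all (fun t => (`|t| <= M)%R) x.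

Lemma measurable_all d (T : measurableType d) n (P : R -> bool) (f : T -> n.-tuple R) :
  measurable_fun setT P -> measurable_fun setT f ->
  measurable_fun setT (fun x => all P (f x)).
Proof.
move=> mP; elim: n f => [|n IH] f mf.
  by rewrite (_ : (fun _ => _) = cst true)//; apply/funext => x; rewrite (tuple0 (f x)).
rewrite (_ : (fun _ => _) = fun x => P (thead (f x)) && all P [tuple of behead (f x)]).
  apply: measurable_and.
    by apply: (measurableT_comp mP); apply: (measurableT_comp (measurable_tnth ord0)).
  apply: IH; exact: (measurableT_comp (@measurable_behead _ _ n)).
by apply/funext => x; rewrite [in LHS](tuple_eta (f x)).
Qed.

Lemma measurable_incube n (M : R) : measurable_fun setT (@incube n M).
Proof.
apply: (@measurable_all _ _ n (fun t : R => (`|t| <= M)%R) id) => //.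
apply: measurable_fun_ler => //; exact: measurableT_comp.
Qed.

Lemma incubeP n M (x : n.-tuple R) : reflect (forall i, `|tnth x i| <= M)%R (incube M x).
Proof. exact: all_tnthP. Qed.

Lemma integral_leb1_itv (a b : R) : (a <= b)%R ->
  \int[@leb1 R]_t ind (a <= t <= b)%R = (b - a)%:E.
Proof.
move=> ab; rewrite integral_indE; last first.
  by apply: measurable_and; exact: measurable_fun_ler.
rewrite (_ : [set x | _] = `[a, b]%classic); last first.
  by apply/seteqP; split => t /=; rewrite in_itv.
rewrite [LHS]lebesgue_measure_itv/= lte_fin.
move: ab; rewrite le_eqVlt => /predU1P[->|->]; last by rewrite -EFinD.
by rewrite ltxx subrr.
Qed.

Lemma cube_volume n (M : R) : (0 <= M)%R ->
  \int[lebn R n]_x ind (incube M x) = ((2 * M) ^+ n)%:E.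
Proof.
move=> M0; elim: n => [|n IH].
  by rewrite lebn0_integral.
have mi k := @measurable_ind R _ _ _ (@measurable_incube k M).
rewrite lebnS_integral//; last exact: mi.
under eq_integral => t _.
  under eq_integral => s _ do rewrite /incube/= ind_and.
  rewrite ge0_integralZl// IH.
  over.
rewrite ge0_integralZr//; last 2 first.
- apply: measurable_ind; apply: measurable_fun_ler => //; exact: measurableT_comp.
- by rewrite lee_fin exprn_ge0// mulr_ge0.
rewrite exprS EFinM; congr (_ * _).
under eq_integral do rewrite ler_norml.
by rewrite integral_leb1_itv ?ge0_cp//; congr EFin; ring.
Qed.

Definition omega n : \bar R := \int[lebn R n]_x ind (enorm x < 1)%R.

Lemma measurable_ball_ind n (a : n.-tuple R) (r : R) :
  measurable_fun setT (fun x => ind (enorm (vsub x a) < r)%R : \bar R).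
Proof.
apply: measurable_ind; apply: measurable_fun_ltr => //.
by apply: measurable_enorm; exact: measurable_vsub.
Qed.

Lemma ball_volume n (a : n.-tuple R) (r : R) : (0 < r)%R ->
  \int[lebn R n]_x ind (enorm (vsub x a) < r)%R = (r ^+ n)%:E * omega n.
Proof.
move=> r0; have mb := measurable_ball_ind a r.
rewrite -(lebn_translate a)//.
have E x : vsub (vadd x a) a = x.
  by apply: eq_from_tnth => i; rewrite !tnthE addrK.
under eq_integral do rewrite E.
rewrite (lebn_dilate r0)//; last first.
  by apply: measurable_ind; apply: measurable_fun_ltr => //; exact: measurable_enorm.
congr (_ * _); apply: eq_integral => x _.
by rewrite enormZ gtr0_norm// -ltr_pdivlMl// mulVf// gt_eqF.
Qed.

Lemma omega_lty n : omega n < +oo.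
Proof.
apply: (@le_lt_trans _ _ (\int[lebn R n]_x ind (incube 1 x))); last first.
  by rewrite cube_volume// ltry.
apply: ge0_le_integral => //.
- by apply: measurable_ind; apply: measurable_fun_ltr => //; exact: measurable_enorm.
- exact: measurable_ind (@measurable_incube _ _).
- move=> x _; apply: le_ind => x1; apply/incubeP => i.
  exact: le_trans (enorm_coord _ _) (ltW x1).
Qed.

Lemma omega_gt0 n : 0 < omega n.
Proof.
(* A cube of half-side [1/(n+1)] fits into the unit ball, as [n M^2 <= n M < 1]. *)
pose M : R := (n.+1%:R^-1)%R.
have M0 : (0 < M)%R by rewrite invr_gt0 ltr0n.
apply: (@lt_le_trans _ _ (\int[lebn R n]_x ind (incube M x))).
  by rewrite cube_volume ?ltW// lte_fin exprn_gt0// mulr_gt0.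
apply: ge0_le_integral => //.
- exact: measurable_ind (@measurable_incube _ _).
- by apply: measurable_ind; apply: measurable_fun_ltr => //; exact: measurable_enorm.
- move=> x _; apply: le_ind => /incubeP xM.
  rewrite -ltr_sqr ?nnegrE ?enorm_ge0// enorm_sqr expr1n.
  apply: (@le_lt_trans _ _ (\sum_(i < n) M)%R).
    apply: ler_sum => i _; rewrite -expr2 -real_normK ?num_real// expr2.
    rewrite -[leRHS]mulr1 ler_pM//; rewrite (le_trans (xM i))//.
    by rewrite invf_le1 ?ltr0n// ler1n.
  rewrite sumr_const card_ord -mulr_natl ltr_pdivrMr ?ltr0n// mul1r.
  by rewrite ltr_nat.
Qed.

Lemma omega_fin n : omega n \is a fin_num.
Proof. by rewrite ge0_fin_numE ?omega_lty// ltW// omega_gt0. Qed.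

End ball_volume.

(** * Tonelli in two and three variables, and tools for measurability *)

Section tonelli.
Local Open Scope ereal_scope.
Context d1 d2 (T1 : measurableType d1) (T2 : measurableType d2) (R : realType).

Lemma measurable_section1 d3 (T3 : measurableType d3) (h : T1 -> T2 -> T3) (x : T1) :
  measurable_fun setT (fun p : T1 * T2 => h p.1 p.2) -> measurable_fun setT (h x).
Proof.
move=> mh; exact: (measurableT_comp mh (pair1_measurable x)).
Qed.

Lemma measurable_section2 d3 (T3 : measurableType d3) (h : T1 -> T2 -> T3) (y : T2) :
  measurable_fun setT (fun p : T1 * T2 => h p.1 p.2) -> measurable_fun setT (h ^~ y).
Proof.
move=> mh; exact: (measurableT_comp mh (pair2_measurable y)).
Qed.

Lemma measurable_swap d3 (T3 : measurableType d3) (h : T1 -> T2 -> T3) :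
  measurable_fun setT (fun p : T1 * T2 => h p.1 p.2) ->
  measurable_fun setT (fun p : T2 * T1 => h p.2 p.1).
Proof.
move=> mh; apply: (measurableT_comp mh (_ : measurable_fun setT (fun p : T2 * T1 => (p.2, p.1)))).
exact: measurable_fun_pair.
Qed.

Lemma measurable_int1 (m : {sigma_finite_measure set T2 -> \bar R}) (h : T1 -> T2 -> \bar R) :
  measurable_fun setT (fun p : T1 * T2 => h p.1 p.2) ->
  measurable_fun setT (fun x => \int[m]_y h x y).
Proof. exact: (@measurable_integral_param _ _ _ _ _ m (fun p => h p.1 p.2)). Qed.

Variables (m1 : {sigma_finite_measure set T1 -> \bar R})
  (m2 : {sigma_finite_measure set T2 -> \bar R}).

Lemma tonelli_swap (h : T1 -> T2 -> \bar R) :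
  measurable_fun setT (fun p : T1 * T2 => h p.1 p.2) -> (forall x y, 0 <= h x y) ->
  \int[m1]_x \int[m2]_y h x y = \int[m2]_y \int[m1]_x h x y.
Proof.
move=> mh h0.
have /= := @fubini_tonelli _ _ _ _ _ m1 m2 (fun p => h p.1 p.2) mh.
by rewrite /fubini_F /fubini_G/=; apply=> -[x y].
Qed.

End tonelli.

Lemma le_int d (T : measurableType d) (R : realType) (m : {measure set T -> \bar R})
    (f g : T -> \bar R) : (forall x, 0 <= f x)%E ->
  measurable_fun setT f -> measurable_fun setT g -> (forall x, f x <= g x)%E ->
  (\int[m]_x f x <= \int[m]_x g x)%E.
Proof. by move=> f0 mf mg fg; exact: ge0_le_integral. Qed.

Section tonelli3.
Local Open Scope ereal_scope.
Context d1 d2 d3 (T1 : measurableType d1) (T2 : measurableType d2)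
  (T3 : measurableType d3) (R : realType).
Variables (m1 : {sigma_finite_measure set T1 -> \bar R})
  (m2 : {sigma_finite_measure set T2 -> \bar R})
  (m3 : {sigma_finite_measure set T3 -> \bar R}).
Variable g : T1 -> T2 -> T3 -> \bar R.
Hypothesis mg : measurable_fun setT (fun p : (T1 * T2) * T3 => g p.1.1 p.1.2 p.2).
Hypothesis g0 : forall x y z, 0 <= g x y z.

Lemma tonelli_213 : \int[m1]_x \int[m2]_y \int[m3]_z g x y z =
  \int[m2]_y \int[m1]_x \int[m3]_z g x y z.
Proof.
rewrite tonelli_swap; first by [].
- exact: (@measurable_int1 _ _ _ _ _ m3 (fun (t : T1 * T2) z => g t.1 t.2 z)).
- by move=> x y; exact: integral_ge0.
Qed.

Lemma tonelli_312 : \int[m1]_x \int[m2]_y \int[m3]_z g x y z =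
  \int[m3]_z \int[m1]_x \int[m2]_y g x y z.
Proof.
transitivity (\int[m1]_x \int[m3]_z \int[m2]_y g x y z).
  apply: eq_integral => x _; apply: tonelli_swap; last by move=> y z; exact: g0.
  apply: (measurableT_comp mg (_ : measurable_fun setT (fun p : T2 * T3 => ((x, p.1), p.2)))).
  by apply: measurable_fun_pair => //; exact: measurable_fun_pair.
rewrite tonelli_swap; first by [].
- apply: (@measurable_int1 _ _ _ _ _ m2 (fun (t : T1 * T3) y => g t.1 y t.2)).
  apply: (measurableT_comp mg (_ : measurable_fun setT
    (fun p : (T1 * T3) * T2 => ((p.1.1, p.2), p.1.2)))).
  apply: measurable_fun_pair; last exact: (measurableT_comp measurable_snd measurable_fst).
  by apply: measurable_fun_pair => //; exact: (measurableT_comp measurable_fst measurable_fst).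
- by move=> x y; exact: integral_ge0.
Qed.

Lemma int3E : \int[m1]_x \int[m2]_y \int[m3]_z g x y z =
  \int[prodm (prodm m1 m2) m3]_p g p.1.1 p.1.2 p.2.
Proof.
rewrite [RHS](fubini_tonelli1 (m1 := prodm m1 m2))//.
rewrite [RHS](fubini_tonelli1 (m1 := m1))//.
- exact: (@measurable_int1 _ _ _ _ _ m3 (fun (t : T1 * T2) z => g t.1 t.2 z)).
- by move=> x; exact: integral_ge0.
Qed.

End tonelli3.

Section scale.
Local Open Scope ereal_scope.
Context d (T : measurableType d) (R : realType) (m : {measure set T -> \bar R}).

Lemma intZl (k : \bar R) (f : T -> \bar R) : 0 <= k -> (forall x, 0 <= f x) ->
  measurable_fun setT f -> \int[m]_x (k * f x) = k * \int[m]_x f x.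
Proof. by move=> k0 f0 mf; rewrite ge0_integralZl. Qed.

Lemma intZr (k : \bar R) (f : T -> \bar R) : 0 <= k -> (forall x, 0 <= f x) ->
  measurable_fun setT f -> \int[m]_x (f x * k) = \int[m]_x f x * k.
Proof. by move=> k0 f0 mf; rewrite ge0_integralZr. Qed.

End scale.

Section measurable_misc.
Context d (T : measurableType d).

Lemma measurable_fst_comp d1 d2 (T1 : measurableType d1) (T2 : measurableType d2)
  (f : T -> T1 * T2) : measurable_fun setT f -> measurable_fun setT (fun x => (f x).1).
Proof. by move=> mf; exact: measurableT_comp. Qed.

Lemma measurable_snd_comp d1 d2 (T1 : measurableType d1) (T2 : measurableType d2)
  (f : T -> T1 * T2) : measurable_fun setT f -> measurable_fun setT (fun x => (f x).2).
Proof. by move=> mf; exact: measurableT_comp. Qed.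

Lemma measurable_tnth_comp (R : realType) n (f : T -> n.-tuple R) i :
  measurable_fun setT f -> measurable_fun setT (fun x => tnth (f x) i).
Proof. by move=> mf; exact: (measurableT_comp (measurable_tnth i)). Qed.

Lemma measurable_app d1 d2 (T1 : measurableType d1) (T2 : measurableType d2)
  (g : T1 -> T2) (f : T -> T1) : measurable_fun setT g -> measurable_fun setT f ->
  measurable_fun setT (fun x => g (f x)).
Proof. by move=> mg mf; exact: measurableT_comp. Qed.

Lemma measurable_funN' (R : realType) (f : T -> R) :
  measurable_fun setT f -> measurable_fun setT (fun x => - f x).
Proof. by move=> mf; exact: measurableT_comp. Qed.

Lemma measurable_norm (R : realType) (f : T -> R) :
  measurable_fun setT f -> measurable_fun setT (fun x => `|f x|).
Proof. by move=> mf; exact: measurableT_comp. Qed.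

Lemma measurable_EFin' (R : realType) (f : T -> R) :
  measurable_fun setT f -> measurable_fun setT (fun x => (f x)%:E).
Proof. by move=> mf; exact/measurable_EFinP. Qed.

Lemma measurable_powR' (R : realType) (p : R) (f : T -> R) :
  measurable_fun setT f -> measurable_fun setT (fun x => powR (f x) p).
Proof. by move=> mf; exact: (measurableT_comp (measurable_powR p)). Qed.

Lemma measurable_cos' (R : realType) (f : T -> R) :
  measurable_fun setT f -> measurable_fun setT (fun x => cos (f x)).
Proof.
move=> mf; apply: (measurableT_comp _ mf).
by apply: continuous_measurable_fun; exact: continuous_cos.
Qed.

Lemma measurable_sin' (R : realType) (f : T -> R) :
  measurable_fun setT f -> measurable_fun setT (fun x => sin (f x)).
Proof.
move=> mf; apply: (measurableT_comp _ mf).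
by apply: continuous_measurable_fun; exact: continuous_sin.
Qed.

Lemma measurable_funV (R : realType) (f : T -> R) :
  measurable_fun setT f -> measurable_fun setT (fun x => (f x)^-1).
Proof.
move=> mf; apply: (measurableT_comp _ mf).
have -> : [set: R] = [set 0] `|` ~` [set 0] by rewrite setUv.
apply/measurable_funU => //; first exact: measurableC.
split; first exact: measurable_fun_set1.
apply: open_continuous_measurable_fun; first exact: closed_openC.
by move=> x /set_mem /= /eqP x0; exact: inv_continuous.
Qed.

End measurable_misc.

(** One structural step towards measurability, chosen by the head symbol of the function; [meas]
    iterates it after exposing that head by eta-expansion. *)
Ltac meas1 :=
  lazymatch goal with
  | |- measurable_fun _ (fun x => x) => exact: measurable_id
  | |- measurable_fun _ (fun x => fst (@?f x)) => apply: measurable_fst_comp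
  | |- measurable_fun _ (fun x => snd (@?f x)) => apply: measurable_snd_comp
  | |- measurable_fun _ (fun x => pair (@?f x) (@?g x)) => apply: measurable_fun_pair
  | |- measurable_fun _ (fun x => tnth (@?f x) ?i) => apply: measurable_tnth_comp
  | |- measurable_fun _ (fun x => vadd (@?f x) (@?g x)) => apply: measurable_vadd
  | |- measurable_fun _ (fun x => vsub (@?f x) (@?g x)) => apply: measurable_vsub
  | |- measurable_fun _ (fun x => vscale (@?f x) (@?g x)) => apply: measurable_vscale
  | |- measurable_fun _ (fun x => dotp (@?f x) (@?g x)) => apply: measurable_dotp
  | |- measurable_fun _ (fun x => enorm (@?f x)) => apply: measurable_enorm
  | |- measurable_fun _ (fun x => Num.sqrt (@?f x)) => apply: measurable_sqrt
  | |- measurable_fun _ (fun x => GRing.add (@?f x) (GRing.opp (@?g x))) => apply: measurable_funB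
  | |- measurable_fun _ (fun x => GRing.add (@?f x) (@?g x)) => apply: measurable_funD
  | |- measurable_fun _ (fun x => GRing.mul (@?f x) (@?g x)) => apply: measurable_funM
  | |- measurable_fun _ (fun x => GRing.exp (@?f x) ?n) => apply: measurable_funX
  | |- measurable_fun _ (fun x => GRing.opp (@?f x)) => apply: measurable_funN'
  | |- measurable_fun _ (fun x => GRing.inv (@?f x)) => apply: measurable_funV
  | |- measurable_fun _ (fun x => Num.norm (@?f x)) => apply: measurable_norm
  | |- measurable_fun _ (fun x => cos (@?f x)) => apply: measurable_cos'
  | |- measurable_fun _ (fun x => sin (@?f x)) => apply: measurable_sin'
  | |- measurable_fun _ (fun x => powR (@?f x) ?p) => apply: measurable_powR'
  | |- measurable_fun _ (fun x => ind (@?f x)) => apply: measurable_ind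
  | |- measurable_fun _ (fun x => Order.lt (@?f x) (@?g x)) => apply: measurable_fun_ltr
  | |- measurable_fun _ (fun x => Order.le (@?f x) (@?g x)) => apply: measurable_fun_ler
  | |- measurable_fun _ (fun x => andb (@?f x) (@?g x)) => apply: measurable_and
  | |- measurable_fun _ (fun x => orb (@?f x) (@?g x)) => apply: measurable_or
  | |- measurable_fun _ (fun x => negb (@?f x)) => apply: measurable_neg
  | |- measurable_fun _ (fun x => EFin (@?f x)) => apply: measurable_EFin'
  | |- measurable_fun _ (fun x => mule (@?f x) (@?g x)) => apply: emeasurable_funM
  | |- measurable_fun _ (fun x => adde (@?f x) (@?g x)) => apply: emeasurable_funD
  | |- measurable_fun _ (fun x => integral _ _ _) => apply: measurable_int1
  | |- measurable_fun _ (fun x => ?g (@?f x)) =>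
      first [match goal with H : measurable_fun _ g |- _ => apply: (measurable_app H) end
            |exact: measurable_cst]
  | |- measurable_fun _ _ => exact: measurable_cst
  end.
Ltac meas_eta :=
  lazymatch goal with
  | |- measurable_fun _ (fun _ => _) => fail
  | |- measurable_fun ?D ?f => change (measurable_fun D (fun x => f x))
  end.
Ltac meas := repeat first [assumption | progress cbv beta | meas_eta | meas1].

(** * Rotations, slabs and shells *)

Section rotation.
Context (R : realType) (n : nat).
Local Open Scope ereal_scope.
Implicit Types x y u v : n.-tuple R.

(* Uniqueness of Haar measure: evaluating
   [\int_x \int_y 1_(|y| < 1) g (U x + y)] in both orders compares
   [\int g (U x)] with [\int g], and [U] preserves the unit ball. *)
Lemma lebn_isometry (U : n.-tuple R -> n.-tuple R) (g : n.-tuple R -> \bar R) :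
  measurable_fun setT U ->
  (forall x y, U (vadd x y) = vadd (U x) (U y)) ->
  (forall x y, U (vsub x y) = vsub (U x) (U y)) ->
  (forall x, U (U x) = x) -> (forall x, enorm (U x) = enorm x) ->
  measurable_fun setT g -> (forall x, 0 <= g x) ->
  \int[lebn R n]_x g (U x) = \int[lebn R n]_x g x.
Proof.
move=> mU UD UB UK Uiso mg g0.
have mgU : measurable_fun setT (fun x => g (U x)) by meas.
pose b (y : n.-tuple R) : \bar R := ind (enorm y < 1)%R.
have mb : measurable_fun setT b by rewrite /b; meas.
have b0 y : 0 <= b y by exact: ind_ge0.
(* The volume of the unit ball is positive and finite, hence cancels. *)
suff : omega R n * \int[lebn R n]_x g (U x) = omega R n * \int[lebn R n]_x g x.
  have op := omega_gt0 R n; have of_ := omega_fin R n.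
  move=> E; rewrite -[LHS]mul1e -[RHS]mul1e.
  have -> : 1 = (fine (omega R n))^-1%:E * omega R n :> \bar R.
    rewrite -[X in _ * X](fineK of_) -EFinM mulVf//.
    by rewrite gt_eqF// fine_gt0// op omega_lty.
  by rewrite -!muleA E.
transitivity (\int[lebn R n]_y \int[lebn R n]_x (b y * g (vadd (U x) y))).
  rewrite -ge0_integralZr//; last by apply: integral_ge0.
  apply: eq_integral => y _; rewrite ge0_integralZl//; last by meas.
  (* Translate by [U y]: since [U] is an involution, [U (x + U y) = U x + y]. *)
  congr (_ * _); rewrite -(lebn_translate (U y))//.
  by apply: eq_integral => x _; rewrite UD UK.
rewrite tonelli_swap; last 2 first.
- by meas.
- by move=> x y; exact: mule_ge0.
transitivity (\int[lebn R n]_x \int[lebn R n]_y (b (vsub y (U x)) * g y)).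
  apply: eq_integral => x _.
  rewrite -[RHS](lebn_translate (U x)); last 2 first.
  - by meas.
  - by move=> y; exact: mule_ge0.
  apply: eq_integral => y _; congr (b _ * g _).
    by apply: eq_from_tnth => i; rewrite !tnthE addrK.
  by apply: eq_from_tnth => i; rewrite !tnthE addrC.
rewrite tonelli_swap; last 2 first.
- by meas.
- by move=> x y; exact: mule_ge0.
rewrite -ge0_integralZl//; last by rewrite ltW// omega_gt0.
apply: eq_integral => y _; rewrite intZr; [|exact: g0|by move=> x; exact: b0|by meas].
(* Since [|y - U x| = |U y - x|], the integral in [x] is the volume of a unit ball centred at
   [U y]. *)
congr (_ * _); rewrite -[RHS]mul1e -[X in X * _](_ : ((1 : R) ^+ n)%:E = 1); last by rewrite expr1n.
rewrite -(ball_volume (U y) ltr01); apply: eq_integral => x _.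
by rewrite /b -(Uiso (vsub y _)) UB UK enorm_vsubC.
Qed.

(** Reflection in the hyperplane orthogonal to [u]. At [u = 0] the convention [0^-1 = 0] makes it
    the identity. *)
Definition householder u x : n.-tuple R :=
  vsub x (vscale (2 * dotp x u / dotp u u)%R u).

Lemma householderD u x y : householder u (vadd x y) = vadd (householder u x) (householder u y).
Proof. by apply: eq_from_tnth => i; rewrite !tnthE !dotpE; ring. Qed.

Lemma householderB u x y : householder u (vsub x y) = vsub (householder u x) (householder u y).
Proof. by apply: eq_from_tnth => i; rewrite !tnthE !dotpE; ring. Qed.

Lemma dotp_householder u x y : dotp (householder u x) (householder u y) = dotp x y.
Proof.
rewrite !dotpE (dotpC u y); have [u0|u0] := eqVneq (dotp u u) 0%R.
  by rewrite u0 invr0; ring.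
by field.
Qed.

Lemma householderK u x : householder u (householder u x) = x.
Proof.
apply: eq_from_tnth => i; rewrite !tnthE !dotpE; have [u0|u0] := eqVneq (dotp u u) 0%R.
  by rewrite u0 invr0; ring.
by field.
Qed.

End rotation.

Section slab.
Context (R : realType).
Local Open Scope ereal_scope.

Definition vbase0 n : n.+1.-tuple R := [tuple of 1%R :: nseq n 0%R].

Lemma dotp_vbase0 n (x : n.+1.-tuple R) : dotp x (vbase0 n) = tnth x ord0.
Proof.
rewrite /dotp big_ord_recl /Defs.coord /= tnth_tcons0 mulr1 big1 ?addr0// => i _.
rewrite (_ : tnth (vbase0 n) _ = 0%R) ?mulr0//.
by rewrite (tnth_nth 0%R) /= nth_nseq; case: ifP.
Qed.

(** The reflection along [u = v - |v| e_0] sends [v] to [|v| e_0], because [|u|^2 = 2 <v, u>]. If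
    the two vectors coincide then [u = 0] and the reflection is the identity. *)
Lemma exists_rotation n (v : n.+1.-tuple R) :
  exists u, forall x, dotp x v = (enorm v * tnth (householder u x) ord0)%R.
Proof.
pose u := vsub v (vscale (enorm v) (vbase0 n)); exists u => x.
suff hv : householder u v = vscale (enorm v) (vbase0 n).
  by rewrite -(dotp_householder u) hv dotpZr dotp_vbase0.
have vv := enorm_sqr v.
have b1 : dotp (vbase0 n) (vbase0 n) = 1%R by rewrite dotp_vbase0.
have uu : dotp u u = (2 * dotp v u)%R.
  by rewrite /u !dotpE b1 (dotpC (vbase0 n) v) -vv; ring.
apply: eq_from_tnth => i; rewrite !tnthE.
have [u0|u0] := eqVneq (dotp u u) 0%R.
  have := dotp_eq0 u0 i; rewrite !tnthE => /eqP; rewrite subr_eq0 => /eqP <-.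
  by rewrite u0 invr0; ring.
by rewrite -uu divff// mul1r; ring.
Qed.

Lemma dotp_tcons n t (s : n.-tuple R) :
  dotp [tuple of t :: s] [tuple of t :: s] = (t ^+ 2 + dotp s s)%R.
Proof.
rewrite /dotp big_ord_recl /Defs.coord /= tnth_tcons0 expr2; congr (_ + _)%R.
by apply: eq_bigr => i _; rewrite !tnth_tconsS.
Qed.

Let cball n (t : R) : \bar R := \int[lebn R n]_x ind (dotp x x <= t)%R.

Let measurable_cball n t : measurable_fun setT (fun x : n.-tuple R => ind (dotp x x <= t)%R : \bar R).
Proof. by meas. Qed.

(** The plane is the dimension in which volume is proportional to the squared radius, so annuli
    described by the squared radius have area proportional to their width. *)
Let cball_dilate t : (0 < t)%R -> cball 2 t = t%:E * cball 2 1.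
Proof.
move=> t0; rewrite /cball.
have st : (0 < Num.sqrt t)%R by rewrite sqrtr_gt0.
rewrite (lebn_dilate st)// sqr_sqrtr; last exact: ltW.
congr (_ * _); apply: eq_integral => x _; rewrite !dotpE mulrA -expr2 sqr_sqrtr; last exact: ltW.
by rewrite -[X in (_ <= X)%R]mulr1 ler_pM2l.
Qed.

Let cball_lty n : cball n 1 < +oo.
Proof.
apply: (@le_lt_trans _ _ (\int[lebn R n]_x ind (incube 1 x))); last first.
  by rewrite cube_volume// ltry.
apply: ge0_le_integral => //.
- by meas.
- exact: measurable_ind (@measurable_incube _ _ _).
- move=> x _; apply: le_ind => x1; apply/incubeP => i.
  apply: le_trans (enorm_coord _ _) _.
  by rewrite -ler_sqr ?nnegrE ?enorm_ge0// enorm_sqr expr1n.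
Qed.

(** In the plane the area is a difference of two discs. In higher dimension, fixing one coordinate
    [t] leaves an annulus with [a] replaced by [a - t^2], and the bound is uniform in [a]. On the
    line the length could be of order [sqrt l], so the induction cannot start earlier. *)
Lemma annulus_volume n : (2 <= n)%N -> exists2 C : R, (0 <= C)%R & forall a l : R, (0 <= l)%R ->
  \int[lebn R n]_x ind ((a < dotp x x <= a + l) && (dotp x x <= 1))%R <= (C * l)%:E.
Proof.
elim: n => [//|[//|n] IH _]; case: n IH => [_|n IH].
  pose D := fine (cball 2 1).
  have DE : cball 2 1 = D%:E by rewrite fineK// ge0_fin_numE ?cball_lty//; exact: integral_ge0.
  have D0 : (0 <= D)%R by rewrite fine_ge0//; exact: integral_ge0.
  exists D => // a l; rewrite le_eqVlt => /predU1P[<-|l0].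
    rewrite mulr0 integral0_eq// => x _.
    by rewrite addr0; case: ltP => //= h; rewrite leNgt h.
  apply: (@le_trans _ _ (\int[lebn R 2]_x ind (a < dotp x x <= a + l)%R)).
    apply: ge0_le_integral => //; [by meas|by meas|].
    by move=> x _; apply: le_ind => /andP[].
  have [a0|a0] := leP a 0%R.
    apply: (@le_trans _ _ (cball 2 l)); last by rewrite cball_dilate// DE -EFinM mulrC.
    apply: ge0_le_integral => //; [by meas|by meas|].
    move=> x _; apply: le_ind => /andP[_ h]; lra.
  have al : (0 < a + l)%R by rewrite addr_gt0.
  have : cball 2 (a + l) = cball 2 a + \int[lebn R 2]_x ind (a < dotp x x <= a + l)%R.
    rewrite /cball -ge0_integralD//; [|by meas|by meas].
    apply: eq_integral => x _; rewrite /ind -EFinD -natrD; congr (_%:R%:E).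
    by case: (leP (dotp x x) a) => /= h; [rewrite (le_trans h) ?lerDl ?ltW|].
  rewrite (cball_dilate al) (cball_dilate a0) DE -!EFinM.
  case: (\int[_]_x _) => [r [E]| |]//=.
  by rewrite lee_fin; lra.
have [//|C C0 h] := IH.
exists (2 * C)%R => [|a l l0]; first by rewrite mulr_ge0.
rewrite lebnS_integral//; last by meas.
apply: (@le_trans _ _ (\int[@leb1 R]_t (ind (`|t| <= 1)%R * (C * l)%:E))).
  apply: ge0_le_integral => //.
  - by move=> t _; exact: integral_ge0.
  - apply: (@measurable_integral_param _ _ _ _ _ (lebn R n.+2)
      (fun p => ind ((a < dotp (tcons p) (tcons p) <= a + l) && (dotp (tcons p) (tcons p) <= 1))%R)).
    have := @measurable_tcons R n.+2 => mt; by meas.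
  - by meas.
  move=> t _; have [t1|t1] := leP `|t|%R 1%R.
    rewrite mul1e; apply: le_trans (h (a - t ^+ 2)%R l l0).
    apply: ge0_le_integral => //; [|by meas|].
      apply: (@measurable_section_tcons _ _ _ _
        (fun x => ind ((a < dotp x x <= a + l) && (dotp x x <= 1))%R)).
      by meas.
    move=> s _; apply: le_ind; rewrite dotp_tcons; have := sqr_ge0 t; set tt := (t ^+ 2)%R; lra.
  rewrite mul0e integral0_eq// => s _; rewrite dotp_tcons.
  case: andP => // -[_ h1]; exfalso.
  have : (t ^+ 2 <= 1)%R by have := dotp_ge0 s; lra.
  by rewrite -real_normK ?num_real// -[X in (_ <= X)%R](expr1n _ 2) ler_sqr ?nnegrE// leNgt t1.
rewrite ge0_integralZr//; [|by meas|by rewrite lee_fin mulr_ge0].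
under eq_integral do rewrite ler_norml.
by rewrite integral_leb1_itv ?ge0_cp// -EFinM lee_fin; lra.
Qed.

(** Rotate [v] onto the first axis: the slab confines the first coordinate to an interval of length
    [k / |v|], and each slice is an annulus in dimension [n >= 2]. This is where the ambient
    dimension must be at least 3. *)
Lemma slab_volume n : (2 <= n)%N -> exists2 C : R, (0 <= C)%R &
  forall (v : n.+1.-tuple R) (a l b k : R), (0 < enorm v)%R -> (0 <= l)%R -> (0 <= k)%R ->
  \int[lebn R n.+1]_x ind [&& (a < dotp x x <= a + l)%R, (dotp x x <= 1)%R &
     (b <= dotp x v <= b + k)%R] <= (C * l * (k / enorm v))%:E.
Proof.
move=> /annulus_volume[C C0 h]; exists C => // v a l b k v0 l0 k0.
have [u hu] := exists_rotation v.
pose g (x : n.+1.-tuple R) : \bar R := ind [&& (a < dotp x x <= a + l)%R, (dotp x x <= 1)%R &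
     (b <= enorm v * tnth x ord0 <= b + k)%R].
have mg : measurable_fun setT g by rewrite /g; meas.
have g0 x : 0 <= g x by exact: ind_ge0.
rewrite (_ : integral _ _ _ = \int[lebn R n.+1]_x g (householder u x)); last first.
  by apply: eq_integral => x _; rewrite /g dotp_householder -hu.
rewrite lebn_isometry//; last 5 first.
- by rewrite /householder; meas.
- exact: householderD.
- exact: householderB.
- exact: householderK.
- by move=> x; rewrite /enorm dotp_householder.
rewrite lebnS_integral//.
apply: (@le_trans _ _ (\int[@leb1 R]_t ((C * l)%:E * ind (b / enorm v <= t <= (b + k) / enorm v)%R))).
  apply: ge0_le_integral => //.
  - by move=> t _; exact: integral_ge0.
  - apply: (@measurable_integral_param _ _ _ _ _ (lebn R n) (g \o @tcons R n)).
    by have := @measurable_tcons R n => mt; apply: measurableT_comp.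
  - by meas.
  move=> t _; apply: (@le_trans _ _ (\int[lebn R n]_s (ind (b / enorm v <= t <= (b + k) / enorm v)%R *
    ind ((a - t ^+ 2 < dotp s s <= a - t ^+ 2 + l) && (dotp s s <= 1))%R))).
    apply: ge0_le_integral => //; [|by meas|].
      exact: measurable_section_tcons.
    move=> s _; rewrite -ind_and /g; apply: le_ind; rewrite dotp_tcons tnth_tcons0.
    rewrite ler_pdivrMr// ler_pdivlMr// (mulrC t).
    have := sqr_ge0 t; set tt := (t ^+ 2)%R; lra.
  rewrite ge0_integralZl//; last by meas.
  by rewrite [leLHS]muleC; exact: (lee_wpmul2r (ind_ge0 _ _) (h _ _ l0)).
rewrite ge0_integralZl//; [|by meas|by rewrite lee_fin mulr_ge0].
rewrite [leRHS]EFinM; apply: lee_wpmul2l; first by rewrite lee_fin mulr_ge0.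
rewrite integral_leb1_itv; last by rewrite ler_pM2r ?invr_gt0// lerDl.
by rewrite lee_fin -mulrBl (addrC b) addrK.
Qed.

End slab.

(** * Triples of points in thin shells *)

Section shells.
Context (R : realType) (n : nat).
Hypothesis n2 : (2 <= n)%N.
Local Open Scope ereal_scope.
Local Notation V := (n.+1.-tuple R).
Local Notation mu := (lebn R n.+1).

(** The thickening is one-sided because the cone that defines the surface measure lies inside the
    unit ball. *)
Definition shell (r : R) (x : V) : bool := (1 - r < enorm x <= 1)%R.

Lemma measurable_shell d (T : measurableType d) r (f : T -> V) :
  measurable_fun setT f -> measurable_fun setT (fun x => shell r (f x)).
Proof. by move=> mf; rewrite /shell; meas. Qed.

Lemma shell_dotp r x : (0 <= r <= 1)%R -> shell r x -> (1 - 2 * r < dotp x x <= 1)%R.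
Proof.
move=> r01 /andP[h1 h2]; have x0 := enorm_ge0 x; rewrite -enorm_sqr.
by apply/andP; split; nra.
Qed.

Lemma shell_volume : exists2 C : R, (0 <= C)%R &
  forall r : R, (0 <= r <= 1)%R -> \int[mu]_x ind (shell r x) <= (C * r)%:E.
Proof.
have [C C0 h] := @annulus_volume R n.+1 (leqW n2).
exists (C * 2)%R => [|r r01]; first exact: mulr_ge0.
have r20 : (0 <= 2 * r)%R by lra.
rewrite -mulrA; apply: le_trans (h (1 - 2 * r)%R _ r20).
apply: le_int => //.
- by apply: measurable_ind; exact: measurable_shell.
- by meas.
- by move=> x; apply: le_ind => /(shell_dotp r01); lra.
Qed.

(** The difference of [|x|^2] and [|x - v|^2] is affine in [x], so lying in both shells confines [x]
    to a slab of width [O(r)] orthogonal to [v]. The constant is [96 = 2 * 12 * 4]: annulus width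
    [2 r], slab width [12 r], and [1 / |v| <= 4]. *)
Lemma two_shells_volume : exists2 C : R, (0 <= C)%R &
  forall (r : R) (v : V), (0 < r <= 20^-1)%R -> (4^-1 <= enorm v)%R ->
  \int[mu]_x ind (shell r x && (1 - 5 * r <= enorm (vsub x v) <= 1 + 5 * r)%R)
    <= (C * r ^+ 2)%:E.
Proof.
have [C C0 h] := @slab_volume R n n2.
exists (C * 96)%R => [|r v /andP[r0 r1] v4]; first exact: mulr_ge0.
have v0 : (0 < enorm v)%R by lra.
have r20 : (0 <= 2 * r)%R by lra.
have r12 : (0 <= 12 * r)%R by lra.
apply: (@le_trans _ _ (C * (2 * r) * (12 * r / enorm v))%:E); last first.
  rewrite lee_fin.
  have : ((enorm v)^-1 <= 4)%R by rewrite invf_ple ?posrE.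
  have : (0 < (enorm v)^-1)%R by rewrite invr_gt0.
  set i := (enorm v)^-1%R => i0 i4.
  rewrite (_ : C * 96 * r ^+ 2 = C * (2 * r) * (12 * r * 4))%R; last by ring.
  apply: ler_wpM2l; first by rewrite mulr_ge0.
  by apply: ler_wpM2l.
(* From [2 <x, v> = |x|^2 + |v|^2 - |x - v|^2], with [|x|^2] in [(1 - 2r, 1]] and [|x - v|^2] in
   [[1 - 10r, 1 + 12r]], the number [<x, v> - |v|^2 / 2] lies in [[-7r, 5r]]. *)
apply: le_trans (h v (1 - 2 * r)%R (2 * r)%R (dotp v v / 2 - 7 * r)%R _ v0 r20 r12).
apply: le_int => //.
- apply: measurable_ind; apply: measurable_and; first exact: measurable_shell.
  by meas.
- by meas.
move=> x; apply: le_ind => /andP[/shell_dotp xs].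
have {xs} := xs ltac:(lra) => xs.
move=> /andP[h1 h2].
have e2 := enorm_sqr (vsub x v); have e0 := enorm_ge0 (vsub x v).
move: e2; rewrite !dotpE (dotpC v x); set e := enorm _ in h1 h2 e0 *.
set xx := dotp x x in xs *; set xv := dotp x v; set vv := dotp v v => e2.
have l1 : (1 - 10 * r <= e ^+ 2)%R by nra.
have l2 : (e ^+ 2 <= 1 + 12 * r)%R by nra.
by apply/and3P; split; lra.
Qed.

(** The configuration that [two_shells_volume] measures, with the separation of the centres [0] and
    [v] built in. *)
Let sel (r : R) (v a : V) : bool :=
  [&& shell r a, (4^-1 <= enorm v)%R & (1 - 5 * r <= enorm (vsub a v) <= 1 + 5 * r)%R].

Let measurable_sel r d (T : measurableType d) (f g : T -> V) :
  measurable_fun setT f -> measurable_fun setT g ->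
  measurable_fun setT (fun x => sel r (f x) (g x)).
Proof.
move=> mf mg; rewrite /sel; apply: measurable_and; first exact: measurable_shell.
by meas.
Qed.

(** From the inside out: [b] lies in a ball of radius [4 r], [a] in two shells with separated
    centres, [o] in one shell, which gives [r^(n+1)], [r^2] and [r]. The bounds do not depend on the
    centres, so [f] and [c] may be arbitrary measurable maps, and one statement serves several
    orders of the three points. *)
Let triple_core : exists2 C : R, (0 <= C)%R &
  forall (r : R) (f : V -> V) (c : V -> V -> V), (0 < r <= 20^-1)%R ->
  measurable_fun setT f -> measurable_fun setT (fun p : V * V => c p.1 p.2) ->
  \int[mu]_o \int[mu]_a \int[mu]_b
     ind [&& shell r o, sel r (f o) a & (enorm (vsub b (c o a)) < 4 * r)%R]
    <= (C * r ^+ (n.+1 + 3))%:E.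
Proof.
have [C1 C10 h1] := shell_volume.
have [C2 C20 h2] := two_shells_volume.
pose w := fine (omega R n.+1).
have w0 : (0 <= w)%R by rewrite fine_ge0// ltW// omega_gt0.
exists (C1 * C2 * (4 ^+ n.+1 * w))%R => [|r f c r01 mf mc].
  by rewrite !mulr_ge0// exprn_ge0.
have /andP[r0 r1] := r01.
pose B := ((4 * r) ^+ n.+1 * w)%R.
have B0 : (0 <= B)%R by rewrite mulr_ge0// exprn_ge0// mulr_ge0// ltW.
have hb o a : \int[mu]_b ind [&& shell r o, sel r (f o) a & (enorm (vsub b (c o a)) < 4 * r)%R] =
    ind (shell r o) * (ind (sel r (f o) a) * B%:E).
  under eq_integral do rewrite ind_and (ind_and _ (sel _ _ _) _).
  rewrite intZl; last 3 first.
  - exact: ind_ge0.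
  - by move=> b; rewrite mule_ge0.
  - by meas.
  rewrite intZl; [|exact: ind_ge0|by move=> b; exact: ind_ge0|by meas].
  by rewrite ball_volume ?mulr_gt0// /B EFinM fineK ?omega_fin.
under eq_integral => o _ do under eq_integral => a _ do rewrite hb.
apply: (@le_trans _ _ (\int[mu]_o (ind (shell r o) * (C2 * r ^+ 2 * B)%:E))).
  apply: le_int.
  - by move=> o; apply: integral_ge0 => a _; rewrite !mule_ge0.
  - apply: measurable_int1; apply: emeasurable_funM.
      by apply: measurable_ind; apply: measurable_shell; meas.
    apply: emeasurable_funM; last by meas.
    by apply: measurable_ind; apply: measurable_sel; meas.
  - apply: emeasurable_funM; last by meas.
    by apply: measurable_ind; apply: measurable_shell; meas.
  have ms o : measurable_fun setT (fun a => ind (sel r (f o) a) : \bar R).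
    by apply: measurable_ind; apply: measurable_sel; meas.
  move=> o; rewrite intZl; last 3 first.
  - exact: ind_ge0.
  - by move=> a; rewrite mule_ge0.
  - by apply: emeasurable_funM; [exact: ms|meas].
  apply: lee_wpmul2l; first exact: ind_ge0.
  rewrite intZr; [|by rewrite lee_fin|by move=> a; exact: ind_ge0|exact: ms].
  rewrite [leRHS]EFinM; apply: lee_wpmul2r; first by rewrite lee_fin.
  have [v4|v4] := leP 4^-1%R (enorm (f o)).
    apply: le_trans (h2 r (f o) r01 v4); apply: le_int.
    - by move=> a; exact: ind_ge0.
    - exact: ms.
    - apply: measurable_ind; apply: measurable_and; first exact: measurable_shell.
      by meas.
    - by move=> a; apply: le_ind => /and3P[-> _ ->].
  rewrite integral0_eq; first by rewrite lee_fin mulr_ge0// exprn_ge0// ltW.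
  by move=> a _; rewrite /sel (leNgt 4^-1%R) v4 andbF.
rewrite intZr; last 3 first.
- by rewrite lee_fin mulr_ge0// mulr_ge0// sqr_ge0.
- by move=> o; exact: ind_ge0.
- by apply: measurable_ind; apply: measurable_shell; meas.
apply: (@le_trans _ _ ((C1 * r)%:E * (C2 * r ^+ 2 * B)%:E)).
  apply: lee_wpmul2r; first by rewrite lee_fin mulr_ge0// mulr_ge0// sqr_ge0.
  by apply: h1; lra.
rewrite -EFinM lee_fin /B exprMn exprD.
by rewrite le_eqVlt; apply/orP; left; apply/eqP; ring.
Qed.

(* One of [|y + z|], [|y - x|], [|z - x|] is bounded below on triples of the shell.
   If [|z - x|] is, fix [y]: as [z] is within [4 r] of [w + x - y], [x] lies in two
   shells, centred at [0] and [y - w], and [|y - w|] is about [|z - x|]. *)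
Lemma triple_shell_volume : exists2 C : R, (0 <= C)%R &
  forall (r : R) (w : V), (0 < r <= 40^-1)%R ->
  \int[mu]_x \int[mu]_y \int[mu]_z
     ind [&& shell r x, shell r y, shell r z & (enorm (vsub (vsub (vadd w x) y) z) < 4 * r)%R]
    <= (C * r ^+ (n.+1 + 3))%:E.
Proof.
have [C C0 h] := triple_core.
exists (C * 3)%R => [|r w r01]; first exact: mulr_ge0.
have r02 : (0 < r <= 20^-1)%R by lra.
(* Centres of the second shell and of the small ball: [fA] and [cA] are used when [x] is the outer
   variable, [fB] and [cB] when [y] or [z] is. *)
pose fA (o : V) := vadd w o.
pose fB (o : V) := vsub o w.
pose cA o a := vsub (fA o) a.
pose cB o a := vsub a (fB o).
have mfA : measurable_fun setT fA by rewrite /fA; meas.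
have mfB : measurable_fun setT fB by rewrite /fB; meas.
have mcA : measurable_fun setT (fun p : V * V => cA p.1 p.2) by rewrite /cA; meas.
have mcB : measurable_fun setT (fun p : V * V => cB p.1 p.2) by rewrite /cB; meas.
pose G f (c : V -> V -> V) o a b : \bar R :=
  ind [&& shell r o, sel r (f o) a & (enorm (vsub b (c o a)) < 4 * r)%R].
have G0 f c o a b : 0 <= G f c o a b by exact: ind_ge0.
have mG f c (p q s : (V * V) * V -> V) : measurable_fun setT f -> measurable_fun setT (fun p : V * V => c p.1 p.2) ->
    measurable_fun setT p -> measurable_fun setT q -> measurable_fun setT s ->
    measurable_fun setT (fun t => G f c (p t) (q t) (s t)).
  move=> mf mc mp mq ms; rewrite /G; apply: measurable_ind; apply: measurable_and.
    exact: measurable_shell.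
  apply: measurable_and; first by apply: measurable_sel; meas.
  apply: measurable_fun_ltr => //; apply: measurable_enorm; apply: measurable_vsub => //.
  by apply: (measurable_app mc (_ : measurable_fun setT (fun t => (p t, q t)))); meas.
have mA : measurable_fun setT (fun t : (V * V) * V => G fA cA t.1.1 t.1.2 t.2).
  by apply: mG; meas.
have mB : measurable_fun setT (fun t : (V * V) * V => G fB cB t.2 t.1.1 t.1.2).
  by apply: mG; meas.
have mC : measurable_fun setT (fun t : (V * V) * V => G fB cB t.1.2 t.1.1 t.2).
  by apply: mG; meas.
(* The core bound is taken in the orders [(x, y, z)], [(z, x, y)] and [(y, x, z)]; each is then
   rewritten as an integral over one common product, so that the three integrands can be added. *)
have hA := h r fA cA r02 mfA mcA.
have hB := h r fB cB r02 mfB mcB.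
have hC := hB.
rewrite (@int3E _ _ _ _ _ _ _ _ _ _ _ mA (fun x y z => G0 _ _ _ _ _)) in hA.
rewrite -(@tonelli_312 _ _ _ _ _ _ _ mu mu mu (fun x y z => G fB cB z x y) mB (fun x y z => G0 _ _ _ _ _)) in hB.
rewrite (@int3E _ _ _ _ _ _ _ _ _ _ (fun x y z => G fB cB z x y) mB (fun x y z => G0 _ _ _ _ _)) in hB.
rewrite -(@tonelli_213 _ _ _ _ _ _ _ mu mu mu (fun x y z => G fB cB y x z) mC (fun x y z => G0 _ _ _ _ _)) in hC.
rewrite (@int3E _ _ _ _ _ _ _ _ _ _ (fun x y z => G fB cB y x z) mC (fun x y z => G0 _ _ _ _ _)) in hC.
rewrite int3E; last 2 first.
- apply: measurable_ind; apply: measurable_and; first by apply: measurable_shell; meas.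
  apply: measurable_and; first by apply: measurable_shell; meas.
  apply: measurable_and; first by apply: measurable_shell; meas.
  by meas.
- by move=> x y z; exact: ind_ge0.
rewrite (_ : C * 3 * _ = C * r ^+ (n.+1 + 3) + C * r ^+ (n.+1 + 3) + C * r ^+ (n.+1 + 3))%R; last by ring.
rewrite !EFinD.
apply: le_trans (leeD (leeD hA hB) hC).
rewrite -ge0_integralD; [|by []|by move=> t _; exact: G0|exact: mA|by move=> t _; exact: G0|exact: mB].
rewrite -ge0_integralD; last 5 first.
- by [].
- by move=> t _; rewrite adde_ge0.
- exact: emeasurable_funD.
- by move=> t _; exact: G0.
- exact: mC.
apply: le_int.
- by move=> t; exact: ind_ge0.
- apply: measurable_ind; apply: measurable_and; first by apply: measurable_shell; meas.
  apply: measurable_and; first by apply: measurable_shell; meas.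
  apply: measurable_and; first by apply: measurable_shell; meas.
  by meas.
- by apply: emeasurable_funD => //; exact: emeasurable_funD.
move=> [[x y] z] /=.
have [/and4P[sx sy sz e4]|_] := boolP [&& _, _, _ & _]; last first.
  by rewrite !adde_ge0.
suff : [|| [&& shell r x, sel r (fA x) y & (enorm (vsub z (cA x y)) < 4 * r)%R],
  [&& shell r z, sel r (fB z) x & (enorm (vsub y (cB z x)) < 4 * r)%R] |
  [&& shell r y, sel r (fB y) x & (enorm (vsub z (cB y x)) < 4 * r)%R]].
  rewrite /G /ind -!EFinD lee_fin -!natrD ler_nat => /or3P[] ->.
  - by rewrite -addnA leq_addr.
  - by rewrite addnAC leq_addl.
  - by rewrite leq_addl.
have eA : enorm (vsub z (cA x y)) = enorm (vsub (vsub (vadd w x) y) z).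
  by rewrite enorm_vsubC.
have eB : enorm (vsub y (cB z x)) = enorm (vsub (vsub (vadd w x) y) z).
  rewrite enorm_vsubC; congr enorm; apply: eq_from_tnth => i.
  by rewrite /cB /fB !tnthE; ring.
have eC : enorm (vsub z (cB y x)) = enorm (vsub (vsub (vadd w x) y) z).
  rewrite enorm_vsubC; congr enorm; apply: eq_from_tnth => i.
  by rewrite /cB /fB !tnthE; ring.
rewrite eA eB eC e4 sx sy sz !andbT /sel sx sy !andTb.
have /andP[x1 x2] := sx; have /andP[y1 y2] := sy; have /andP[z1 z2] := sz.
pose e := vsub (vsub (vadd w x) y) z.
have tri1 (a b c : V) : (forall i, tnth a i = tnth b i + tnth c i)%R -> (enorm a <= enorm b + enorm c)%R.
  move=> abc; rewrite (_ : a = vadd b c) ?enorm_triangle//.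
  by apply: eq_from_tnth => i; rewrite tnthE.
have tri2 (a b c : V) : (forall i, tnth a i = tnth b i - tnth c i)%R -> (enorm a <= enorm b + enorm c)%R.
  move=> abc; rewrite (_ : a = vsub b c) ?enorm_vsub_le//.
  by apply: eq_from_tnth => i; rewrite tnthE.
(* As [2 x = (x - y) + (x - z) + (y + z)] has norm greater than [2 (1 - r)], one of the three
   vectors has norm at least [1/2]. *)
have b1 : (enorm (vscale 2 x) <= enorm (vsub x y) + (enorm (vsub x z) + enorm (vadd y z)))%R.
  apply: (@le_trans _ _ (enorm (vsub x y) + enorm (vadd (vsub x z) (vadd y z)))%R).
    by apply: tri1 => i; rewrite !tnthE; ring.
  by rewrite lerD2l enorm_triangle.
rewrite enormZ ger0_norm// in b1.
have a1 : (enorm (vadd y z) <= enorm (fA x) + enorm e)%R.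
  by apply: tri2 => i; rewrite /fA /e !tnthE; ring.
have a2 : (enorm (vsub y (fA x)) <= enorm z + enorm e)%R.
  by rewrite enorm_vsubC; apply: tri1 => i; rewrite /fA /e !tnthE; ring.
have a3 : (enorm z <= enorm (vsub y (fA x)) + enorm e)%R.
  by rewrite enorm_vsubC; apply: tri2 => i; rewrite /fA /e !tnthE; ring.
have c1 : (enorm (vsub x y) <= enorm (fB z) + enorm e)%R.
  by apply: tri1 => i; rewrite /fB /e !tnthE; ring.
have c2 : (enorm (vsub x (fB z)) <= enorm y + enorm e)%R.
  by apply: tri1 => i; rewrite /fB /e !tnthE; ring.
have c3 : (enorm y <= enorm (vsub x (fB z)) + enorm e)%R.
  by apply: tri2 => i; rewrite /fB /e !tnthE; ring.
have d1 : (enorm (vsub x z) <= enorm (fB y) + enorm e)%R.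
  by apply: tri1 => i; rewrite /fB /e !tnthE; ring.
have d2 : (enorm (vsub x (fB y)) <= enorm z + enorm e)%R.
  by apply: tri1 => i; rewrite /fB /e !tnthE; ring.
have d3 : (enorm z <= enorm (vsub x (fB y)) + enorm e)%R.
  by apply: tri2 => i; rewrite /fB /e !tnthE; ring.
have {}e4 : (enorm e < 4 * r)%R by [].
(* Since [e = w + x - y - z] has norm less than [4 r], the vectors [y + z], [x - y], [x - z] differ
   by less than [4 r] from the centres [w + x], [z - w], [y - w], which are therefore longer than
   [1/2 - 4 r >= 1/4]. *)
have [k1|k1] := leP 2^-1%R (enorm (vadd y z)).
  by apply/or3P; apply: Or31; clear - r01 e4 k1 a1 a2 a3 z1 z2; apply/and3P; split; lra.
have [k2|k2] := leP 2^-1%R (enorm (vsub x y)).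
  by apply/or3P; apply: Or32; clear - r01 e4 k2 c1 c2 c3 y1 y2; apply/and3P; split; lra.
have k3 : (2^-1 <= enorm (vsub x z))%R by clear - r01 x1 b1 k1 k2; lra.
by apply/or3P; apply: Or33; clear - r01 e4 k3 d1 d2 d3 z1 z2; apply/and3P; split; lra.
Qed.

End shells.

(** * Surface measure and triples of points of the sphere *)

Section integral_mrestr.
Local Open Scope ereal_scope.
Context d (T : measurableType d) (R : realType) (m : {measure set T -> \bar R}).

Lemma ge0_integral_mrestr (D : set T) (mD : measurable D) (f : T -> \bar R) :
  measurable_fun setT f -> (forall x, 0 <= f x) ->
  \int[mrestr m mD]_x f x = \int[m]_(x in D) f x.
Proof.
move=> mf f0; rewrite -(setvU D) ge0_integral_setU//; last 3 first.
- exact: measurableC.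
- by rewrite setvU.
- by rewrite /disj_set setICl.
rewrite [X in X + _](_ : _ = 0) ?add0e; last first.
  rewrite (@eq_measure_integral _ _ _ _ mzero) ?integral_measure_zero// => A mA AD.
  rewrite /= /mrestr (_ : A `&` D = set0) ?measure0//.
  by rewrite -subset0 => x [/AD].
apply: eq_measure_integral => A mA AD; rewrite /= /mrestr.
by congr (m _); exact/setIidPl.
Qed.

End integral_mrestr.

Section sphere_measure.
Context (R : realType) (d : nat).
Local Open Scope ereal_scope.
Local Notation V := (d.-tuple R).
Local Notation mu := (lebn R d).

Definition pball (x : V) : bool := (0 < enorm x <= 1)%R.

Lemma measurable_pball : measurable [set x : V | pball x].
Proof.
rewrite -[X in measurable X]setTI.
have mp : measurable_fun setT pball by rewrite /pball; meas.
exact: (mp measurableT [set true]).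
Qed.

Lemma sprojE (x : V) : sproj x = vscale (enorm x)^-1 x.
Proof. by apply: eq_from_tnth => i; rewrite !tnth_mktuple mulrC. Qed.

Lemma measurable_sproj : measurable_fun setT (@sproj R d : V -> V).
Proof.
rewrite (_ : @sproj R d = fun x : V => vscale (enorm x)^-1 x); first by meas.
by apply/funext => x; exact: sprojE.
Qed.

(** Surface measure without the normalising factor [d]: [sint] is [d] times integration against it.
    As the image of a finite measure under radial projection it is a finite measure on all of [R^d],
    carried by the sphere. *)
Definition sphm : set V -> \bar R :=
  pushforward (mrestr mu measurable_pball) (@sproj R d : V -> V).

HB.instance Definition _ := Measure.copy sphm
  (measure_function_pushforward__canonical__measure_function_Measure
    (mrestr mu measurable_pball) measurable_sproj).

Lemma sphm_fin : fin_num_fun sphm.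
Proof.
move=> A mA; rewrite ge0_fin_numE; last exact: measure_ge0.
have mB : measurable [set x : V | incube 1 x].
  rewrite -[X in measurable X]setTI.
  exact: (@measurable_incube R d 1 measurableT [set true]).
apply: (@le_lt_trans _ _ (mu [set x : V | incube 1 x])); last first.
  by rewrite -integral_indE ?cube_volume ?ltry//; exact: measurable_incube.
apply: le_measure; rewrite ?inE//.
  apply: measurableI; last exact: measurable_pball.
  by rewrite -[X in measurable X]setTI; exact: measurable_sproj.
move=> x [_ /andP[_ x1]]; apply/incubeP => i.
exact: le_trans (enorm_coord _ _) x1.
Qed.

HB.instance Definition _ := Measure_isFinite.Build _ _ _ sphm sphm_fin.

Lemma integral_sphm (g : V -> \bar R) : measurable_fun setT g -> (forall x, 0 <= g x) ->
  \int[sphm]_x g x = \int[mu]_x (ind (pball x) * g (sproj x)).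
Proof.
move=> mg g0; have ms := measurable_sproj.
rewrite ge0_integral_pushforward//.
rewrite preimage_setT (ge0_integral_mrestr mu measurable_pball (measurableT_comp mg ms) (fun=> g0 _)).
rewrite integral_mkcond; apply: eq_integral => x _.
rewrite patchE; case: ifPn => [/set_mem/= ->|/negP xp]; first by rewrite mul1e.
by case: (boolP (pball x)) => [px|_]; [case: xp; exact/mem_set|rewrite mul0e].
Qed.

Lemma sint_sphm (g : V -> \bar R) : measurable_fun setT g -> (forall x, 0 <= g x) ->
  sint g = d%:R%:E * \int[sphm]_x g x.
Proof.
move=> mg g0; have ms := measurable_sproj.
rewrite integral_sphm// /sint; congr (_ * _).
rewrite -iint_ge0E; last 2 first.
- apply: emeasurable_funM; first by rewrite /pball; meas.
  exact: (measurableT_comp mg ms).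
- by move=> x; rewrite mule_ge0.
congr (iint _); apply/funext => x; rewrite /pball.
by case: ifP => _; rewrite ?mul1e ?mul0e.
Qed.

Lemma sphere_sproj (x : V) : pball x -> (@sphere R d) (sproj x).
Proof.
move=> /andP[x0 _]; rewrite /sphere/= sprojE !dotpE -enorm_sqr.
by field; rewrite gt_eqF.
Qed.

Lemma sproj_dist (r : R) (x : V) : (r <= 1)%R -> (1 - r < enorm x <= 1)%R ->
  (enorm (vsub x (sproj x)) < r)%R.
Proof.
move=> r1 /andP[h1 h2].
have x0 : (0 < enorm x)%R by lra.
rewrite sprojE (_ : vsub _ _ = vscale (1 - (enorm x)^-1)%R x); last first.
  by apply: eq_from_tnth => i; rewrite !tnthE; ring.
rewrite enormZ -[X in (_ * X)%R]ger0_norm ?enorm_ge0// -normrM mulrBl mul1r mulVf ?gt_eqF//.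
by rewrite distrC ger0_norm ?subr_ge0//; lra.
Qed.

(* The cone over a subset of the sphere is a disjoint union of dilates of its
   part in the shell, so the shell carries a fraction [1 - (1 - r)^d >= r]. *)
Lemma integral_sphm_shell (r : R) (g : V -> \bar R) : (0 < d)%N -> (0 < r < 1)%R ->
  measurable_fun setT g -> (forall x, 0 <= g x) -> \int[sphm]_x g x < +oo ->
  r%:E * \int[sphm]_x g x <=
  \int[mu]_x (ind (1 - r < enorm x <= 1)%R * g (sproj x)).
Proof.
move=> d0 r01 mg g0 goo; have ms := measurable_sproj.
set I := \int[sphm]_x _ in goo *.
have I0 : 0 <= I by exact: integral_ge0.
have [i Ei] : exists i, I = i%:E.
  by exists (fine I); rewrite fineK// ge0_fin_numE.
have i0 : (0 <= i)%R by rewrite -lee_fin -Ei.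
pose q := (1 - r)%R; have q0 : (0 < q)%R by rewrite /q; lra.
have mgs : measurable_fun setT (fun x => g (sproj x)) by exact: measurableT_comp.
set J := leRHS.
have J0 : 0 <= J by apply: integral_ge0 => x _; rewrite mule_ge0.
have EI : I = (q ^+ d)%:E * I + J.
  have -> : (q ^+ d)%:E * I = \int[mu]_x (ind (0 < enorm x <= q)%R * g (sproj x)).
    rewrite (lebn_dilate q0); last 2 first.
    - by apply: emeasurable_funM => //; meas.
    - by move=> x; rewrite mule_ge0.
    congr (_ * _); rewrite /I integral_sphm//; apply: eq_integral => x _.
    rewrite /pball enormZ gtr0_norm//; congr (ind _ * _).
      by rewrite pmulr_rgt0// ger_pMr.
    congr g; rewrite !sprojE enormZ gtr0_norm//; apply: eq_from_tnth => k.
    rewrite !tnthE; have [->|x0] := eqVneq (enorm x) 0%R.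
      by rewrite mulr0 invr0; ring.
    by field; rewrite x0 gt_eqF.
  rewrite /J -ge0_integralD//; last 4 first.
  - by move=> x _; rewrite mule_ge0.
  - by apply: emeasurable_funM => //; meas.
  - by move=> x _; rewrite mule_ge0.
  - by apply: emeasurable_funM => //; meas.
  rewrite /I integral_sphm//; apply: eq_integral => x _.
  rewrite [RHS](_ : _ = (ind (0 < enorm x <= q)%R + ind (1 - r < enorm x <= 1)%R) * g (sproj x)); last first.
    by rewrite ge0_muleDl ?ind_ge0.
  congr (_ * _).
  rewrite /pball /ind -EFinD -natrD; congr (_%:R%:E).
  rewrite -/q; have q1 : (q <= 1)%R by rewrite /q; lra.
  have [h|h] := leP (enorm x) q; first by rewrite (le_trans h q1) andbT addn0.
  by rewrite (lt_trans q0 h).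
(* Finiteness of [I] allows solving [I = q^d I + J] for [J = (1 - q^d) I], and
   [q^d <= q = 1 - r]. *)
rewrite Ei in EI *; clearbody J; case: J EI J0 => [j EI J0|_ _|//]; last by rewrite leey.
move: EI J0; rewrite -!EFinM -EFinD => -[EI]; rewrite lee_fin => j0; rewrite lee_fin.
have : (q ^+ d <= q)%R.
  case: (d) d0 => // k _; rewrite exprS; apply: ler_piMr; first exact: ltW.
  by apply: exprn_ile1; rewrite /q; lra.
move=> qd; have : (q ^+ d * i <= q * i)%R by exact: ler_wpM2r.
rewrite /q; lra.
Qed.

End sphere_measure.

Section triple_sphere.
Context (R : realType) (n : nat).
Hypothesis n2 : (2 <= n)%N.
Local Open Scope ereal_scope.
Local Notation V := (n.+1.-tuple R).
Local Notation mu := (lebn R n.+1).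
Local Notation S := (@sphm R n.+1).

Definition vdiff4 (w x y z : V) : V := vsub (vsub (vadd w x) y) z.

Lemma measurable_vdiff4 d (T : measurableType d) (w x y z : T -> V) :
  measurable_fun setT w -> measurable_fun setT x -> measurable_fun setT y ->
  measurable_fun setT z -> measurable_fun setT (fun t => vdiff4 (w t) (x t) (y t) (z t)).
Proof. by move=> mw mx my mz; rewrite /vdiff4; meas. Qed.

Let bounded_lty (g : V -> \bar R) (M : R) : measurable_fun setT g -> (forall x, 0 <= g x <= M%:E) ->
  (0 <= M)%R -> \int[S]_x g x <= M%:E * S setT.
Proof.
move=> mg gM M0; rewrite -integral_cst//; apply: le_int => //.
by move=> x; case/andP: (gM x).
by move=> x; case/andP: (gM x).
Qed.

(** Each of the three points is spread radially over a shell of thickness [r]. This costs a factor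
    [r] per variable and moves each point by less than [r], so [< r] becomes [< 4 r]; dividing the
    shell bound [r^(d+3)] by [r^3] leaves [r^d]. *)
Lemma triple_sphere : exists2 C : R, (0 <= C)%R & forall (r : R) (w : V), (0 < r)%R ->
  \int[S]_x \int[S]_y \int[S]_z ind (enorm (vdiff4 w x y z) < r)%R <= (C * r ^+ n.+1)%:E.
Proof.
have [C C0 h] := triple_shell_volume R n2.
pose s := fine (S setT).
have sE : S setT = s%:E by rewrite fineK// sphm_fin.
have s0 : (0 <= s)%R by rewrite fine_ge0.
(* The second summand covers [r > 1/40], where the total mass bounds the integral by
   [s^3 <= s^3 (40 r)^(n+1)]. *)
exists (C + s ^+ 3 * 40 ^+ n.+1)%R => [|r w r0].
  by rewrite addr_ge0// mulr_ge0// exprn_ge0.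
have m3 : measurable_fun setT (fun p : (V * V) * V => ind (enorm (vdiff4 w p.1.1 p.1.2 p.2) < r)%R : \bar R).
  apply: measurable_ind; apply: measurable_fun_ltr => //; apply: measurable_enorm.
  by apply: measurable_vdiff4; meas.
pose g2 x y := \int[S]_z ind (enorm (vdiff4 w x y z) < r)%R.
have mg2 : measurable_fun setT (fun p : V * V => g2 p.1 p.2).
  exact: (@measurable_int1 _ _ _ _ _ S (fun (p : V * V) z => ind (enorm (vdiff4 w p.1 p.2 z) < r)%R)).
pose g1 x := \int[S]_y g2 x y.
have mg1 : measurable_fun setT g1 by exact: measurable_int1.
have g2b x y : 0 <= g2 x y <= s%:E.
  apply/andP; split; first exact: integral_ge0.
  rewrite -[leRHS]mul1e -sE; apply: bounded_lty => //.
  - exact: (@measurable_section1 _ _ _ _ _ _ (fun (p : V * V) z => ind (enorm (vdiff4 w p.1 p.2 z) < r)%R) (x, y)).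
  - by move=> z; rewrite ind_ge0 ind_le1.
have g1b x : 0 <= g1 x <= (s ^+ 2)%:E.
  apply/andP; split; first by apply: integral_ge0 => y _; case/andP: (g2b x y).
  rewrite expr2 EFinM -[X in _ * X]sE; apply: bounded_lty => //.
  exact: measurable_section1 mg2.
have [r40|r40] := ltP 40^-1%R r.
  apply: (@le_trans _ _ (s ^+ 3)%:E).
    rewrite exprSr EFinM -[X in _ * X]sE; apply: bounded_lty => //.
    by rewrite exprn_ge0.
  have e1 : (1 <= (40 * r) ^+ n.+1)%R.
    by rewrite exprn_ege1// -ler_pdivrMl// mulr1 ltW.
  rewrite lee_fin mulrDl -mulrA -exprMn.
  apply: (@le_trans _ _ (s ^+ 3 * (40 * r) ^+ n.+1)%R).
    by rewrite ler_peMr// exprn_ge0.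
  by rewrite lerDr mulr_ge0// exprn_ge0// ltW.
have r01 : (0 < r < 1)%R by lra.
have r04 : (0 < r <= 40^-1)%R by lra.
have ms := @measurable_sproj R n.+1.
pose k3 x y z := ind (shell r z) * ind (enorm (vdiff4 w x y (sproj z)) < r)%R.
have fin_lty (g : V -> \bar R) M : measurable_fun setT g -> (forall x, 0 <= g x <= M%:E) -> (0 <= M)%R ->
    \int[S]_x g x < +oo.
  by move=> mg gM M0; apply: le_lt_trans (bounded_lty mg gM M0) _; rewrite sE -EFinM ltry.
have step1 x y : r%:E * g2 x y <= \int[mu]_z (ind (shell r z) * ind (enorm (vdiff4 w x y (sproj z)) < r)%R).
  have mz : measurable_fun setT (fun z => ind (enorm (vdiff4 w x y z) < r)%R : \bar R).
    exact: (@measurable_section1 _ _ _ _ _ _ (fun (p : V * V) z => ind (enorm (vdiff4 w p.1 p.2 z) < r)%R) (x, y)).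
  apply: integral_sphm_shell => //; apply: (fin_lty _ 1%R) => //.
  by move=> z; rewrite ind_ge0 ind_le1.
have step2 x : r%:E * g1 x <= \int[mu]_y (ind (shell r y) * g2 x (sproj y)).
  have my : measurable_fun setT (g2 x) by exact: measurable_section1 mg2.
  apply: integral_sphm_shell => //; last exact: (fin_lty _ s).
  by move=> y; case/andP: (g2b x y).
have step3 : r%:E * \int[S]_x g1 x <= \int[mu]_x (ind (shell r x) * g1 (sproj x)).
  apply: integral_sphm_shell => //; last by apply: (fin_lty _ (s ^+ 2)%R) => //; rewrite exprn_ge0.
  by move=> x; case/andP: (g1b x).
have r0E : (0 <= r)%R by exact: ltW.
have -> : \int[S]_x \int[S]_y \int[S]_z ind (enorm (vdiff4 w x y z) < r)%R = \int[S]_x g1 x by [].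
have {}g2b x y : 0 <= g2 x y by case/andP: (g2b x y).
have {fin_lty} g1oo : \int[S]_x g1 x < +oo.
  by apply: (fin_lty _ (s ^+ 2)%R) => //; rewrite exprn_ge0.
have {}g1b x : 0 <= g1 x by case/andP: (g1b x).
clearbody g1 g2.
pose G x y z : \bar R := ind [&& shell r x, shell r y, shell r z & (enorm (vdiff4 w x y z) < 4 * r)%R].
have mG : measurable_fun setT (fun p : (V * V) * V => G p.1.1 p.1.2 p.2).
  apply: measurable_ind; apply: measurable_and; first by apply: measurable_shell; meas.
  apply: measurable_and; first by apply: measurable_shell; meas.
  apply: measurable_and; first by apply: measurable_shell; meas.
  apply: measurable_fun_ltr => //; apply: measurable_enorm.
  by apply: measurable_vdiff4; meas.
have G0 x y z : 0 <= G x y z by exact: ind_ge0.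
have mG2 : measurable_fun setT (fun p : V * V => \int[mu]_z G p.1 p.2 z).
  exact: (@measurable_int1 _ _ _ _ _ mu (fun (p : V * V) z => G p.1 p.2 z)).
have mG1 : measurable_fun setT (fun x => \int[mu]_y \int[mu]_z G x y z).
  exact: measurable_int1.
have key1 x y : shell r x -> shell r y -> r%:E * g2 (sproj x) (sproj y) <= \int[mu]_z G x y z.
  move=> sx sy; apply: le_trans (step1 _ _) _; apply: le_int.
  - by move=> z; rewrite mule_ge0.
  - apply: emeasurable_funM; first by apply: measurable_ind; apply: measurable_shell; meas.
    apply: measurable_ind; apply: measurable_fun_ltr => //; apply: measurable_enorm.
    by apply: measurable_vdiff4; meas.
  - exact: (@measurable_section1 _ _ _ _ _ _ (fun (p : V * V) z => G p.1 p.2 z) (x, y)).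
  move=> z; rewrite -ind_and; apply: le_ind => /andP[sz e]; rewrite sx sy sz /=.
  have dx := sproj_dist (ltW (proj2 (andP r01))) sx.
  have dy := sproj_dist (ltW (proj2 (andP r01))) sy.
  have dz := sproj_dist (ltW (proj2 (andP r01))) sz.
  have -> : vdiff4 w x y z = vsub (vsub (vadd (vdiff4 w (sproj x) (sproj y) (sproj z)) (vsub x (sproj x)))
     (vsub y (sproj y))) (vsub z (sproj z)).
    by apply: eq_from_tnth => i; rewrite /vdiff4 !tnthE; ring.
  have := enorm_vsub_le (vsub (vadd (vdiff4 w (sproj x) (sproj y) (sproj z)) (vsub x (sproj x)))
     (vsub y (sproj y))) (vsub z (sproj z)).
  have := enorm_vsub_le (vadd (vdiff4 w (sproj x) (sproj y) (sproj z)) (vsub x (sproj x)))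
     (vsub y (sproj y)).
  have := enorm_triangle (vdiff4 w (sproj x) (sproj y) (sproj z)) (vsub x (sproj x)).
  clear - dx dy dz e; lra.
have key2 x : shell r x -> (r ^+ 2)%:E * g1 (sproj x) <= \int[mu]_y \int[mu]_z G x y z.
  move=> sx; rewrite expr2 EFinM -muleA.
  apply: le_trans (lee_wpmul2l _ (step2 _)) _; first by rewrite lee_fin.
  have msy : measurable_fun setT (fun y => ind (shell r y) * g2 (sproj x) (sproj y)).
    apply: emeasurable_funM; first by apply: measurable_ind; apply: measurable_shell; meas.
    exact: (measurableT_comp (@measurable_section1 _ _ _ _ _ _ g2 (sproj x) mg2) ms).
  rewrite -intZl//; last by move=> y; rewrite mule_ge0//; exact: g2b.
  apply: le_int.
  - by move=> y; rewrite !mule_ge0// ?lee_fin//; exact: g2b.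
  - by apply: emeasurable_funM.
  - exact: (@measurable_section1 _ _ _ _ _ _ (fun x y => \int[mu]_z G x y z) x mG2).
  move=> y; have [sy|_] := boolP (shell r y); last by rewrite mul0e mule0; exact: integral_ge0.
  by rewrite mul1e; exact: key1.
have : (r ^+ 3)%:E * \int[S]_x g1 x <= (C * r ^+ (n.+1 + 3))%:E.
  rewrite exprSr EFinM -muleA.
  apply: le_trans (lee_wpmul2l _ step3) _; first by rewrite lee_fin exprn_ge0.
  apply: le_trans (h r w r04).
  have mgx : measurable_fun setT (fun x => ind (shell r x) * g1 (sproj x)).
    apply: emeasurable_funM; first by apply: measurable_ind; apply: measurable_shell; meas.
    exact: (measurableT_comp mg1 ms).
  rewrite -intZl//; last 2 first.
  - by rewrite lee_fin exprn_ge0.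
  - by move=> x; rewrite mule_ge0//; exact: g1b.
  apply: le_int.
  - by move=> x; rewrite !mule_ge0// ?lee_fin ?exprn_ge0//; exact: g1b.
  - by apply: emeasurable_funM.
  - exact: mG1.
  move=> x; have [sx|_] := boolP (shell r x); last first.
    by rewrite mul0e mule0; apply: integral_ge0 => y _; exact: integral_ge0.
  by have := key2 _ sx; rewrite mul1e /G sx.
have i0 : 0 <= \int[S]_x g1 x by exact: integral_ge0.
move: g1oo.
move: i0; case: (\int[S]_x g1 x) => [i| |]//; rewrite lee_fin => i0 _.
rewrite -EFinM !lee_fin exprD mulrA mulrC ler_pM2r ?exprn_gt0// => /le_trans; apply.
by rewrite ler_wpM2r ?exprn_ge0// lerDl mulr_ge0// exprn_ge0.
Qed.

End triple_sphere.

(** * Energy of averaged balls *)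

Local Open Scope ereal_scope.
Lemma sqr_adde (R : realType) (a b : \bar R) : 0 <= a -> 0 <= b ->
  (a + b) * (a + b) <= 2%:E * (a * a + b * b).
Proof.
case: a => [a| |]//; case: b => [b| |]// a0 b0.
- change (((a + b) * (a + b))%:E <= (2 * (a * a + b * b))%:E).
  rewrite lee_fin; have := sqr_ge0 (a - b)%R; rewrite !expr2; nra.
- by rewrite !mulyy ?addey// gt0_muley ?leey// lte_fin.
- by rewrite !mulyy ?addye// gt0_muley ?leey// lte_fin.
- by rewrite !mulyy ?addye// gt0_muley ?leey// lte_fin.
Qed.

Local Close Scope ereal_scope.

(** Autocorrelation; its Fourier transform is the squared modulus of that of [W]. *)
Definition correl (R : realType) n (W : n.-tuple R -> \bar R) (z : n.-tuple R) : \bar R :=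
  (\int[lebn R n]_y (W (vadd y z) * W y))%E.

Section energy.
Context (R : realType) (n : nat).
Hypothesis n2 : (2 <= n)%N.
Local Open Scope ereal_scope.
Local Notation V := (n.+1.-tuple R).
Local Notation mu := (lebn R n.+1).
Local Notation S := (@sphm R n.+1).

(** The intersection sits in the smaller ball, and is empty once the centres are [s + t <= 2 s] or
    more apart. *)
Lemma ball_pair_volume (a b : V) (s t : R) : (0 < t)%R -> (t <= s)%R ->
  \int[mu]_z (ind (enorm (vsub a z) < s)%R * ind (enorm (vsub b z) < t)%R) <=
  (t ^+ n.+1)%:E * omega R n.+1 * ind (enorm (vsub a b) < 2 * s)%R.
Proof.
move=> t0 ts; have o0 := ltW (omega_gt0 R n.+1).
have [ab|ab] := ltP (enorm (vsub a b)) (2 * s)%R.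
  rewrite mule1 -(ball_volume b t0); apply: le_int.
  - by move=> z; rewrite mule_ge0.
  - by meas.
  - by meas.
  - by move=> z; rewrite -ind_and (enorm_vsubC z); apply: le_ind => /andP[].
rewrite mule0 integral0_eq// => z _; rewrite -ind_and.
case: andP => // -[h1 h2]; exfalso.
have := enorm_vsub_triangle a z b; rewrite (enorm_vsubC z b).
clear - h1 h2 ab ts; lra.
Qed.

Variables (r : V -> R) (e : V -> bool).
Hypothesis mr : measurable_fun setT r.
Hypothesis me : measurable_fun setT e.
Hypothesis r0 : forall x, (0 < r x)%R.

(** The normalisation [r(x)^-d] of averages over [B(x, r(x))], restricted to the set [e] where
    averages are large. *)
Definition qweight (x : V) : R := ((e x)%:R * ((r x)^-1) ^+ n.+1)%R.

Local Notation q := qweight.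

Lemma qweight_ge0 x : (0 <= q x)%R.
Proof. by rewrite mulr_ge0// exprn_ge0// invr_ge0 ltW. Qed.

Lemma measurable_qweight : measurable_fun setT q.
Proof.
rewrite /qweight; apply: measurable_funM; last by meas.
rewrite (_ : (fun _ => _) = fun x => if e x then 1%R else 0%R); last first.
  by apply/funext => x; case: (e x).
exact: measurable_fun_ifT.
Qed.

Let mq := measurable_qweight.

(** The volume of the smaller ball cancels the weight attached to it; what is left is a closeness
    condition at the scale of the larger radius, with the weight of the larger ball. Adding the two
    alternatives makes the bound independent of which radius is larger. *)
Lemma qweight_pair (c : R) (x u a b : V) : (0 < c)%R ->
  (q x)%:E * ((q u)%:E * \int[mu]_z (ind (enorm (vsub a z) < c * r x)%R *
     ind (enorm (vsub b z) < c * r u)%R)) <=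
  (c ^+ n.+1)%:E * omega R n.+1 *
   ((q x)%:E * ind (enorm (vsub a b) < 2 * c * r x)%R +
    (q u)%:E * ind (enorm (vsub a b) < 2 * c * r u)%R).
Proof.
move=> c0; have o0 := omega_gt0 R n.+1.
have q0 y : 0 <= (q y)%:E by rewrite lee_fin qweight_ge0.
have cr y : (0 < c * r y)%R by rewrite mulr_gt0.
have co : 0 <= (c ^+ n.+1)%:E * omega R n.+1 by rewrite mule_ge0 ?lee_fin ?exprn_ge0 ?ltW.
have qE y : ((q y)%:E * ((c * r y) ^+ n.+1)%:E <= (c ^+ n.+1)%:E).
  rewrite -EFinM lee_fin /q -mulrA -exprMn mulrCA mulVf ?gt_eqF// mulr1.
  by case: (e y); rewrite ?mul1r// mul0r exprn_ge0// ltW.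
have I0 y : 0 <= (ind y : \bar R) by exact: ind_ge0.
have main s t (k1 k2 : R) (j : \bar R) (X : \bar R) : 0 <= j -> 0 <= X -> (0 <= k1)%R -> (0 <= k2)%R ->
    (k2%:E * t <= (c ^+ n.+1)%:E) -> 0 <= t -> X <= t * omega R n.+1 * s -> 0 <= s ->
   k1%:E * (k2%:E * X) <= (c ^+ n.+1)%:E * omega R n.+1 * (k1%:E * s + k2%:E * j).
  move=> j0 X0 k10 k20 kt t0 Xt s0.
  apply: (@le_trans _ _ (k1%:E * ((c ^+ n.+1)%:E * omega R n.+1 * s))).
    apply: lee_wpmul2l; first by rewrite lee_fin.
    apply: (@le_trans _ _ (k2%:E * (t * omega R n.+1 * s))).
      by apply: lee_wpmul2l => //; rewrite lee_fin.
    rewrite !muleA; apply: lee_wpmul2r => //; apply: lee_wpmul2r => //; exact: ltW.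
  rewrite muleCA; apply: lee_wpmul2l => //.
  by rewrite leeDl// mule_ge0// lee_fin.
have [ux|xu] := leP (r u) (r x).
  apply: (main _ ((c * r u) ^+ n.+1)%:E); rewrite ?qweight_ge0//.
  - by apply: integral_ge0 => z _; rewrite mule_ge0.
  - by rewrite lee_fin exprn_ge0// ltW.
  - by rewrite -mulrA; apply: ball_pair_volume => //; rewrite ler_pM2l.
rewrite muleCA addeC.
under eq_integral do rewrite muleC.
apply: (main _ ((c * r x) ^+ n.+1)%:E); rewrite ?qweight_ge0//.
- by apply: integral_ge0 => z _; rewrite mule_ge0.
- by rewrite lee_fin exprn_ge0// ltW.
- rewrite -mulrA (enorm_vsubC a b); apply: ball_pair_volume => //.
  by rewrite ler_pM2l// ltW.
Qed.

Lemma qweight_le (x : V) (c : R) : (0 <= c)%R -> (q x * (c * r x) ^+ n.+1 <= c ^+ n.+1)%R.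
Proof.
move=> c0; rewrite /q -mulrA -exprMn mulrCA mulVf ?gt_eqF// mulr1.
by case: (e x); rewrite ?mul1r// mul0r exprn_ge0.
Qed.

Local Notation S2 := (prodm S S).

Variable C : R.
Hypothesis C0 : (0 <= C)%R.
Hypothesis hC : forall (t : R) (w : V), (0 < t)%R ->
  \int[S]_x \int[S]_y \int[S]_z ind (enorm (vdiff4 w x y z) < t)%R <= (C * t ^+ n.+1)%:E.

(** Dominates the autocorrelation of [Wfun]: only the weight of one point of the pair is left. The
    map [D] is [x - y] or [y - x], according to which point carries the larger radius. *)
Definition Zfun (D : V -> V -> V) (z : V) : \bar R :=
  \int[S2]_p ((q p.1)%:E * ind (enorm (vsub (D p.1 p.2) z) < 2 * r p.1)%R).

(** Factors: [2^d omega] from balls of radius [2 r], [C 4^d] from the triple bound at scale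
    [4 r(x)], and the mass of the sphere for the remaining variable [x]. *)
Definition pair_energy_const : R :=
  (2 ^+ n.+1 * fine (omega R n.+1) * (C * 4 ^+ n.+1 * fine (S setT)))%R.

(** Expanding the square gives an integral over four points [x, y, u, v] and two balls. By
    [qweight_pair] there remains, up to symmetry, the weight of [x] and the condition
    [|x - y - u + v| < 4 r(x)]. For fixed [x] the triple bound integrates [y, u, v] to at most
    [C (4 r(x))^d], which cancels the weight. No regularity of the radius beyond measurability is
    involved. *)
Lemma pair_energy (D : V -> V -> V) :
  measurable_fun setT (fun p : V * V => D p.1 p.2) ->
  (forall x y u v, enorm (vsub (D x y) (D u v)) = enorm (vdiff4 x v y u)) ->
  \int[mu]_z (Zfun D z * Zfun D z) <= (pair_energy_const + pair_energy_const)%:E.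
Proof.
move=> mD hD; rewrite /pair_energy_const.
pose w := fine (omega R n.+1).
have w0 : (0 <= w)%R by rewrite fine_ge0// ltW// omega_gt0.
have wE : omega R n.+1 = w%:E by rewrite fineK// omega_fin.
pose s := fine (S setT).
have sE : S setT = s%:E by rewrite fineK// sphm_fin.
have s0 : (0 <= s)%R by rewrite fine_ge0.
pose K2 := (2 ^+ n.+1 * w)%R.
have K20 : (0 <= K2)%R by rewrite mulr_ge0// exprn_ge0.
rewrite -/w -/s -/K2; set Z := Zfun D.
pose A (p : V * V) z : \bar R := (q p.1)%:E * ind (enorm (vsub (D p.1 p.2) z) < 2 * r p.1)%R.
have q0 y : 0 <= (q y)%:E by rewrite lee_fin qweight_ge0.
have A0 p z : 0 <= A p z by rewrite mule_ge0.
have mA : measurable_fun setT (fun t : (V * V) * V => A t.1 t.2).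
  rewrite /A; apply: emeasurable_funM; first by meas.
  apply: measurable_ind; apply: measurable_fun_ltr; last by meas.
  apply: measurable_enorm; apply: measurable_vsub; last by meas.
  exact: (measurable_app mD).
have mAz z : measurable_fun setT (fun p => A p z) by exact: (measurable_section2 z mA).
have ZE z : Z z = \int[S2]_p A p z by [].
have Z0 z : 0 <= Z z by rewrite ZE; exact: integral_ge0.
have E1 : \int[mu]_z (Z z * Z z) = \int[S2]_p \int[S2]_u \int[mu]_z (A p z * A u z).
  rewrite (@tonelli_312 _ _ _ _ _ _ _ S2 S2 mu (fun p u z => A p z * A u z)); last 2 first.
  - apply: emeasurable_funM.
      by apply: (measurable_app mA (_ : measurable_fun setT (fun t => (t.1.1, t.2)))); meas.
    by apply: (measurable_app mA (_ : measurable_fun setT (fun t => (t.1.2, t.2)))); meas.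
  - by move=> p u z; rewrite mule_ge0.
  apply: eq_integral => z _.
  rewrite {1}ZE -(intZr _ (Z0 z) (fun p => A0 p z) (mAz z)).
  by apply: eq_integral => p _; rewrite ZE -(intZl _ (A0 p z) (fun u => A0 u z) (mAz z)).
pose B (p u : V * V) : \bar R := K2%:E * ((q p.1)%:E * ind (enorm (vsub (D p.1 p.2) (D u.1 u.2)) < 4 * r p.1)%R).
have B0 p u : 0 <= B p u.
  by apply: mule_ge0; [rewrite lee_fin|apply: mule_ge0].
have mB : measurable_fun setT (fun t : (V * V) * (V * V) => B t.1 t.2).
  rewrite /B; apply: emeasurable_funM; first by meas.
  apply: emeasurable_funM; first by meas.
  apply: measurable_ind; apply: measurable_fun_ltr; last by meas.
  apply: measurable_enorm; apply: measurable_vsub.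
    exact: (measurable_app mD).
  exact: (measurable_app mD).
have mBx p : measurable_fun setT (B p) by exact: (measurable_section1 p mB).
have mBs : measurable_fun setT (fun t : (V * V) * (V * V) => B t.2 t.1) by exact: measurable_swap.
have E2 p u : \int[mu]_z (A p z * A u z) <= B p u + B u p.
  rewrite (_ : \int[mu]_z (A p z * A u z) = (q p.1)%:E * ((q u.1)%:E * \int[mu]_z (ind (enorm (vsub (D p.1 p.2) z) < 2 * r p.1)%R *
     ind (enorm (vsub (D u.1 u.2) z) < 2 * r u.1)%R))); last first.
    have mi p' : measurable_fun setT (fun z => ind (enorm (vsub (D p'.1 p'.2) z) < 2 * r p'.1)%R : \bar R) by meas.
    rewrite -intZl//; [|by move=> z; rewrite mule_ge0|exact: emeasurable_funM].
    rewrite -intZl//; [|by move=> z; rewrite !mule_ge0|]; last first.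
      by apply: emeasurable_funM; [meas|exact: emeasurable_funM].
    by apply: eq_integral => z _; rewrite /A muleACA !muleA.
  apply: le_trans (qweight_pair _ _ _ _ _) _ => //.
  have kE : (2 ^+ n.+1)%:E * omega R n.+1 = K2%:E by rewrite wE -EFinM.
  have e4 : (2 * 2 = 4 :> R)%R by rewrite -natrM.
  rewrite kE e4 /B (enorm_vsubC (D u.1 u.2)) -[leRHS]ge0_muleDr; first by [].
  - by apply: mule_ge0; [exact: q0|exact: ind_ge0].
  - by apply: mule_ge0; [exact: q0|exact: ind_ge0].
have E3 : \int[S2]_p \int[S2]_u B p u <= (K2 * (C * 4 ^+ n.+1 * s))%:E.
  have mi p : measurable_fun setT (fun u : V * V => ind (enorm (vsub (D p.1 p.2) (D u.1 u.2)) < 4 * r p.1)%R : \bar R).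
    by meas.
  pose J (p : V * V) := \int[S2]_u ind (enorm (vsub (D p.1 p.2) (D u.1 u.2)) < 4 * r p.1)%R : \bar R.
  have J0 p : 0 <= J p by exact: integral_ge0.
  have mJ0 : measurable_fun setT (fun t : (V * V) * (V * V) => ind (enorm (vsub (D t.1.1 t.1.2) (D t.2.1 t.2.2)) < 4 * r t.1.1)%R : \bar R).
    apply: measurable_ind; apply: measurable_fun_ltr; last by meas.
    apply: measurable_enorm; apply: measurable_vsub.
      exact: (measurable_app mD).
    exact: (measurable_app mD).
  have mJ : measurable_fun setT J by exact: (measurable_int1 S2 mJ0).
  have mqJ : measurable_fun setT (fun p : V * V => (q p.1)%:E * J p).
    by apply: emeasurable_funM => //; meas.
  have EB p : \int[S2]_u B p u = K2%:E * ((q p.1)%:E * J p).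
    rewrite intZl; [|by rewrite lee_fin|by move=> u; apply: mule_ge0|by apply: emeasurable_funM; [meas|exact: mi]].
    by rewrite intZl; [|exact: q0|by move=> u; exact: ind_ge0|exact: mi].
  have qJ0 p : 0 <= (q p.1)%:E * J p by apply: mule_ge0; [exact: q0|exact: J0].
  under eq_integral do rewrite EB.
  rewrite (@intZl _ _ _ _ K2%:E (fun p => (q p.1)%:E * J p) _ qJ0 mqJ); last by rewrite lee_fin.
  rewrite [leRHS]EFinM; apply: lee_wpmul2l; first by rewrite lee_fin.
  rewrite [leLHS](fubini_tonelli1 (m1 := S) (m2 := S) _ mqJ qJ0) /fubini_F /=.
  rewrite [leRHS]EFinM -[X in _ <= _ * X]sE -[leRHS]integral_cst//.
  apply: le_int.
  - by move=> x; apply: integral_ge0 => y _; exact: (qJ0 (x, y)).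
  - exact: (@measurable_int1 _ _ _ _ _ S (fun x y => (q x)%:E * J (x, y)) mqJ).
  - by meas.
  move=> x; rewrite (@intZl _ _ _ _ (q x)%:E (fun y => J (x, y)) (q0 x) (fun y => J0 (x, y))
    (@measurable_section1 _ _ _ _ _ _ (fun x y => J (x, y)) x mJ)).
  apply: (@le_trans _ _ ((q x)%:E * (C * (4 * r x) ^+ n.+1)%:E)); last first.
    by rewrite -EFinM lee_fin mulrCA ler_wpM2l// qweight_le.
  apply: lee_wpmul2l => //.
  have r4 : (0 < 4 * r x)%R by rewrite mulr_gt0.
  apply: (@le_trans _ _ (\int[S]_v \int[S]_y \int[S]_u ind (enorm (vdiff4 x v y u) < 4 * r x)%R)); last exact: hC.
  rewrite -(@tonelli_312 _ _ _ _ _ _ _ S S S (fun y u v => ind (enorm (vdiff4 x v y u) < 4 * r x)%R)); last 2 first.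
  - by apply: measurable_ind; apply: measurable_fun_ltr; [apply: measurable_enorm; apply: measurable_vdiff4; meas|meas].
  - by move=> y u v; exact: ind_ge0.
  apply: le_int.
  - by move=> y; exact: J0.
  - exact: (@measurable_section1 _ _ _ _ _ _ (fun x y => J (x, y)) x mJ).
  - apply: (@measurable_int1 _ _ _ _ _ S (fun y u => \int[S]_v ind (enorm (vdiff4 x v y u) < 4 * r x)%R)).
    apply: (@measurable_int1 _ _ _ _ _ S (fun (t : V * V) v => ind (enorm (vdiff4 x v t.1 t.2) < 4 * r x)%R)).
    by apply: measurable_ind; apply: measurable_fun_ltr; [apply: measurable_enorm; apply: measurable_vdiff4; meas|meas].
  move=> y; rewrite /J (fubini_tonelli1 (m1 := S) (m2 := S) _ (mi (x, y)) (fun=> ind_ge0 _ _)).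
  rewrite /fubini_F le_eqVlt; apply/orP; left; apply/eqP.
  by apply: eq_integral => u _; apply: eq_integral => v _; rewrite hD.
rewrite E1 EFinD.
apply: le_trans (leeD E3 E3).
rewrite [X in _ <= _ + X]tonelli_swap//.
rewrite -ge0_integralD//; last 4 first.
- by move=> p _; exact: integral_ge0.
- exact: measurable_int1.
- by move=> p _; exact: integral_ge0.
- exact: measurable_int1.
apply: le_int.
- by move=> p; apply: integral_ge0 => u _; apply: integral_ge0 => z _; rewrite mule_ge0.
- apply: measurable_int1; apply: measurable_int1.
  apply: emeasurable_funM.
    by apply: (measurable_app mA (_ : measurable_fun setT (fun t => (t.1.1, t.2)))); meas.
  by apply: (measurable_app mA (_ : measurable_fun setT (fun t => (t.1.2, t.2)))); meas.
- by apply: emeasurable_funD; exact: measurable_int1.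
have mBy p : measurable_fun setT (fun u => B u p) by exact: (measurable_section2 p mB).
move=> p; rewrite -ge0_integralD; [|by []|by move=> u _; exact: B0|exact: mBx|by move=> u _; exact: B0|exact: mBy].
apply: le_int.
- by move=> u; apply: integral_ge0 => z _; apply: mule_ge0.
- apply: measurable_int1; apply: emeasurable_funM.
    by apply: (measurable_app mA (_ : measurable_fun setT (fun t => (p, t.2)))); meas.
  by apply: (measurable_app mA (_ : measurable_fun setT (fun t => (t.1, t.2)))); meas.
- by apply: emeasurable_funD; [exact: mBx|exact: mBy].
- by move=> u; exact: E2.
Qed.

(* Dual to the linearised averages: [\int |G| W] integrates over [e] the averages
   (up to the volume of the unit ball) of [|G|] over the balls [B(x, r x)]. *)
Definition Wfun (y : V) : \bar R := \int[S]_x ((q x)%:E * ind (enorm (vsub x y) < r x)%R).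

Let a1 (x y : V) : \bar R := (q x)%:E * ind (enorm (vsub x y) < r x)%R.

Let a10 x y : 0 <= a1 x y.
Proof. by apply: mule_ge0; [rewrite lee_fin qweight_ge0|exact: ind_ge0]. Qed.

Let ma1 : measurable_fun setT (fun p : V * V => a1 p.1 p.2).
Proof. by rewrite /a1; meas. Qed.

Lemma Wfun_ge0 y : 0 <= Wfun y.
Proof. by apply: integral_ge0 => x _; exact: a10. Qed.

Lemma measurable_Wfun : measurable_fun setT Wfun.
Proof. exact: (@measurable_int1 _ _ _ _ _ S (fun y x => a1 x y) (measurable_swap ma1)). Qed.

Lemma Zfun_ge0 D z : 0 <= Zfun D z.
Proof.
apply: integral_ge0 => p _; apply: mule_ge0; last exact: ind_ge0.
by rewrite lee_fin qweight_ge0.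
Qed.

Lemma measurable_Zfun (D : V -> V -> V) :
  measurable_fun setT (fun p : V * V => D p.1 p.2) -> measurable_fun setT (Zfun D).
Proof.
move=> mD; apply: (@measurable_int1 _ _ _ _ _ S2
  (fun z p => (q p.1)%:E * ind (enorm (vsub (D p.1 p.2) z) < 2 * r p.1)%R)).
apply: emeasurable_funM; first by meas.
apply: measurable_ind; apply: measurable_fun_ltr; last by meas.
apply: measurable_enorm; apply: measurable_vsub; last by meas.
exact: (measurable_app mD).
Qed.

Let D1 (x y : V) := vsub x y.
Let D2 (x y : V) := vsub y x.

Let mD1 : measurable_fun setT (fun p : V * V => D1 p.1 p.2).
Proof. by rewrite /D1; meas. Qed.

Let mD2 : measurable_fun setT (fun p : V * V => D2 p.1 p.2).
Proof. by rewrite /D2; meas. Qed.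

Lemma ZfunE D z : measurable_fun setT (fun p : V * V => D p.1 p.2) ->
  Zfun D z = \int[S]_x \int[S]_y ((q x)%:E * ind (enorm (vsub (D x y) z) < 2 * r x)%R).
Proof.
move=> mD; rewrite /Zfun (fubini_tonelli1 (m1 := S) (m2 := S))//.
- by meas.
- by move=> p; apply: mule_ge0; [rewrite lee_fin qweight_ge0|exact: ind_ge0].
Qed.

(** Integrating over [y] first meets balls around [x1 - z] and [x2]. [qweight_pair] with [c = 1]
    splits the result into a term weighted at [x1] and one weighted at [x2]; exchanging the
    variables in the second gives the other difference map. *)
Lemma correl_le z : correl Wfun z <= omega R n.+1 * (Zfun D1 z + Zfun D2 z).
Proof.
have o0 := ltW (omega_gt0 R n.+1).
pose g y x1 x2 := a1 x1 (vadd y z) * a1 x2 y.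
have g0 y x1 x2 : 0 <= g y x1 x2 by apply: mule_ge0; exact: a10.
have mg : measurable_fun setT (fun p : (V * V) * V => g p.1.1 p.1.2 p.2).
  apply: emeasurable_funM.
    by apply: (measurable_app ma1 (_ : measurable_fun setT (fun t => (t.1.2, vadd t.1.1 z)))); meas.
  by apply: (measurable_app ma1 (_ : measurable_fun setT (fun t => (t.2, t.1.1)))); meas.
have mg' : measurable_fun setT (fun p : (V * V) * V => g p.2 p.1.1 p.1.2).
  by apply: (measurable_app mg (_ : measurable_fun setT (fun t : (V * V) * V => ((t.2, t.1.1), t.1.2)))); meas.
have -> : correl Wfun z = \int[S]_x1 \int[S]_x2 \int[mu]_y g y x1 x2.
  rewrite (@tonelli_312 _ _ _ _ _ _ _ S S mu (fun x1 x2 y => g y x1 x2) mg' (fun _ _ _ => g0 _ _ _)).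
  apply: eq_integral => y _.
  rewrite {1}/Wfun -/(a1 _ _) -(intZr _ (Wfun_ge0 y) (fun x => a10 x (vadd y z)) (measurable_section2 _ ma1)).
  apply: eq_integral => x _.
  by rewrite /g -(intZl _ (a10 x _) (fun x => a10 x y) (measurable_section2 _ ma1)).
pose h1 x1 x2 : \bar R := (q x1)%:E * ind (enorm (vsub (D1 x1 x2) z) < 2 * r x1)%R.
pose h2 x1 x2 : \bar R := (q x2)%:E * ind (enorm (vsub (D2 x2 x1) z) < 2 * r x2)%R.
have h10 x1 x2 : 0 <= h1 x1 x2.
  by apply: mule_ge0; [rewrite lee_fin qweight_ge0|exact: ind_ge0].
have h20 x1 x2 : 0 <= h2 x1 x2.
  by apply: mule_ge0; [rewrite lee_fin qweight_ge0|exact: ind_ge0].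
have mh1 : measurable_fun setT (fun p : V * V => h1 p.1 p.2) by rewrite /h1 /D1; meas.
have mh2 : measurable_fun setT (fun p : V * V => h2 p.1 p.2) by rewrite /h2 /D2; meas.
have -> : omega R n.+1 * (Zfun D1 z + Zfun D2 z) =
    \int[S]_x1 \int[S]_x2 (omega R n.+1 * (h1 x1 x2 + h2 x1 x2)).
  rewrite (ZfunE _ mD1) (ZfunE _ mD2).
  rewrite (_ : \int[S]_x \int[S]_y ((q x)%:E * ind (enorm (vsub (D2 x y) z) < 2 * r x)%R) =
    \int[S]_x1 \int[S]_x2 h2 x1 x2); last first.
    by rewrite (tonelli_swap S S mh2 h20).
  rewrite -ge0_integralD; last 5 first.
  - by [].
  - by move=> x _; apply: integral_ge0 => y _; exact: h10.
  - exact: (measurable_int1 S mh1).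
  - by move=> x _; apply: integral_ge0 => y _; exact: h20.
  - exact: (measurable_int1 S mh2).
  have h12 x y : 0 <= h1 x y + h2 x y by apply: adde_ge0.
  have mh12 : measurable_fun setT (fun p : V * V => h1 p.1 p.2 + h2 p.1 p.2).
    exact: emeasurable_funD.
  rewrite -(@intZl _ _ _ _ (omega R n.+1) _ o0); last 2 first.
  - move=> x; apply: adde_ge0; apply: integral_ge0 => y _; [exact: h10|exact: h20].
  - by apply: emeasurable_funD; [exact: (measurable_int1 S mh1)|exact: (measurable_int1 S mh2)].
  apply: eq_integral => x _.
  rewrite (@intZl _ _ _ _ (omega R n.+1) (fun y => h1 x y + h2 x y) o0 (h12 x) (@measurable_section1 _ _ _ _ _ _ (fun x y => h1 x y + h2 x y) x mh12)).
  congr (_ * _).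
  rewrite -ge0_integralD; [by []|by []|by move=> y _; exact: h10|exact: (measurable_section1 x mh1)|by move=> y _; exact: h20|exact: (measurable_section1 x mh2)].
have mh x1 : measurable_fun setT (fun x2 => omega R n.+1 * (h1 x1 x2 + h2 x1 x2)).
  apply: emeasurable_funM; first by meas.
  by apply: emeasurable_funD; [exact: (measurable_section1 x1 mh1)|exact: (measurable_section1 x1 mh2)].
have mhh : measurable_fun setT (fun p : V * V => omega R n.+1 * (h1 p.1 p.2 + h2 p.1 p.2)).
  by apply: emeasurable_funM; [meas|exact: emeasurable_funD].
have mi2 : measurable_fun setT (fun p : V * V => \int[mu]_y g y p.1 p.2).
  exact: (@measurable_int1 _ _ _ _ _ mu (fun (p : V * V) y => g y p.1 p.2) mg').
apply: le_int.
- by move=> x1; apply: integral_ge0 => x2 _; apply: integral_ge0 => y _; exact: g0.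
- exact: (@measurable_int1 _ _ _ _ _ S (fun x1 x2 => \int[mu]_y g y x1 x2) mi2).
- exact: (@measurable_int1 _ _ _ _ _ S (fun x1 x2 => omega R n.+1 * (h1 x1 x2 + h2 x1 x2)) mhh).
move=> x1; apply: le_int.
- by move=> x2; apply: integral_ge0 => y _; exact: g0.
- exact: (@measurable_section1 _ _ _ _ _ _ (fun x1 x2 => \int[mu]_y g y x1 x2) x1 mi2).
- exact: mh.
move=> x2.
have q0 y : 0 <= (q y)%:E by rewrite lee_fin qweight_ge0.
have mi a c : measurable_fun setT (fun y : V => ind (enorm (vsub a y) < c)%R : \bar R) by meas.
rewrite (_ : \int[mu]_y g y x1 x2 = (q x1)%:E * ((q x2)%:E * \int[mu]_y (ind (enorm (vsub (vsub x1 z) y) < 1 * r x1)%R *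
     ind (enorm (vsub x2 y) < 1 * r x2)%R))); last first.
  have i0 y : 0 <= (ind (enorm (vsub (vsub x1 z) y) < 1 * r x1)%R * ind (enorm (vsub x2 y) < 1 * r x2)%R : \bar R).
    by apply: mule_ge0; exact: ind_ge0.
  have mii : measurable_fun setT (fun y => ind (enorm (vsub (vsub x1 z) y) < 1 * r x1)%R * ind (enorm (vsub x2 y) < 1 * r x2)%R : \bar R).
    by apply: emeasurable_funM; exact: mi.
  rewrite -(intZl _ (q0 x2) i0 mii).
  rewrite -(intZl _ (q0 x1)); last 2 first.
  - by move=> y; apply: mule_ge0; [exact: q0|exact: i0].
  - by apply: emeasurable_funM; [meas|exact: mii].
  apply: eq_integral => y _; rewrite /g /a1 muleACA -muleA !mul1r.
  rewrite (_ : vsub x1 (vadd y z) = vsub (vsub x1 z) y) ?muleA//.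
  by apply: eq_from_tnth => i; rewrite !tnthE; ring.
apply: le_trans (qweight_pair x1 x2 (vsub x1 z) x2 ltr01) _.
rewrite expr1n mul1e !mulr1 /h1 /h2 /D1 /D2.
rewrite (_ : vsub (vsub x1 z) x2 = vsub (vsub x1 x2) z)//.
by apply: eq_from_tnth => i; rewrite !tnthE; ring.
Qed.

(** The factor 2 comes from [(a + b)^2 <= 2 (a^2 + b^2)], the factor 4 from two functions [Zfun]
    with two symmetric terms each. *)
Lemma correl_energy : \int[mu]_z (correl Wfun z * correl Wfun z) <=
  (fine (omega R n.+1) ^+ 2 * 2 * (4 * pair_energy_const))%:E.
Proof.
set w := fine (omega R n.+1).
have w0 : (0 <= w)%R by rewrite fine_ge0// ltW// omega_gt0.
have wE : omega R n.+1 = w%:E by rewrite fineK// omega_fin.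
have c0 z : 0 <= correl Wfun z.
  by apply: integral_ge0 => y _; apply: mule_ge0; exact: Wfun_ge0.
have mW := measurable_Wfun.
have mc : measurable_fun setT (correl Wfun).
  by apply: (@measurable_int1 _ _ _ _ _ mu (fun z y => Wfun (vadd y z) * Wfun y)); meas.
have mZ1 := measurable_Zfun mD1.
have mZ2 := measurable_Zfun mD2.
apply: (@le_trans _ _ (\int[mu]_z ((w ^+ 2 * 2)%:E * (Zfun D1 z * Zfun D1 z + Zfun D2 z * Zfun D2 z)))).
  apply: le_int.
  - by move=> z; apply: mule_ge0; exact: c0.
  - by apply: emeasurable_funM; exact: mc.
  - by apply: emeasurable_funM; [exact: measurable_cst|exact: (emeasurable_funD (emeasurable_funM mZ1 mZ1) (emeasurable_funM mZ2 mZ2))].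
  move=> z; have := correl_le z; rewrite wE => h.
  apply: le_trans (lee_pmul (c0 z) (c0 z) h h) _.
  have zz := sqr_adde (Zfun_ge0 D1 z) (Zfun_ge0 D2 z).
  rewrite [leLHS]muleACA -[X in X * _]EFinM -expr2 (EFinM (w ^+ 2)) -[leRHS]muleA.
  apply: lee_wpmul2l; first by rewrite lee_fin sqr_ge0.
  exact: zz.
have ZZ0 D z : 0 <= Zfun D z * Zfun D z by apply: mule_ge0; exact: Zfun_ge0.
rewrite intZl; last 3 first.
- by rewrite lee_fin mulr_ge0// sqr_ge0.
- by move=> z; apply: adde_ge0; exact: ZZ0.
- exact: (emeasurable_funD (emeasurable_funM mZ1 mZ1) (emeasurable_funM mZ2 mZ2)).
rewrite [leRHS]EFinM; apply: lee_wpmul2l; first by rewrite lee_fin mulr_ge0// sqr_ge0.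
rewrite ge0_integralD; last 5 first.
- by [].
- by move=> z _; exact: ZZ0.
- exact: (emeasurable_funM mZ1 mZ1).
- by move=> z _; exact: ZZ0.
- exact: (emeasurable_funM mZ2 mZ2).
have E : (4 * pair_energy_const = (pair_energy_const + pair_energy_const) + (pair_energy_const + pair_energy_const))%R by ring.
rewrite E EFinD; apply: leeD; apply: pair_energy.
- exact: mD1.
- move=> x y u v; congr enorm; apply: eq_from_tnth => i.
  by rewrite /D1 /vdiff4 !tnthE; ring.
- exact: mD2.
- move=> x y u v; rewrite enorm_vsubC; congr enorm; apply: eq_from_tnth => i.
  by rewrite /D2 /vdiff4 !tnthE; ring.
Qed.

Lemma integral_Wfun (g : V -> \bar R) : (forall y, 0 <= g y) -> measurable_fun setT g ->
  \int[mu]_y (g y * Wfun y) =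
  \int[S]_x ((q x)%:E * \int[mu]_y (g y * ind (enorm (vsub x y) < r x)%R)).
Proof.
move=> g0 mg.
have mga : measurable_fun setT (fun p : V * V => g p.1 * a1 p.2 p.1).
  apply: emeasurable_funM; first by apply: (measurableT_comp mg); meas.
  exact: (measurable_swap ma1).
have ga0 y x : 0 <= g y * a1 x y by apply: mule_ge0; [exact: g0|exact: a10].
transitivity (\int[mu]_y \int[S]_x (g y * a1 x y)).
  apply: eq_integral => y _.
  by rewrite (intZl _ (g0 y) (fun x => a10 x y) (measurable_section2 y ma1)).
rewrite (@tonelli_swap _ _ _ _ _ mu S (fun y x => g y * a1 x y) mga ga0).
apply: eq_integral => x _.
have mi : measurable_fun setT (fun y => g y * ind (enorm (vsub x y) < r x)%R).
  by apply: emeasurable_funM; [exact: mg|meas].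
rewrite -(@intZl _ _ _ _ (q x)%:E _ _ _ mi); last 2 first.
- by rewrite lee_fin qweight_ge0.
- by move=> y; apply: mule_ge0; [exact: g0|exact: ind_ge0].
by apply: eq_integral => y _; rewrite /a1 muleCA.
Qed.

Lemma Wfun_mass : \int[mu]_y Wfun y <= omega R n.+1 * S setT.
Proof.
under eq_integral do rewrite -(mul1e (Wfun _)).
rewrite (@integral_Wfun (cst 1)); [|by move=> y; rewrite lee_fin|by meas].
rewrite -integral_cst//; apply: le_int.
- move=> x; apply: mule_ge0; first by rewrite lee_fin qweight_ge0.
  by apply: integral_ge0 => y _; apply: mule_ge0; [rewrite lee_fin|exact: ind_ge0].
- apply: emeasurable_funM; first by meas.
  by apply: (@measurable_int1 _ _ _ _ _ mu (fun x y => cst 1 y * ind (enorm (vsub x y) < r x)%R)); rewrite /cst; meas.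
- by meas.
move=> x; under eq_integral do rewrite mul1e enorm_vsubC.
rewrite ball_volume// muleA -[leRHS]mul1e; apply: lee_wpmul2r; first exact/ltW/omega_gt0.
by rewrite -EFinM lee_fin; have := @qweight_le x 1 ler01; rewrite mul1r expr1n.
Qed.

(** The bound degenerates as [dl] tends to 0. It only guarantees that the weight is bounded, so that
    it is an admissible test function, and does not enter the final constants. *)
Lemma Wfun_le (dl : R) y : (0 < dl)%R -> (forall x, (dl <= r x)%R) ->
  Wfun y <= (dl^-1 ^+ n.+1)%:E * S setT.
Proof.
move=> dl0 hr; rewrite -integral_cst//; apply: le_int.
- by move=> x; exact: a10.
- exact: (measurable_section2 y ma1).
- by meas.
move=> x; rewrite -[leRHS]mule1; apply: lee_pmul.
- by rewrite lee_fin qweight_ge0.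
- exact: ind_ge0.
- rewrite lee_fin /q; apply: (@le_trans _ _ (1 * (r x)^-1 ^+ n.+1)%R).
    by apply: ler_wpM2r; [rewrite exprn_ge0// invr_ge0 ltW|case: (e x)].
  by rewrite mul1r lerXn2r ?nnegrE ?invr_ge0 ?(ltW (r0 x)) ?(ltW dl0)// lef_pV2 ?posrE.
- exact: ind_le1.
Qed.

Lemma Wfun_supp y : (forall x, (r x <= 1)%R) -> (2 <= enorm y)%R -> Wfun y = 0.
Proof.
move=> hr hy; rewrite /Wfun integral_sphm; last 2 first.
- exact: (measurable_section2 y ma1).
- by move=> x; exact: a10.
rewrite integral0_eq// => x _.
case: (boolP (pball x)) => [px|_]; last exact: mul0e.
rewrite /a1; case: ltP => [h|_]; last by rewrite !mule0.
exfalso; have := sphere_sproj px; rewrite /sphere/= => ss.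
have ns : enorm (sproj x) = 1%R by rewrite /enorm ss sqrtr1.
(* A point of the support is within [r x <= 1] of a unit vector, hence has norm less than 2. *)
have := enorm_triangle (vsub y (sproj x)) (sproj x); rewrite (enorm_vsubC y) ns.
rewrite (_ : vadd _ _ = y); last by apply: eq_from_tnth => i; rewrite !tnthE; ring.
move: (hr (sproj x)) h hy; lra.
Qed.

End energy.

(** * The fourth moment of a Fourier transform *)

Section line_integrals.
Context (R : realType).
Local Open Scope ereal_scope.

Lemma integral_leb1_even (g F : R -> R) (l : R) :
  (forall x : R, is_derive x (1%R : R) F (g x)) -> continuous g ->
  (forall x, 0 <= x -> 0 <= g x)%R -> F x @[x --> +oo%R] --> l ->
  \int[@leb1 R]_t (g `|t|)%:E = (2 * (l - F 0))%:E.
Proof.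
move=> dF cg g0 Fl.
have cgn : continuous (fun t : R => g `|t|%R).
  move=> x; change {for x, continuous (g \o (Num.norm : R -> R))}.
  by apply: continuous_comp; [exact: norm_continuous|exact: cg].
have mg : measurable_fun setT (fun t : R => g `|t|%R) by exact: continuous_measurable_fun.
rewrite ge0_integral_leb1; last 2 first.
- exact/measurable_EFinP.
- by move=> x; rewrite lee_fin g0.
rewrite ge0_symfun_integralT//; last 2 first.
- by move=> x; exact: g0.
- by move=> x /=; rewrite normrN.
rewrite EFinM; congr (_ * _).
rewrite -set_itvcy EFinD EFinN -(@ge0_continuous_FTC2y R g F 0 l).
- apply: eq_integral => x; rewrite inE/= in_itv/= andbT => x0.
  by rewrite ger0_norm.
- exact: g0.
- by apply: continuous_subspaceT.
- exact: Fl.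
- by move=> x _; have [] := dF x.
- apply: cvg_at_right_filter; apply: differentiable_continuous.
  by apply/derivable1_diffP; have [] := dF 0%R.
- by move=> x _; rewrite derive1E; have [] := dF x.
Qed.

Lemma cvg_expR_scale (e : R) : (0 < e)%R -> expR (- (e * x))%R @[x --> +oo%R] --> (0%R : R).
Proof.
move=> e0; apply: (@cvg_comp _ _ _ (fun x : R => e * x)%R (fun x => expR (- x)%R) _ (+oo%R)).
  by apply: gt0_cvgMry => //; exact: cvg_id.
exact: cvgr_expR.
Qed.

(** The transform of [exp(-e |t|)] at angular frequency [a]: the one-dimensional Poisson kernel,
    positive for [e > 0]. *)
Definition poisson1 (e a : R) : R := (2 * e / (e ^+ 2 + a ^+ 2))%R.

Lemma poisson1_ge0 e a : (0 <= e)%R -> (0 <= poisson1 e a)%R.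
Proof. by move=> e0; rewrite divr_ge0 ?mulr_ge0// addr_ge0 ?sqr_ge0. Qed.

Lemma poisson1_le e a : (0 < e)%R -> (poisson1 e a <= 2 / e)%R.
Proof.
move=> e0; rewrite /poisson1 ler_pdivrMr; last by rewrite ltr_pwDl ?exprn_gt0// sqr_ge0.
rewrite mulrDr (_ : (2 / e * e ^+ 2) = 2 * e)%R; last by field; rewrite gt_eqF.
by rewrite lerDl mulr_ge0 ?sqr_ge0// divr_ge0// ltW.
Qed.

(** The constant [A >= |B|] keeps the integrand nonnegative, so that only integrals of nonnegative
    functions are met. *)
Lemma integral_exp_cos_even (e a A B : R) : (0 < e)%R -> (`|B| <= A)%R ->
  \int[@leb1 R]_t (expR (- (e * `|t|)) * (A + B * cos (a * `|t|)))%:E =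
  (A * (2 / e) + B * poisson1 e a)%:E.
Proof.
move=> e0 BA.
have ea0 : (e ^+ 2 + a ^+ 2 != 0)%R by rewrite gt_eqF// ltr_pwDl ?exprn_gt0// sqr_ge0.
(* A primitive that vanishes at infinity, so the integral over the half-line is [- F 0]. *)
pose F (t : R) := (expR (- (e * t)) * (- (A / e) + B * (a * sin (a * t) - e * cos (a * t)) / (e ^+ 2 + a ^+ 2)))%R.
have dF (x : R) : is_derive x (1%R : R) F (expR (- (e * x)) * (A + B * cos (a * x)))%R.
  rewrite /F; apply: is_derive_eq; rewrite /GRing.scale/=; field.
  by rewrite ea0 gt_eqF.
rewrite (@integral_leb1_even (fun t => expR (- (e * t)) * (A + B * cos (a * t)))%R F 0 dF).
- rewrite /F !mulr0 oppr0 expR0 sin0 cos0 /poisson1; congr (_%:E); field.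
  by rewrite ea0 gt_eqF.
- move=> x; apply: differentiable_continuous; apply/derivable1_diffP.
  by apply: ex_derive.
- move=> x _; rewrite mulr_ge0 ?expR_ge0//.
  have : (`|B * cos (a * x)| <= A)%R.
    rewrite normrM; apply: le_trans BA; rewrite -[leRHS]mulr1 ler_wpM2l// ler_norml.
    by rewrite cos_geN1 cos_le1.
  by rewrite ler_norml => /andP[]; rewrite -subr_ge0 opprK addrC.
pose C := (A / e + A * (`|a| + e) / (e ^+ 2 + a ^+ 2))%R.
have FC x : (`|F x| <= C * expR (- (e * x)))%R.
  rewrite /F normrM (ger0_norm (expR_ge0 _)) mulrC ler_wpM2r ?expR_ge0//.
  apply: le_trans (ler_normD _ _) _; rewrite normrN /C; apply: lerD.
    by rewrite ger0_norm// divr_ge0 ?(ltW e0)//; apply: le_trans BA.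
  rewrite !normrM normfV (ger0_norm (_ : 0 <= e ^+ 2 + a ^+ 2)%R) ?addr_ge0 ?sqr_ge0//.
  rewrite ler_wpM2r ?invr_ge0 ?addr_ge0 ?sqr_ge0//; apply: ler_pM => //.
  apply: le_trans (ler_normB _ _) _; rewrite !normrM (gtr0_norm e0); apply: lerD.
    by rewrite -[leRHS]mulr1 ler_wpM2l// ler_norml sin_geN1 sin_le1.
  by rewrite -[leRHS]mulr1 ler_wpM2l ?(ltW e0)// ler_norml cos_geN1 cos_le1.
have Cl (D : R) : (D * expR (- (e * x)))%R @[x --> +oo%R] --> (0%R : R).
  by rewrite -(mulr0 D); apply: cvgM; [exact: cvg_cst|exact: cvg_expR_scale].
apply: (@squeeze_cvgr _ _ _ _ (fun x => (- C) * expR (- (e * x)))%R (fun x => C * expR (- (e * x)))%R).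
- by apply: nearW => x; rewrite mulNr -ler_norml.
- exact: Cl.
- exact: Cl.
Qed.

Lemma ge0_integral_leb1N (f : R -> \bar R) : measurable_fun setT f -> (forall x, 0 <= f x) ->
  \int[@leb1 R]_t f (- t)%R = \int[@leb1 R]_t f t.
Proof.
move=> mf f0.
have mfN : measurable_fun setT (fun t : R => f (- t)%R) by apply: (measurable_app mf); meas.
rewrite !ge0_integral_leb1//.
have mN : measurable_fun [set: measurableTypeR R] (-%R : measurableTypeR R -> measurableTypeR R).
  exact: measurable_funN'.
rewrite -[RHS](@eq_measure_integral _ _ _ setT _ (pushforward (@lebesgue_measure R) (-%R : measurableTypeR R -> measurableTypeR R))); last first.
  by move=> A mA _; exact: lebesgue_measureN.
by rewrite (ge0_integral_pushforward mN).
Qed.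

(** Adding the reflected integral removes the phase: [cos (th + a t) + cos (th - a t) = 2 cos th cos
    (a t)]. *)
Lemma integral_exp_cos (e a th A B : R) : (0 < e)%R -> (`|B| <= A)%R ->
  \int[@leb1 R]_t (expR (- (e * `|t|)) * (A + B * cos (th + a * t)))%:E =
  (A * (2 / e) + B * cos th * poisson1 e a)%:E.
Proof.
move=> e0 BA.
have c1 B' t : (`|B'| <= A -> 0 <= A + B' * cos t)%R.
  move=> B'A; have : (`|B' * cos t| <= A)%R.
    rewrite normrM; apply: le_trans B'A; rewrite -[leRHS]mulr1 ler_wpM2l// ler_norml.
    by rewrite cos_geN1 cos_le1.
  by rewrite ler_norml => /andP[]; rewrite -subr_ge0 opprK addrC.
pose g t := (expR (- (e * `|t|)) * (A + B * cos (th + a * t)))%R.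
have g0 t : 0 <= (g t)%:E by rewrite lee_fin mulr_ge0 ?expR_ge0// c1.
have mg : measurable_fun setT (fun t => (g t)%:E).
  apply: measurable_EFin'; apply: measurable_funM; last by meas.
  by apply: (measurable_app (@measurable_expR R)); meas.
have BtA : (`|B * cos th| <= A)%R.
  rewrite normrM; apply: le_trans BA; rewrite -[leRHS]mulr1 ler_wpM2l// ler_norml.
  by rewrite cos_geN1 cos_le1.
have E : \int[@leb1 R]_t (g t)%:E + \int[@leb1 R]_t (g t)%:E = 2%:E * (A * (2 / e) + B * cos th * poisson1 e a)%:E.
  rewrite -{2}(ge0_integral_leb1N mg g0).
  rewrite -(integral_exp_cos_even a e0 BtA).
  rewrite -ge0_integralD//; last first.
    by apply: (measurable_app mg); meas.
  rewrite -intZl//; last 2 first.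
  - by move=> t; rewrite lee_fin mulr_ge0 ?expR_ge0// c1.
  - apply: measurable_EFin'; apply: measurable_funM; last by meas.
    by apply: (measurable_app (@measurable_expR R)); meas.
  apply: eq_integral => t _; rewrite -EFinD -EFinM; congr (_%:E).
  rewrite /g normrN mulrN cosD cosB.
  have -> : cos (a * `|t|)%R = cos (a * t)%R.
    by have [|] := leP 0%R t => [/ger0_norm->|/ltr0_norm->]//; rewrite mulrN cosN.
  ring.
have I0 : 0 <= \int[@leb1 R]_t (g t)%:E by apply: integral_ge0.
rewrite -/(g _); move: E I0; case: (\int[@leb1 R]_t _) => [x||]//.
by rewrite -EFinD -EFinM => -[E] _; congr (_%:E); lra.
Qed.

Lemma integral_poisson1 (e : R) : (0 < e)%R ->
  \int[@leb1 R]_t (poisson1 e (2 * pi * t))%:E = 1.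
Proof.
move=> e0; have p0 := pi_gt0 R.
pose F (s : R) := (pi^-1 * atan (2 * pi / e * s))%R.
have e1 (x : R) : (e ^+ 2 + (2 * pi * x) ^+ 2 != 0)%R.
  by rewrite gt_eqF// ltr_pwDl ?exprn_gt0// sqr_ge0.
have dF (x : R) : is_derive x (1%R : R) F (poisson1 e (2 * pi * x)).
  rewrite /F; apply: is_derive_eq; rewrite /GRing.scale/= /poisson1.
  move: (pi : R) p0 e1 => P p0 e1; field.
  by rewrite e1 !gt_eqF.
transitivity (\int[@leb1 R]_t (poisson1 e (2 * pi * `|t|))%:E).
  by apply: eq_integral => t _; rewrite /poisson1 !exprMn real_normK ?num_real.
rewrite (@integral_leb1_even (fun t => poisson1 e (2 * pi * t)) F 2^-1 dF).
- by rewrite /F mulr0 atan0 mulr0 subr0 mulfV.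
- move=> x; apply: differentiable_continuous; apply/derivable1_diffP.
  rewrite /poisson1; apply: derivableM => //; apply: derivableV => //.
- by move=> x _; rewrite poisson1_ge0// ltW.
rewrite (_ : 2^-1 = pi^-1 * (pi / 2))%R; last by rewrite mulrA mulVf ?mul1r// gt_eqF.
apply: cvgM; first exact: cvg_cst.
apply: (@cvg_comp _ _ _ (fun x : R => 2 * pi / e * x)%R atan _ (+oo%R)); last exact: cvgy_atan.
by apply: gt0_cvgMry; [rewrite divr_gt0 ?mulr_gt0|exact: cvg_id].
Qed.

End line_integrals.

Section product_kernels.
Context (R : realType).
Local Open Scope ereal_scope.

(** A product of one-dimensional exponentials instead of a function of the Euclidean norm, so that
    the transform is again a product. *)
Definition expw n (e : R) (x : n.-tuple R) : R := (\prod_(i < n) expR (- (e * `|tnth x i|)))%R.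

Definition poisson n (e : R) (x : n.-tuple R) : R := (\prod_(i < n) poisson1 e (tnth x i))%R.

Lemma expw_ge0 n e (x : n.-tuple R) : (0 <= expw e x)%R.
Proof. by apply: prodr_ge0 => i _; exact: expR_ge0. Qed.

Lemma poisson_ge0 n e (x : n.-tuple R) : (0 < e)%R -> (0 <= poisson e x)%R.
Proof. by move=> e0; apply: prodr_ge0 => i _; exact/poisson1_ge0/ltW. Qed.

Lemma poisson_le n e (x : n.-tuple R) : (0 < e)%R -> (poisson e x <= (2 / e) ^+ n)%R.
Proof.
move=> e0; rewrite -[n in leRHS]card_ord -prodr_const; apply: ler_prod => i _.
by rewrite poisson1_le// poisson1_ge0 ?ltW.
Qed.

Lemma measurable_expw n e : measurable_fun setT (@expw n e).
Proof.
apply: measurable_prod => i _.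
by apply: (measurable_app (@measurable_expR R)); meas.
Qed.

Lemma measurable_poisson n e : measurable_fun setT (@poisson n e).
Proof. by apply: measurable_prod => i _; rewrite /poisson1; meas. Qed.

(** The phase [th] is there for the induction: splitting off a coordinate [t] leaves the phase
    [th + s0 t] for the others. *)
Lemma integral_expw n (e : R) (s : n.-tuple R) (th A B : R) : (0 < e)%R -> (`|B| <= A)%R ->
  \int[lebn R n]_x (expw e x * (A + B * cos (th + dotp s x)))%:E =
  (A * (2 / e) ^+ n + B * cos th * poisson e s)%:E.
Proof.
move=> e0; elim: n s th A B => [|n IH] s th A B BA.
  rewrite lebn0_integral /expw /poisson /dotp !big_ord0 addr0 expr0.
  by congr (_%:E); ring.
have c1 t : (0 <= A + B * cos t)%R.
  have : (`|B * cos t| <= A)%R.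
    rewrite normrM; apply: le_trans BA; rewrite -[leRHS]mulr1 ler_wpM2l// ler_norml.
    by rewrite cos_geN1 cos_le1.
  by rewrite ler_norml => /andP[]; rewrite -subr_ge0 opprK addrC.
have mexp := @measurable_expw n e; have mexp1 := @measurable_expw n.+1 e.
rewrite lebnS_integral; last 2 first.
- by apply: measurable_EFin'; meas.
- by move=> x; rewrite lee_fin mulr_ge0 ?expw_ge0.
pose s0 := tnth s ord0; pose s' := [tuple tnth s (lift ord0 i) | i < n].
have sE t (x : n.-tuple R) : dotp s [tuple of t :: x] = (s0 * t + dotp s' x)%R.
  rewrite /dotp big_ord_recl; congr (_ + _)%R.
  by apply: eq_bigr => i _; rewrite /Defs.coord tnth_tconsS tnth_mktuple.
have eE t (x : n.-tuple R) : expw e [tuple of t :: x] = (expR (- (e * `|t|)) * expw e x)%R.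
  rewrite /expw big_ord_recl; congr (_ * _)%R.
  by apply: eq_bigr => i _; rewrite tnth_tconsS.
have pE : poisson e s = (poisson1 e s0 * poisson e s')%R.
  rewrite /poisson big_ord_recl; congr (_ * _)%R.
  by apply: eq_bigr => i _; rewrite tnth_mktuple.
transitivity (\int[@leb1 R]_t (expR (- (e * `|t|)) *
    (A * (2 / e) ^+ n + (B * poisson e s') * cos (th + s0 * t)))%:E).
  apply: eq_integral => t _.
  transitivity ((expR (- (e * `|t|)))%:E * (A * (2 / e) ^+ n + B * cos (th + s0 * t) * poisson e s')%:E); last first.
    by rewrite -EFinM; congr (_%:E); ring.
  rewrite -(IH s' (th + s0 * t)%R A B BA) -intZl.
  - by apply: eq_integral => x _; rewrite -EFinM sE eE addrA mulrA.
  - by rewrite lee_fin expR_ge0.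
  - by move=> x; rewrite lee_fin mulr_ge0 ?expw_ge0.
  - by meas.
rewrite integral_exp_cos//.
  by congr (_%:E); rewrite pE exprS; ring.
rewrite normrM (ger0_norm (poisson_ge0 _ e0)); apply: ler_pM => //.
  exact: poisson_ge0.
exact: poisson_le.
Qed.

Lemma integral_poisson n (e : R) : (0 < e)%R ->
  \int[lebn R n]_x (poisson e (vscale (2 * pi) x))%:E = 1.
Proof.
move=> e0; elim: n => [|n IH]; first by rewrite lebn0_integral /poisson big_ord0.
have mp := @measurable_poisson n e; have mp1 := @measurable_poisson n.+1 e.
rewrite lebnS_integral; last 2 first.
- by apply: measurable_EFin'; meas.
- by move=> x; rewrite lee_fin poisson_ge0.
rewrite -(integral_poisson1 e0); apply: eq_integral => t _.
rewrite -[RHS]mule1 -IH -intZl//; last 3 first.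
- by rewrite lee_fin poisson1_ge0// ltW.
- by move=> x; rewrite lee_fin poisson_ge0.
- by apply: measurable_EFin'; meas.
apply: eq_integral => x _; rewrite -EFinM; congr (_%:E).
rewrite /poisson big_ord_recl !tnthE; congr (_ * _)%R.
by apply: eq_bigr => i _; rewrite !tnthE tnth_tconsS.
Qed.

End product_kernels.

Section product_integrals.
Local Open Scope ereal_scope.
Context d1 d2 (T1 : measurableType d1) (T2 : measurableType d2) (R : realType).
Variables (m1 : {sigma_finite_measure set T1 -> \bar R})
  (m2 : {sigma_finite_measure set T2 -> \bar R}).

Lemma integrable_mul_bounded (f g : T1 -> R) (M : R) : m1.-integrable setT (EFin \o f) ->
  measurable_fun setT g -> (forall x, `|g x| <= M)%R ->
  m1.-integrable setT (EFin \o (fun x => f x * g x)%R).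
Proof.
move=> /integrableP[mf fi] mg gM.
have mf' : measurable_fun setT f by exact/measurable_EFinP.
apply: (@le_integrable _ _ _ _ _ _ _ (fun x => M%:E * (f x)%:E)).
- by [].
- by apply/measurable_EFinP; exact: measurable_funM.
- move=> x _; rewrite -EFinM !abse_EFin lee_fin mulrC !normrM ler_wpM2r//.
  exact: le_trans (gM x) (ler_norm _).
- by apply: integrableZl => //; apply/integrableP; split.
Qed.

Lemma measurable_Rint1 (h : T1 -> T2 -> R) :
  measurable_fun setT (fun p : T1 * T2 => h p.1 p.2) ->
  measurable_fun setT (fun x => (\int[m2]_y h x y)%R).
Proof.
move=> mh; apply: measurableT_comp => //.
by apply: (@measurable_int1 _ _ _ _ _ m2 (fun x y => (h x y)%:E)); apply: measurable_EFin'.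
Qed.

Lemma integrable_prod (f : T1 -> R) (g : T2 -> R) : m1.-integrable setT (EFin \o f) ->
  m2.-integrable setT (EFin \o g) ->
  (prodm m1 m2).-integrable setT (EFin \o (fun p => f p.1 * g p.2)%R).
Proof.
move=> /integrableP[/measurable_EFinP mf fi] /integrableP[/measurable_EFinP mg gi].
have mfg : measurable_fun setT (fun p : T1 * T2 => `|(f p.1)%:E| * `|(g p.2)%:E|).
  by apply: emeasurable_funM; apply: (measurableT_comp (@abse_measurable _ _)); meas.
apply/integrableP; split.
  by apply: measurable_EFin'; meas.
rewrite (_ : \int[_]_x _ = \int[prodm m1 m2]_p (`|(f p.1)%:E| * `|(g p.2)%:E|)); last first.
  by apply: eq_integral => p _; rewrite -abseM.
rewrite [X in X < _](fubini_tonelli1 _ mfg); last by move=> p; apply: mule_ge0.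
rewrite /fubini_F.
have mfa : measurable_fun setT (fun x => `|(f x)%:E|) by apply: (measurableT_comp (@abse_measurable _ _)); meas.
have mga : measurable_fun setT (fun x => `|(g x)%:E|) by apply: (measurableT_comp (@abse_measurable _ _)); meas.
rewrite (_ : \int[m1]_x _ = \int[m1]_x (`|(f x)%:E| * \int[m2]_y `|(g y)%:E|)); last first.
  by apply: eq_integral => x _; rewrite -(intZl m2 (abse_ge0 (f x)%:E) (fun y => abse_ge0 (g y)%:E) mga).
rewrite (intZr m1 (integral_ge0 _ (fun _ _ => abse_ge0 _)) (fun=> abse_ge0 _) mfa).
by apply: lte_mul_pinfty => //; [apply: integral_ge0|rewrite ge0_fin_numE//; apply: integral_ge0].
Qed.

Lemma integral_prod (f : T1 -> R) (g : T2 -> R) : m1.-integrable setT (EFin \o f) ->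
  m2.-integrable setT (EFin \o g) ->
  (\int[prodm m1 m2]_p (f p.1 * g p.2) = (\int[m1]_x f x) * (\int[m2]_x g x))%R.
Proof.
move=> fi gi; have fgi := integrable_prod fi gi.
rewrite -RintegralZr//; congr fine.
rewrite -[LHS](integral12_prod_meas1 fgi); apply: eq_integral => x _.
rewrite /fubini_F/= EFinM fineK ?integrable_fin_num// -integralZl//.
Qed.

End product_integrals.

Section square_kernel.
Local Open Scope ereal_scope.
Context d (T : measurableType d) (R : realType) (n : nat).
Variables (m : {sigma_finite_measure set T -> \bar R}) (Phi : T -> R) (X : T -> n.-tuple R).
Hypothesis iPhi : m.-integrable setT (EFin \o Phi).
Hypothesis mX : measurable_fun setT X.
Local Notation mu := (lebn R n).

(** Cosine transform of the image under [X] of the signed measure [Phi m]. In the application [w] is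
    a pair of points [(x, y)], [Phi w = phi x phi y] and [X w = 2 pi (x - y)], and this is the
    squared modulus of the transform of [phi]. *)
Definition cosint (xi : n.-tuple R) : R := (\int[m]_w (Phi w * cos (dotp (X w) xi)))%R.

Let mPhi : measurable_fun setT Phi.
Proof. by move/measurable_int: iPhi => /measurable_EFinP. Qed.

Let icos xi : m.-integrable setT (EFin \o (fun w => Phi w * cos (dotp (X w) xi))%R).
Proof.
apply: (@integrable_mul_bounded _ _ _ _ Phi _ 1) => //; first by meas.
by move=> x; rewrite ler_norml cos_geN1 cos_le1.
Qed.

Let Psi (p : T * T) : R := (Phi p.1 * Phi p.2)%R.

Let iPsi : (prodm m m).-integrable setT (EFin \o Psi).
Proof. exact: integrable_prod. Qed.

Let mPsi : measurable_fun setT Psi.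
Proof. by rewrite /Psi; meas. Qed.

Let N : R := fine (\int[prodm m m]_p `|Psi p|%:E).

Let NE : \int[prodm m m]_p `|Psi p|%:E = N%:E.
Proof.
rewrite fineK// ge0_fin_numE; first by have /integrableP[] := iPsi.
by apply: integral_ge0.
Qed.

Let cc (p : T * T) xi : R := (cos (dotp (X p.1) xi) * cos (dotp (X p.2) xi))%R.

(** The summand [|Psi|] makes the integrand nonnegative, so that Tonelli applies; its contribution
    [N] is finite and cancels in [square_kernel]. *)
Lemma cosint_sqr xi : \int[prodm m m]_p (`|Psi p| + Psi p * cc p xi)%:E = (N + cosint xi ^+ 2)%:E.
Proof.
have iPc : (prodm m m).-integrable setT (EFin \o (fun p => Psi p * cc p xi)%R).
  rewrite (_ : (fun p => _) = (fun p : T * T => (Phi p.1 * cos (dotp (X p.1) xi)) * (Phi p.2 * cos (dotp (X p.2) xi)))%R).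
    exact: (integrable_prod (icos xi) (icos xi)).
  by apply/funext => p; rewrite /Psi /cc; ring.
rewrite (_ : (fun p => _) = (fun p => `|Psi p|%:E + (Psi p * cc p xi)%:E)); last exact/funext.
rewrite integralD//; last exact: (integrable_abse iPsi).
rewrite NE EFinD; congr (_ + _).
rewrite expr2 -(integral_prod (icos xi) (icos xi)) fineK; last first.
  by apply: integrable_fin_num => //; exact: (integrable_prod (icos xi) (icos xi)).
by apply: eq_integral => p _; rewrite /Psi /cc; congr (_%:E); ring.
Qed.

(* [expw e] regularises the integral; its Fourier transform is the positive
   kernel [poisson e], which is integrated away by [schur] as [e] tends to 0. *)
Lemma square_kernel (e : R) : (0 < e)%R ->
  \int[mu]_xi (expw e xi * cosint xi ^+ 2)%:E <=
  \int[prodm m m]_p (2^-1 * `|Phi p.1 * Phi p.2| *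
    (poisson e (vadd (X p.1) (X p.2)) + poisson e (vsub (X p.1) (X p.2))))%:E.
Proof.
move=> e0; have mexp := @measurable_expw R n e; have mpoi := @measurable_poisson R n e.
have N0 : (0 <= N)%R by rewrite fine_ge0// integral_ge0.
have mcos : measurable_fun setT cosint.
  apply: (@measurable_Rint1 _ _ _ _ _ m (fun xi w => Phi w * cos (dotp (X w) xi))%R).
  by meas.
have pn0 s : (0 <= poisson e s)%R by exact: poisson_ge0.
have en0 s : (0 <= expw e s)%R by exact: expw_ge0.
have cc1 p xi : (0 <= `|Psi p| + Psi p * cc p xi)%R.
  have : (`|Psi p * cc p xi| <= `|Psi p|)%R.
    rewrite normrM -[leRHS]mulr1 ler_wpM2l// /cc normrM -[leRHS]mulr1.
    by rewrite ler_pM// ler_norml cos_geN1 cos_le1.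
  by rewrite ler_norml => /andP[]; rewrite -subr_ge0 opprK addrC.
have mcc : measurable_fun setT (fun t : n.-tuple R * (T * T) => (expw e t.1 * (`|Psi t.2| + Psi t.2 * cc t.2 t.1))%:E).
  by apply: measurable_EFin'; rewrite /cc; meas.
have E1 : \int[mu]_xi (expw e xi * (N + cosint xi ^+ 2))%:E =
   \int[prodm m m]_p \int[mu]_xi (expw e xi * (`|Psi p| + Psi p * cc p xi))%:E.
  rewrite -(@tonelli_swap _ _ _ _ _ mu (prodm m m) (fun xi p => (expw e xi * (`|Psi p| + Psi p * cc p xi))%:E) mcc); last first.
    by move=> xi p; rewrite lee_fin mulr_ge0.
  apply: eq_integral => xi _; rewrite EFinM -cosint_sqr -intZl.
  - by apply: eq_integral => p _; rewrite -EFinM.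
  - by rewrite lee_fin.
  - by move=> p; rewrite lee_fin.
  - by rewrite /cc; meas.
have E2 p : \int[mu]_xi (expw e xi * (`|Psi p| + Psi p * cc p xi))%:E =
   (`|Psi p| * (2 / e) ^+ n)%:E + (2^-1 * Psi p * (poisson e (vadd (X p.1) (X p.2)) + poisson e (vsub (X p.1) (X p.2))))%:E.
  have B : (`|2^-1 * Psi p| <= 2^-1 * `|Psi p|)%R by rewrite normrM ger0_norm.
  have c1 t : (0 <= 2^-1 * `|Psi p| + 2^-1 * Psi p * cos t)%R.
    have : (`|2^-1 * Psi p * cos t| <= 2^-1 * `|Psi p|)%R.
      rewrite normrM; apply: le_trans B; rewrite -[leRHS]mulr1 ler_wpM2l// ler_norml.
      by rewrite cos_geN1 cos_le1.
    by rewrite ler_norml => /andP[]; rewrite -subr_ge0 opprK addrC.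
  (* By [cos a cos b = (cos (a + b) + cos (a - b)) / 2]; each half is a case of [integral_expw]. *)
  transitivity (\int[mu]_xi ((expw e xi * (2^-1 * `|Psi p| + 2^-1 * Psi p * cos (0 + dotp (vadd (X p.1) (X p.2)) xi)))%:E +
     (expw e xi * (2^-1 * `|Psi p| + 2^-1 * Psi p * cos (0 + dotp (vsub (X p.1) (X p.2)) xi)))%:E)).
    apply: eq_integral => xi _; rewrite -EFinD; congr (_%:E).
    rewrite /cc !add0r dotpDl dotpBl cosD cosB; lra.
  rewrite ge0_integralD//; last 4 first.
  - by move=> xi _; rewrite lee_fin mulr_ge0.
  - by apply: measurable_EFin'; meas.
  - by move=> xi _; rewrite lee_fin mulr_ge0.
  - by apply: measurable_EFin'; meas.
  rewrite !integral_expw// -!EFinD cos0; congr (_%:E); lra.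
have c1 : (0 <= (2 / e) ^+ n)%R by rewrite exprn_ge0// divr_ge0// ltW.
have E3 : \int[mu]_xi (expw e xi * (N + cosint xi ^+ 2))%:E = (N * (2 / e) ^+ n)%:E + \int[mu]_xi (expw e xi * cosint xi ^+ 2)%:E.
  under eq_integral do rewrite mulrDr EFinD.
  rewrite ge0_integralD//; last 4 first.
  - by move=> xi _; rewrite lee_fin mulr_ge0.
  - by apply: measurable_EFin'; meas.
  - by move=> xi _; rewrite lee_fin mulr_ge0 ?sqr_ge0.
  - by apply: measurable_EFin'; meas.
  congr (_ + _).
  have := @integral_expw R n e [tuple of nseq n 0%R] 0 N 0 e0.
  rewrite normr0 => /(_ N0); rewrite !mul0r addr0 => <-.
  by apply: eq_integral => xi _; rewrite mul0r addr0.
set RH := (X in _ <= X).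
have : (N * (2 / e) ^+ n)%:E + \int[mu]_xi (expw e xi * cosint xi ^+ 2)%:E <= (N * (2 / e) ^+ n)%:E + RH.
  rewrite -E3 E1 EFinM -NE -(intZr (prodm m m)); [|by rewrite lee_fin|by []|by meas].
  rewrite /RH -ge0_integralD//; last 4 first.
  - by move=> p _; apply: mule_ge0; rewrite lee_fin.
  - by meas.
  - by move=> p _; rewrite lee_fin !mulr_ge0// addr_ge0.
  - by apply: measurable_EFin'; meas.
  apply: le_int.
  - by move=> p; apply: integral_ge0 => xi _; rewrite lee_fin mulr_ge0.
  - exact: (@measurable_int1 _ _ _ _ _ mu (fun p xi => (expw e xi * (`|Psi p| + Psi p * cc p xi))%:E) (@measurable_swap _ _ _ _ _ _ (fun xi p => (expw e xi * (`|Psi p| + Psi p * cc p xi))%:E) mcc)).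
  - by apply: emeasurable_funD; meas.
  move=> p; rewrite E2 -EFinM; apply: leeD => //; rewrite lee_fin.
  by rewrite ler_wpM2r ?addr_ge0// ler_wpM2l// ler_norm.
by rewrite leeD2lE.
Qed.

End square_kernel.

(** * Schur's test *)

Section schur.
Local Open Scope ereal_scope.
Context d (T : measurableType d) (R : realType).
Variables (m : {sigma_finite_measure set T -> \bar R}).

Lemma ereal_amgm (a b : \bar R) : 0 <= a -> 0 <= b -> a * b <= (2^-1)%:E * (a * a + b * b).
Proof.
case: a => [a| |]//; case: b => [b| |]// a0 b0.
- change ((a * b)%:E <= (2^-1 * (a * a + b * b))%:E).
  rewrite lee_fin; have := sqr_ge0 (a - b)%R; rewrite !expr2; nra.
- by rewrite [leRHS](_ : _ = +oo) ?leey// mulyy addey// gt0_muley// lte_fin invr_gt0.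
- by rewrite [leRHS](_ : _ = +oo) ?leey// !mulyy addye// gt0_muley// lte_fin invr_gt0.
- by rewrite [leRHS](_ : _ = +oo) ?leey// !mulyy addye// gt0_muley// lte_fin invr_gt0.
Qed.

Lemma ereal_half (x : \bar R) : 0 <= x -> (2^-1)%:E * (x + x) <= x.
Proof.
case: x => [x| |]// _; last by rewrite leey.
by change ((2^-1 * (x + x))%:E <= x%:E); rewrite lee_fin; lra.
Qed.

(** From [U(x) U(y) <= (U(x)^2 + U(y)^2) / 2]: in each half one variable of the kernel is integrated
    out and contributes at most 1. *)
Lemma schur (U : T -> \bar R) (k : T -> T -> \bar R) : measurable_fun setT U -> (forall x, 0 <= U x) ->
  measurable_fun setT (fun p : T * T => k p.1 p.2) -> (forall x y, 0 <= k x y) ->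
  (forall x, \int[m]_y k x y <= 1) -> (forall y, \int[m]_x k x y <= 1) ->
  \int[m]_x (U x * \int[m]_y (U y * k x y)) <= \int[m]_x (U x * U x).
Proof.
move=> mU U0 mk k0 k1 k2.
have UU0 x : 0 <= U x * U x by apply: mule_ge0.
have mUU : measurable_fun setT (fun x => U x * U x) by exact: emeasurable_funM.
have mkx x : measurable_fun setT (k x) by exact: (measurable_section1 x mk).
have mky y : measurable_fun setT (k ^~ y) by exact: (measurable_section2 y mk).
pose g1 x y := U x * U x * k x y; pose g2 x y := U y * U y * k x y.
have g10 x y : 0 <= g1 x y by apply: mule_ge0.
have g20 x y : 0 <= g2 x y by apply: mule_ge0.
have mg1 : measurable_fun setT (fun p : T * T => g1 p.1 p.2).
  by apply: emeasurable_funM mk; apply: (measurable_app mUU); meas.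
have mg2 : measurable_fun setT (fun p : T * T => g2 p.1 p.2).
  by apply: emeasurable_funM mk; apply: (measurable_app mUU); meas.
have le1 (g : T -> T -> \bar R) : (forall x y, 0 <= g x y) -> measurable_fun setT (fun p : T * T => g p.1 p.2) ->
   (forall x, exists2 h, (0 <= h <= 1) & \int[m]_y g x y = U x * U x * h) ->
   \int[m]_x \int[m]_y g x y <= \int[m]_x (U x * U x).
  move=> g0 mg hg; apply: le_int.
  - by move=> x; apply: integral_ge0.
  - exact: (measurable_int1 m mg).
  - exact: mUU.
  move=> x; have [h /andP[h0 h1] ->] := hg x.
  by rewrite -[leRHS]mule1; apply: lee_wpmul2l.
have I1 : \int[m]_x \int[m]_y g1 x y <= \int[m]_x (U x * U x).
  apply: le1 => // x; exists (\int[m]_y k x y); first by rewrite k1 integral_ge0.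
  by rewrite -(intZl m (UU0 x) (k0 x) (mkx x)).
have I2 : \int[m]_x \int[m]_y g2 x y <= \int[m]_x (U x * U x).
  rewrite (tonelli_swap m m mg2 g20); apply: (le1 (fun y x => g2 x y)) => //.
    exact: (measurable_swap mg2).
  move=> y; exists (\int[m]_x k x y); first by rewrite k2 integral_ge0.
  by rewrite -(intZl m (UU0 y) (fun x => k0 x y) (mky y)).
have Uk0 x y : 0 <= U y * k x y by apply: mule_ge0.
have mUk : measurable_fun setT (fun p : T * T => U p.2 * k p.1 p.2).
  by apply: emeasurable_funM mk; apply: (measurable_app mU); meas.
apply: (@le_trans _ _ ((2^-1)%:E * (\int[m]_x \int[m]_y g1 x y + \int[m]_x \int[m]_y g2 x y))); last first.
  apply: (@le_trans _ _ ((2^-1)%:E * (\int[m]_x (U x * U x) + \int[m]_x (U x * U x)))).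
    by apply: lee_wpmul2l; [rewrite lee_fin|exact: (leeD I1 I2)].
  by apply: ereal_half; apply: integral_ge0.
have g12 x y : 0 <= g1 x y + g2 x y by apply: adde_ge0.
have mg12 : measurable_fun setT (fun p : T * T => g1 p.1 p.2 + g2 p.1 p.2) by exact: emeasurable_funD.
have h0 : 0 <= (2^-1 : R)%:E by rewrite lee_fin.
rewrite -ge0_integralD; last 5 first.
- by [].
- by move=> x _; exact: integral_ge0.
- exact: (measurable_int1 m mg1).
- by move=> x _; exact: integral_ge0.
- exact: (measurable_int1 m mg2).
rewrite -(intZl m h0); last 2 first.
- by move=> x; apply: adde_ge0; exact: integral_ge0.
- by apply: emeasurable_funD; [exact: (measurable_int1 m mg1)|exact: (measurable_int1 m mg2)].
apply: le_int.
- by move=> x; apply: mule_ge0 => //; apply: integral_ge0.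
- by apply: emeasurable_funM => //; exact: (@measurable_int1 _ _ _ _ _ m (fun x y => U y * k x y) mUk).
- apply: emeasurable_funM; first by meas.
  by apply: emeasurable_funD; [exact: (measurable_int1 m mg1)|exact: (measurable_int1 m mg2)].
move=> x; rewrite -ge0_integralD; last 5 first.
- by [].
- by move=> y _; exact: g10.
- exact: (measurable_section1 x mg1).
- by move=> y _; exact: g20.
- exact: (measurable_section1 x mg2).
rewrite -(intZl m h0 (g12 x) (@measurable_section1 _ _ _ _ _ _ (fun x y => g1 x y + g2 x y) x mg12)).
rewrite -(intZl m (U0 x) (Uk0 x) (@measurable_section1 _ _ _ _ _ _ (fun x y => U y * k x y) x mUk)).
apply: le_int.
- by move=> y; apply: mule_ge0.
- by apply: emeasurable_funM; [meas|exact: (@measurable_section1 _ _ _ _ _ _ (fun x y => U y * k x y) x mUk)].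
- by apply: emeasurable_funM; [meas|exact: (@measurable_section1 _ _ _ _ _ _ (fun x y => g1 x y + g2 x y) x mg12)].
move=> y; rewrite /g1 /g2 muleA -ge0_muleDl// muleA; apply: lee_wpmul2r => //.
exact: ereal_amgm.
Qed.

End schur.

Section fourth_moment.
Local Open Scope ereal_scope.
Context (R : realType) (n : nat).
Local Notation V := (n.-tuple R).
Local Notation mu := (lebn R n).

Variables (W : V -> \bar R).
Hypotheses (W0 : forall x, 0 <= W x) (mW : measurable_fun setT W).

Lemma correl_ge0 z : 0 <= correl W z.
Proof. by apply: integral_ge0 => y _; apply: mule_ge0. Qed.

Lemma measurable_correl : measurable_fun setT (correl W).
Proof.
apply: (@measurable_int1 _ _ _ _ _ mu (fun z y => W (vadd y z) * W y)).
by apply: emeasurable_funM; apply: (measurable_app mW); meas.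
Qed.

Lemma integral_correl (g : V -> \bar R) : (forall x, 0 <= g x) -> measurable_fun setT g ->
  \int[prodm mu mu]_w (W w.1 * W w.2 * g (vsub w.1 w.2)) = \int[mu]_z (correl W z * g z).
Proof.
move=> g0 mg.
have h0 (w : V * V) : 0 <= W w.1 * W w.2 * g (vsub w.1 w.2) by rewrite !mule_ge0.
have mh : measurable_fun setT (fun w : V * V => W w.1 * W w.2 * g (vsub w.1 w.2)).
  apply: emeasurable_funM; last by apply: (measurable_app mg); meas.
  by apply: emeasurable_funM; apply: (measurable_app mW); meas.
rewrite [LHS](fubini_tonelli2 _ mh h0) /fubini_G.
transitivity (\int[mu]_y \int[mu]_z (W (vadd y z) * W y * g z)).
  apply: eq_integral => y _; rewrite -[LHS](lebn_translate y); last 2 first.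
  - exact: (@measurable_section2 _ _ _ _ _ _ (fun x y => W x * W y * g (vsub x y)) y mh).
  - by move=> x; exact: (h0 (x, y)).
  apply: eq_integral => z _ /=; congr (W _ * _ * g _).
    by apply: eq_from_tnth => i; rewrite !tnthE; ring.
  by apply: eq_from_tnth => i; rewrite !tnthE; ring.
have mz : measurable_fun setT (fun p : V * V => W (vadd p.1 p.2) * W p.1).
  by apply: emeasurable_funM; apply: (measurable_app mW); meas.
rewrite tonelli_swap; last 2 first.
- by apply: emeasurable_funM mz _; apply: (measurable_app mg); meas.
- by move=> y z; rewrite !mule_ge0.
apply: eq_integral => z _; rewrite /correl (intZr mu (g0 z)) => //.
- by move=> y; apply: mule_ge0.
- exact: (@measurable_section2 _ _ _ _ _ _ (fun y z => W (vadd y z) * W y) z mz).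
Qed.

Variable phi : V -> R.
Hypotheses (iphi : mu.-integrable setT (EFin \o phi)) (phiW : forall x, `|phi x|%:E <= W x).

Let mphi : measurable_fun setT phi.
Proof. by move/measurable_int: iphi => /measurable_EFinP. Qed.

(** For real [phi] the Fourier transform is [cosT phi - i sinT phi]; keeping the two parts apart
    leaves all integrals real. *)
Definition cosT (xi : V) : R := (\int[mu]_x (phi x * cos (2 * pi * dotp x xi)))%R.
Definition sinT (xi : V) : R := (\int[mu]_x (phi x * sin (2 * pi * dotp x xi)))%R.

Let Phi (w : V * V) := (phi w.1 * phi w.2)%R.
Let X (w : V * V) : V := vscale (2 * pi) (vsub w.1 w.2).

Let mX : measurable_fun setT X.
Proof. by rewrite /X; meas. Qed.

Let iPhi : (prodm mu mu).-integrable setT (EFin \o Phi).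
Proof. exact: integrable_prod. Qed.

Let icos xi : mu.-integrable setT (EFin \o (fun x => phi x * cos (2 * pi * dotp x xi))%R).
Proof.
apply: (@integrable_mul_bounded _ _ _ _ phi _ 1) => //; first by meas.
by move=> x; rewrite ler_norml cos_geN1 cos_le1.
Qed.

Let isin xi : mu.-integrable setT (EFin \o (fun x => phi x * sin (2 * pi * dotp x xi))%R).
Proof.
apply: (@integrable_mul_bounded _ _ _ _ phi _ 1) => //; first by meas.
by move=> x; rewrite ler_norml sin_geN1 sin_le1.
Qed.

(** By [cos a cos b + sin a sin b = cos (a - b)]. A square of this quantity is then within reach of
    [square_kernel], which is how the fourth power is handled. *)
Lemma cosT_sinT_cosint xi :
  (cosT xi ^+ 2 + sinT xi ^+ 2 = cosint (prodm mu mu) Phi X xi)%R.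
Proof.
rewrite !expr2 -(integral_prod (icos xi) (icos xi)) -(integral_prod (isin xi) (isin xi)).
rewrite -RintegralD//; last 2 first.
- exact: (integrable_prod (icos xi) (icos xi)).
- exact: (integrable_prod (isin xi) (isin xi)).
apply: eq_Rintegral => w _; rewrite /Phi /X dotpZl dotpBl mulrBr cosB; ring.
Qed.

(** After [square_kernel], replacing [|phi|] by [W] gives half the sum of two quadratic forms in the
    autocorrelation, one for each sign in [X p.1 +- X p.2]. Their Poisson kernel has mass 1 in each
    variable, so Schur's test bounds both by the same energy, uniformly in [e]. *)
Lemma fourth_moment_reg (e : R) : (0 < e)%R ->
  \int[mu]_xi (expw e xi * (cosT xi ^+ 2 + sinT xi ^+ 2) ^+ 2)%:E <=
  \int[mu]_z (correl W z * correl W z).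
Proof.
move=> e0.
under eq_integral do rewrite cosT_sinT_cosint.
apply: le_trans (square_kernel iPhi mX e0) _.
pose k (z : V) : \bar R := (poisson e (vscale (2 * pi) z))%:E.
have k0 z : 0 <= k z by rewrite lee_fin poisson_ge0.
have mk : measurable_fun setT k.
  by apply: measurable_EFin'; apply: (measurable_app (@measurable_poisson R n e)); meas.
have k1 : \int[mu]_z k z = 1 by exact: integral_poisson.
have kN z z' : k (vsub z z') = k (vsub z' z).
  congr (_%:E); apply: eq_bigr => i _; rewrite !tnthE /poisson1; congr (_ / (_ + _))%R; ring.
have kD z : \int[mu]_z' k (vadd z' z) = 1 by rewrite (lebn_translate z mk k0).
have vaddC z z' : vadd z z' = vadd z' z :> V by apply: eq_from_tnth => i; rewrite !tnthE addrC.
have vsubE z z' : vsub z z' = vadd z (vscale (-1) z') :> V.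
  by apply: eq_from_tnth => i; rewrite !tnthE mulN1r.
have mU := measurable_correl; have U0 := correl_ge0.
pose WW (w : V * V) := W w.1 * W w.2.
have WW0 w : 0 <= WW w by apply: mule_ge0.
have mWW : measurable_fun setT WW by apply: emeasurable_funM; apply: (measurable_app mW); meas.
have main (q : V -> V -> V) : measurable_fun setT (fun p : V * V => q p.1 p.2) ->
    (forall x, \int[mu]_y k (q x y) <= 1) -> (forall y, \int[mu]_x k (q x y) <= 1) ->
    \int[prodm (prodm mu mu) (prodm mu mu)]_p (WW p.1 * WW p.2 * k (q (vsub p.1.1 p.1.2) (vsub p.2.1 p.2.2)))
    <= \int[mu]_z (correl W z * correl W z).
  move=> mq q1 q2.
  have mkq : measurable_fun setT (fun p : V * V => k (q p.1 p.2)) by exact: (measurable_app mk).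
  have mh : measurable_fun setT (fun p : (V * V) * (V * V) => WW p.1 * WW p.2 * k (q (vsub p.1.1 p.1.2) (vsub p.2.1 p.2.2))).
    apply: emeasurable_funM; first by apply: emeasurable_funM; apply: (measurable_app mWW); meas.
    by apply: (measurable_app mkq (_ : measurable_fun setT (fun p : (V * V) * (V * V) => (vsub p.1.1 p.1.2, vsub p.2.1 p.2.2)))); meas.
  rewrite [leLHS](fubini_tonelli1 _ mh); last by move=> p; rewrite !mule_ge0.
  rewrite /fubini_F.
  apply: le_trans (@schur _ _ _ mu (correl W) (fun x y => k (q x y)) mU U0 mkq (fun x y => k0 (q x y)) q1 q2).
  pose g z := \int[mu]_z' (correl W z' * k (q z z')).
  have g0 z : 0 <= g z by apply: integral_ge0 => z' _; apply: mule_ge0.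
  have mg : measurable_fun setT g.
    apply: (@measurable_int1 _ _ _ _ _ mu (fun z z' => correl W z' * k (q z z'))).
    by apply: emeasurable_funM; [apply: (measurable_app mU); meas|exact: mkq].
  rewrite -/(g _) -(integral_correl g0 mg) le_eqVlt; apply/orP; left; apply/eqP.
  apply: eq_integral => w _; rewrite /g.
  have mkqw : measurable_fun setT (fun z' => k (q (vsub w.1 w.2) z')).
    exact: (@measurable_section1 _ _ _ _ _ _ (fun z z' => k (q z z')) _ mkq).
  rewrite -(@integral_correl (fun z' => k (q (vsub w.1 w.2) z')) (fun z' => k0 _) mkqw).
  rewrite -(intZl _ (WW0 w)).
  - by apply: eq_integral => w' _; rewrite [RHS]muleA.
  - by move=> w'; apply: mule_ge0 => //; apply: mule_ge0.
  - by apply: emeasurable_funM; [exact: mWW|apply: (measurable_app mkqw); meas].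
have madd : measurable_fun setT (fun p : V * V => vadd p.1 p.2) by meas.
have msub : measurable_fun setT (fun p : V * V => vsub p.1 p.2) by meas.
have I1 : \int[prodm (prodm mu mu) (prodm mu mu)]_p (WW p.1 * WW p.2 * k (vadd (vsub p.1.1 p.1.2) (vsub p.2.1 p.2.2)))
    <= \int[mu]_z (correl W z * correl W z).
  apply: (main _ madd) => [x|y]; last by rewrite kD.
  by under eq_integral do rewrite vaddC; rewrite kD.
have I2 : \int[prodm (prodm mu mu) (prodm mu mu)]_p (WW p.1 * WW p.2 * k (vsub (vsub p.1.1 p.1.2) (vsub p.2.1 p.2.2)))
    <= \int[mu]_z (correl W z * correl W z).
  apply: (main _ msub) => [x|y]; last by under eq_integral do rewrite vsubE; rewrite kD.
  by under eq_integral do rewrite kN vsubE; rewrite kD.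
set UU := \int[mu]_z (correl W z * correl W z) in I1 I2 *.
have UU0 : 0 <= UU by apply: integral_ge0 => z _; apply: mule_ge0.
apply: (@le_trans _ _ ((2^-1)%:E * (UU + UU))); last first.
  exact: ereal_half.
have h0 : 0 <= (2^-1 : R)%:E by rewrite lee_fin.
apply: le_trans (lee_wpmul2l h0 (leeD I1 I2)).
have mWW2 : measurable_fun setT (fun p : (V * V) * (V * V) => WW p.1 * WW p.2).
  by apply: emeasurable_funM; apply: (measurable_app mWW); meas.
have mi1 : measurable_fun setT (fun p : (V * V) * (V * V) => WW p.1 * WW p.2 * k (vadd (vsub p.1.1 p.1.2) (vsub p.2.1 p.2.2))).
  by apply: emeasurable_funM mWW2 _; apply: (measurable_app mk); meas.
have mi2 : measurable_fun setT (fun p : (V * V) * (V * V) => WW p.1 * WW p.2 * k (vsub (vsub p.1.1 p.1.2) (vsub p.2.1 p.2.2))).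
  by apply: emeasurable_funM mWW2 _; apply: (measurable_app mk); meas.
rewrite -ge0_integralD; last 5 first.
- by [].
- by move=> p _; rewrite !mule_ge0.
- exact: mi1.
- by move=> p _; rewrite !mule_ge0.
- exact: mi2.
rewrite -(intZl _ h0); last 2 first.
- by move=> p; rewrite adde_ge0// !mule_ge0.
- exact: (emeasurable_funD mi1 mi2).
have mpoi := @measurable_poisson R n e.
apply: le_int.
- by move=> p; rewrite lee_fin !mulr_ge0// addr_ge0// poisson_ge0.
- by apply: measurable_EFin'; rewrite /Phi; meas.
- by apply: emeasurable_funM; [meas|exact: (emeasurable_funD mi1 mi2)].
move=> p; rewrite -mulrA EFinM; apply: lee_wpmul2l => //.
rewrite -ge0_muleDr// EFinM; apply: lee_pmul.
- by rewrite lee_fin.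
- by rewrite lee_fin addr_ge0// poisson_ge0.
- rewrite /Phi !normrM !EFinM; apply: lee_pmul.
  + by rewrite -EFinM lee_fin mulr_ge0.
  + by rewrite -EFinM lee_fin mulr_ge0.
  + by apply: lee_pmul => //; rewrite lee_fin.
  + by apply: lee_pmul => //; rewrite lee_fin.
- rewrite /k -EFinD lee_fin le_eqVlt; apply/orP; left; apply/eqP.
  by congr (_ + _)%R; congr (poisson e _); apply: eq_from_tnth => i; rewrite /X !tnthE; ring.
Qed.

Lemma expwE (e : R) (xi : V) : (expw e xi = expR (- (e * \sum_(i < n) `|tnth xi i|)))%R.
Proof. by rewrite mulr_sumr -sumrN expR_sum. Qed.

Lemma measurable_cosT : measurable_fun setT cosT.
Proof.
by apply: (@measurable_Rint1 _ _ _ _ _ mu (fun xi x => phi x * cos (2 * pi * dotp x xi))%R); meas.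
Qed.

Lemma measurable_sinT : measurable_fun setT sinT.
Proof.
by apply: (@measurable_Rint1 _ _ _ _ _ mu (fun xi x => phi x * sin (2 * pi * dotp x xi))%R); meas.
Qed.

(** Along [e = 1/(j+1)] the damping factors increase to 1, so monotone convergence removes them. *)
Lemma fourth_moment : \int[mu]_xi ((cosT xi ^+ 2 + sinT xi ^+ 2) ^+ 2)%:E <=
  \int[mu]_z (correl W z * correl W z).
Proof.
pose h xi := ((cosT xi ^+ 2 + sinT xi ^+ 2) ^+ 2)%R.
have mc := measurable_cosT; have ms := measurable_sinT.
have mh : measurable_fun setT h by rewrite /h; meas.
have h0 xi : (0 <= h xi)%R by exact: sqr_ge0.
pose g (j : nat) xi := (expw j.+1%:R^-1 xi * h xi)%:E.
have mg j : measurable_fun setT (g j).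
  by apply: measurable_EFin'; have me := @measurable_expw R n j.+1%:R^-1; meas.
have g0 j xi : 0 <= g j xi by rewrite lee_fin mulr_ge0 ?expw_ge0.
have S0 (xi : V) : (0 <= \sum_(i < n) `|tnth xi i|)%R by apply: sumr_ge0.
have gnd xi : setT xi -> {homo g^~ xi : a b / (a <= b)%N >-> (a <= b)}.
  move=> _ a b ab; rewrite lee_fin ler_wpM2r// !expwE ler_expR lerN2 ler_wpM2r//.
  by rewrite lef_pV2 ?posrE ?ltr0n// ler_nat.
have glim xi : g j xi @[j --> \oo] --> (h xi)%:E.
  apply: cvg_EFin; first by apply: nearW.
  rewrite -[X in _ --> X]mul1r; apply: cvgM; last exact: cvg_cst.
  pose S := (\sum_(i < n) `|tnth xi i|)%R.
  have : expR (- (j.+1%:R^-1 * S)) @[j --> \oo] --> expR (- (0 * S))%R.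
    apply: (@continuous_cvg _ _ _ _ _ _ (@expR R)); first exact: continuous_expR.
    by apply: cvgN; apply: cvgM; [exact: cvg_harmonic|exact: cvg_cst].
  rewrite mul0r oppr0 expR0; apply: cvg_trans; apply: near_eq_cvg; apply: nearW => j.
  by rewrite expwE.
have -> : \int[mu]_xi (h xi)%:E = limn (fun j => \int[mu]_xi g j xi).
  rewrite -(monotone_convergence mu measurableT mg (fun j x _ => g0 j x) gnd).
  by apply: eq_integral => xi _; apply/esym/cvg_lim => //; exact: glim.
apply: lime_le.
  apply: ereal_nondecreasing_is_cvgn => a b ab; apply: le_int => // xi.
  exact: gnd.
by apply: nearW => j; apply: fourth_moment_reg.
Qed.

End fourth_moment.

(** * Duality for bounded functions of bounded support *)

Section pointwise.
Context (R : realType).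

(* Interpolation between [a^p] and [h^4], which is where [p <= 4/3] enters:
   for [a < 1] and [h^3 < k^3 a] one has [(a h)^3 <= k^3 a^4 <= (k a^p)^3]. *)
Lemma interpolation_le (p a h N k : R) : 1 <= p <= 4 / 3 -> 0 <= a -> 0 <= h -> h <= N ->
  0 < k -> a * h <= a `^ p * (N + k) + (k ^+ 3)^-1 * h ^+ 4.
Proof.
move=> /andP[p1 p43] a0 h0 hN k0.
have ap0 : 0 <= a `^ p by exact: powR_ge0.
have N0 : 0 <= N by exact: le_trans hN.
have k3 : 0 < k ^+ 3 by rewrite exprn_gt0.
have kh0 : 0 <= (k ^+ 3)^-1 * h ^+ 4 by rewrite mulr_ge0 ?invr_ge0 ?(ltW k3)// exprn_ge0.
have [a1|a1] := leP 1 a.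
  have aap : a <= a `^ p by rewrite -[leLHS](powRr1 a0); apply: ler_powR.
  rewrite mulrDr -addrA; apply: (le_trans (ler_pM a0 h0 aap hN)).
  by rewrite lerDl addr_ge0// mulr_ge0// ltW.
(* If [h^3 >= k^3 a], the term with [h^4] alone dominates [a h]. *)
have [ha|ha] := leP (k ^+ 3 * a) (h ^+ 3).
  apply: (@le_trans _ _ ((k ^+ 3)^-1 * h ^+ 4)).
    by rewrite mulrC ler_pdivlMl// exprS mulrCA ler_wpM2l.
  by rewrite lerDr mulr_ge0// addr_ge0// ltW.
have : a * h <= k * a `^ p.
  rewrite -(@ler_pXn2r _ 3)// ?nnegrE ?mulr_ge0 ?(ltW k0)// !exprMn.
  apply: (@le_trans _ _ (a ^+ 3 * (k ^+ 3 * a))).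
    by rewrite ler_wpM2l ?exprn_ge0// ltW.
  rewrite mulrCA -exprSr ler_wpM2l ?(ltW k3)//.
  have [->|an0] := eqVneq a 0; first by rewrite expr0n/= exprn_ge0// powR_ge0.
  have a_gt0 : 0 < a by rewrite lt_neqAle eq_sym an0.
  rewrite -(powR_mulrn 4 a0) -(powR_mulrn 3 ap0) -powRrM; apply: ger_powR.
    by rewrite (ltW a1) a_gt0.
  lra.
move=> /le_trans; apply.
by rewrite mulrDr mulrC addrAC lerDr addr_ge0// mulr_ge0.
Qed.

End pointwise.

Section nice_functions.
Context (R : realType) (n : nat).
Local Notation V := (n.-tuple R).
Local Notation mu := (lebn R n).

(** One constant controls both height and support, so that a single integrable function dominates a
    whole sequence. *)
Definition bdsupp (M : R) (phi : V -> R) := forall x, `|phi x| <= M * (incube M x)%:R.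

Definition nice (phi : V -> R) := measurable_fun setT phi /\ exists2 M, 0 <= M & bdsupp M phi.

Definition norm1 (phi : V -> R) : R := \int[mu]_x `|phi x|.

Lemma measurable_natr d (T : measurableType d) (b : T -> bool) :
  measurable_fun setT b -> measurable_fun setT (fun x => (b x)%:R : R).
Proof. by move=> mb; apply/measurable_EFinP; exact: measurable_ind. Qed.

Lemma integrable_incube (M : R) : 0 <= M ->
  mu.-integrable setT (EFin \o (fun x : V => M * (incube M x)%:R)).
Proof.
move=> M0.
have mi := @measurable_incube R n M.
apply/integrableP; split.
  by apply/measurable_EFinP; apply: measurable_funM => //; exact: measurable_natr.
rewrite (_ : (\int[mu]_x _ = \int[mu]_x (M%:E * ind (incube M x)))%E); last first.
  by apply: eq_integral => x _; rewrite gee0_abs ?lee_fin ?mulr_ge0.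
rewrite intZl ?lee_fin//; last exact: measurable_ind.
by rewrite cube_volume// -EFinM ltry.
Qed.

Lemma bdsupp_le (M : R) phi x : bdsupp M phi -> 0 <= M -> `|phi x| <= M.
Proof.
move=> h M0; apply: le_trans (h x) _.
by case: (incube M x); rewrite ?mulr1// mulr0.
Qed.

Lemma le_bdsupp (M M' : R) phi : M <= M' -> 0 <= M -> bdsupp M phi -> bdsupp M' phi.
Proof.
move=> MM' M0 h x; apply: le_trans (h x) _; apply: ler_pM => //.
rewrite ler_nat; have [/incubeP xM|//] := boolP (incube M x).
by rewrite (_ : incube M' x)//; apply/incubeP => i; exact: le_trans (xM i) MM'.
Qed.

Lemma integrable_bdsupp (M : R) phi : 0 <= M -> measurable_fun setT phi -> bdsupp M phi ->
  mu.-integrable setT (EFin \o phi).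
Proof.
move=> M0 mphi h; apply: le_integrable (integrable_incube M0) => //.
  exact/measurable_EFinP.
by move=> x _; rewrite /= lee_fin (le_trans (h x))// ler_norm.
Qed.

Lemma nice_integrable phi : nice phi -> mu.-integrable setT (EFin \o phi).
Proof. by case=> mphi [M M0]; exact: integrable_bdsupp. Qed.

Lemma bdsupp_lin (M a b : R) f g : 0 <= M -> bdsupp M f -> bdsupp M g ->
  bdsupp ((`|a| + `|b| + 1) * M) (fun x => a * f x + b * g x).
Proof.
move=> M0 hf hg x; have M1 : M <= (`|a| + `|b| + 1) * M.
  by rewrite -[leLHS]mul1r ler_wpM2r// lerDr addr_ge0.
apply: (@le_trans _ _ ((`|a| + `|b| + 1) * M * (incube M x)%:R)); last first.
  apply: ler_wpM2l; first by rewrite (le_trans M0 M1).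
  rewrite ler_nat; have [/incubeP xM|//] := boolP (incube M x).
  by rewrite (_ : incube _ x)//; apply/incubeP => i; exact: le_trans (xM i) M1.
apply: le_trans (ler_normD _ _) _; rewrite !normrM -mulrA mulrDl mulrDl -addrA.
apply: lerD; first exact: ler_wpM2l.
by rewrite -[leLHS]addr0; apply: lerD; [exact: ler_wpM2l|rewrite mul1r mulr_ge0].
Qed.

Lemma nice_lin (a b : R) f g : nice f -> nice g -> nice (fun x => a * f x + b * g x).
Proof.
move=> [mf [M1 M10 h1]] [mg [M2 M20 h2]]; split; first by meas.
have M0 : 0 <= M1 + M2 by rewrite addr_ge0.
exists ((`|a| + `|b| + 1) * (M1 + M2)); first by rewrite mulr_ge0// !addr_ge0.
by apply: bdsupp_lin => //; [apply: le_bdsupp h1|apply: le_bdsupp h2]; rewrite ?lerDl ?lerDr.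
Qed.

Lemma norm1_ge0 phi : 0 <= norm1 phi.
Proof. by apply: Rintegral_ge0. Qed.

(** The modulus of the Fourier transform of the real function [phi]. *)
Definition hnorm (phi : V -> R) (xi : V) : R := Num.sqrt (cosT phi xi ^+ 2 + sinT phi xi ^+ 2).

Lemma hnorm_ge0 phi xi : 0 <= hnorm phi xi.
Proof. exact: sqrtr_ge0. Qed.

Lemma hnorm_sqr phi xi : hnorm phi xi ^+ 2 = cosT phi xi ^+ 2 + sinT phi xi ^+ 2.
Proof. by rewrite sqr_sqrtr// addr_ge0 ?sqr_ge0. Qed.

Lemma measurable_hnorm phi : mu.-integrable setT (EFin \o phi) -> measurable_fun setT (hnorm phi).
Proof.
move=> mphi; have mc := measurable_cosT mphi; have ms := measurable_sinT mphi.
by rewrite /hnorm; meas.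
Qed.

(** Read off from the square written as a double integral against a cosine; bounding the cosine and
    sine parts separately would lose a factor. *)
Lemma hnorm_le phi xi : mu.-integrable setT (EFin \o phi) -> hnorm phi xi <= norm1 phi.
Proof.
move=> iphi; rewrite -(@ler_pXn2r _ 2)// ?nnegrE ?hnorm_ge0 ?norm1_ge0//.
rewrite hnorm_sqr (cosT_sinT_cosint iphi) /cosint.
have iabs : mu.-integrable setT (EFin \o (fun x => `|phi x|)) by exact: (integrable_abse iphi).
have iPhi := integrable_prod iphi iphi.
have mX : measurable_fun setT (fun w : V * V => cos (dotp (vscale (2 * pi) (vsub w.1 w.2)) xi)) by meas.
have ic : (prodm mu mu).-integrable setT (EFin \o (fun w : V * V => (phi w.1 * phi w.2) * cos (dotp (vscale (2 * pi) (vsub w.1 w.2)) xi))).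
  apply: (integrable_mul_bounded (M := 1) iPhi mX).
  by move=> w; rewrite ler_norml cos_geN1 cos_le1.
apply: le_trans (ler_norm _) _.
apply: le_trans (le_normr_Rintegral _ ic) _ => //.
rewrite expr2 -(integral_prod iabs iabs); apply: le_Rintegral => //.
- exact: (integrable_abse ic).
- exact: (integrable_prod iabs iabs).
- move=> w _; rewrite normrM normrM -[leRHS]mulr1 ler_wpM2l ?mulr_ge0//.
  by rewrite ler_norml cos_geN1 cos_le1.
Qed.

(** Integrates [interpolation_le] with [h] the modulus of the transform: it is at most [norm1 phi],
    and its fourth moment is at most [Q]. The parameter [k] stays free and is chosen differently in
    the two uses. *)
Lemma duality_le (W : V -> \bar R) (phi a : V -> R) (p k dl Q : R) :
  1 <= p <= 4 / 3 -> 0 < k ->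
  (forall x, 0 <= W x)%E -> measurable_fun setT W ->
  mu.-integrable setT (EFin \o phi) -> (forall x, `|phi x|%:E <= W x)%E ->
  measurable_fun setT a -> (forall x, 0 <= a x) ->
  (\int[mu]_x (a x `^ p)%:E = dl%:E)%E ->
  (\int[mu]_z (correl W z * correl W z) <= Q%:E)%E ->
  (\int[mu]_x (a x * hnorm phi x)%:E <= (dl * (norm1 phi + k) + (k ^+ 3)^-1 * Q)%:E)%E.
Proof.
move=> p43 k0 W0 mW iphi phiW ma a0 adl hQ.
have mphi : measurable_fun setT phi by move/measurable_int: iphi => /measurable_EFinP.
have mh := measurable_hnorm iphi.
have Nk : 0 <= norm1 phi + k by rewrite addr_ge0 ?norm1_ge0// ltW.
have k3 : 0 <= (k ^+ 3)^-1 by rewrite invr_ge0 exprn_ge0// ltW.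
apply: (@le_trans _ _ (\int[mu]_x ((a x `^ p)%:E * (norm1 phi + k)%:E + (k ^+ 3)^-1%:E * (hnorm phi x ^+ 4)%:E))%E).
  apply: le_int.
  - by move=> x; rewrite lee_fin mulr_ge0 ?hnorm_ge0.
  - by apply: measurable_EFin'; meas.
  - by apply: emeasurable_funD; meas.
  - move=> x; rewrite -!EFinM -EFinD lee_fin; apply: interpolation_le => //.
      exact: hnorm_ge0.
    exact: hnorm_le.
rewrite ge0_integralD//; last 4 first.
- by move=> x _; rewrite -EFinM lee_fin mulr_ge0 ?powR_ge0.
- by meas.
- by move=> x _; rewrite -EFinM lee_fin mulr_ge0 ?exprn_ge0 ?hnorm_ge0.
- by meas.
rewrite intZr; [|by rewrite lee_fin|by move=> x; rewrite lee_fin powR_ge0|by meas].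
rewrite intZl; [|by rewrite lee_fin|by move=> x; rewrite lee_fin exprn_ge0 ?hnorm_ge0|by meas].
rewrite adl (EFinD (dl * _)) (EFinM dl); apply: leeD => //; rewrite [leRHS]EFinM; apply: lee_wpmul2l; first by rewrite lee_fin.
apply: le_trans hQ; apply: le_trans (fourth_moment W0 mW iphi phiW).
rewrite le_eqVlt; apply/orP; left; apply/eqP; apply: eq_integral => x _.
by rewrite -hnorm_sqr -exprM.
Qed.

(** The autocorrelation is at most [M N] and has integral at most [N^2]. This crude energy bound
    serves for bounded test functions that are unrelated to the sphere. *)
Lemma correl_sqr_le (W : V -> \bar R) (M N : R) : 0 <= M -> 0 <= N ->
  (forall x, 0 <= W x)%E -> measurable_fun setT W -> (forall x, W x <= M%:E)%E ->
  (\int[mu]_x W x <= N%:E)%E ->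
  (\int[mu]_z (correl W z * correl W z) <= (M * N ^+ 3)%:E)%E.
Proof.
move=> M0 N0 W0 mW WM hN.
have c0 := correl_ge0 W0; have mc := measurable_correl mW.
have cle z : (correl W z <= (M * N)%:E)%E.
  apply: (@le_trans _ _ (\int[mu]_y (M%:E * W y))%E).
    apply: le_int.
    - by move=> y; apply: mule_ge0.
    - by apply: emeasurable_funM => //; apply: (measurable_app mW); meas.
    - by meas.
    - by move=> y; apply: lee_wpmul2r.
  by rewrite intZl// EFinM; apply: lee_wpmul2l.
apply: (@le_trans _ _ (\int[mu]_z ((M * N)%:E * (correl W z * 1)))%E).
  apply: le_int.
  - by move=> z; apply: mule_ge0.
  - exact: emeasurable_funM.
  - by apply: emeasurable_funM; [meas|apply: emeasurable_funM => //; meas].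
  - by move=> z; rewrite mule1; apply: lee_wpmul2r.
rewrite intZl; last 3 first.
- by rewrite lee_fin mulr_ge0.
- by move=> z; rewrite mule1.
- by apply: emeasurable_funM => //; meas.
rewrite (_ : M * N ^+ 3 = (M * N) * (N * N)); last by ring.
rewrite [leRHS]EFinM; apply: lee_wpmul2l; first by rewrite lee_fin mulr_ge0.
rewrite -(@integral_correl _ _ W W0 mW (cst 1)%E); [|by move=> x; rewrite lee_fin|by meas].
rewrite (_ : (\int[_]_w _ = \int[prodm mu mu]_w (W w.1 * W w.2))%E); last first.
  by apply: eq_integral => w _; rewrite /= mule1.
rewrite [leLHS]fubini_tonelli1; last 2 first.
- by apply: emeasurable_funM; apply: (measurable_app mW); meas.
- by move=> w; apply: mule_ge0.
rewrite /fubini_F.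
have I0 : (0 <= \int[mu]_x W x)%E by apply: integral_ge0.
rewrite (_ : (\int[mu]_x _ = \int[mu]_x (W x * \int[mu]_y W y))%E); last first.
  by apply: eq_integral => x _; rewrite -intZl.
by rewrite intZr// EFinM; apply: lee_pmul.
Qed.

End nice_functions.

(** * A monotone class theorem *)

Lemma measurable_set_bool d (T : measurableType d) (b : T -> bool) :
  measurable_fun setT b -> measurable [set x | b x].
Proof.
by move=> mb; rewrite -[X in measurable X]setTI; exact: (mb measurableT [set true]).
Qed.

Section boxes.
Context (R : realType) (n : nat).
Local Notation V := (n.-tuple R).

Definition inbox (a b x : V) : bool := [forall i, tnth a i < tnth x i < tnth b i].

Lemma inboxP a b x : reflect (forall i, tnth a i < tnth x i < tnth b i) (inbox a b x).
Proof. exact: forallP. Qed.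

Definition boxes : set (set V) := [set A | exists a b, A = [set x | inbox a b x]].

Lemma setI_closed_boxes : setI_closed boxes.
Proof.
move=> _ _ [a1 [b1 ->]] [a2 [b2 ->]].
exists [tuple Num.max (tnth a1 i) (tnth a2 i) | i < n].
exists [tuple Num.min (tnth b1 i) (tnth b2 i) | i < n].
apply/seteqP; split => x /=.
  move=> [/inboxP h1 /inboxP h2]; apply/inboxP => i; rewrite !tnth_mktuple.
  by have /andP[? ?] := h1 i; have /andP[? ?] := h2 i; rewrite gt_max lt_min; apply/andP; split; apply/andP.
move=> /inboxP h; split; apply/inboxP => i; have := h i; rewrite !tnth_mktuple gt_max lt_min.
  by move=> /andP[/andP[-> _] /andP[-> _]].
by move=> /andP[/andP[_ ->] /andP[_ ->]].
Qed.

Lemma measurable_inbox a b : measurable_fun setT (inbox a b).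
Proof.
rewrite (_ : inbox a b = fun x => \big[andb/true]_i (tnth a i < tnth x i < tnth b i)); last first.
  by apply/funext => x; rewrite big_andE.
elim: (index_enum _) => [|i s IH].
  by rewrite (_ : (fun _ => _) = cst true)//; apply/funext => x; rewrite big_nil.
rewrite (_ : (fun _ => _) = fun x => (tnth a i < tnth x i < tnth b i) &&
    \big[andb/true]_(j <- s) (tnth a j < tnth x j < tnth b j)); last first.
  by apply/funext => x; rewrite big_cons.
by apply: measurable_and => //; meas.
Qed.

Lemma measurable_boxesE : @measurable _ V = <<s boxes >>.
Proof.
apply/seteqP; split => A.
  move=> mA.
  have mid : measurable_fun setT (id : g_sigma_algebraType boxes -> V).
    apply/measurable_fun_tnthP => i.
    have mE : @measurable default_measure_display R = <<s @RGenOInfty.G R >>.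
      exact: RGenOInfty.measurableE.
    have mi := @measurability _ _ (g_sigma_algebraType boxes) _ setT
      (fun x : g_sigma_algebraType boxes => tnth (x : V) i) _ mE.
    apply: mi => _ [_ [c ->] <-].
    (* A half-space [x_i > c] is exhausted by boxes whose lower bound is [c] in direction [i] and
       whose other bounds are [-k] and [k]. *)
    rewrite setTI (_ : _ @^-1` _ = \bigcup_k [set x | inbox [tuple if j == i then c else - k%:R | j < n] [tuple k%:R | j < n] x]).
      by apply: bigcupT_measurable => k; apply: sub_sigma_algebra; do 2 eexists.
    apply/seteqP; split => x /=; rewrite in_itv/= andbT.
      move=> cx; pose S := \sum_(j < n) `|tnth x j|.
      have Sx j : `|tnth x j| <= S by rewrite /S (bigD1 j)//= lerDl sumr_ge0.
      exists (Num.truncn S).+1 => //=; apply/inboxP => j; rewrite !tnth_mktuple.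
      have xk : `|tnth x j| < (Num.truncn S).+1%:R.
        by apply: le_lt_trans (Sx j) _; exact: truncnS_gt.
      move: xk; rewrite ltr_norml => /andP[k1 ->]; rewrite andbT.
      by case: eqP => [->//|_].
    by move=> [k _ /inboxP/(_ i)]; rewrite !tnth_mktuple eqxx => /andP[].
  by have := mid measurableT A mA; rewrite setTI.
apply: smallest_sub => //; first exact: sigma_algebra_measurable.
by move=> _ [a [b ->]]; apply: measurable_set_bool; exact: measurable_inbox.
Qed.

End boxes.

Section bumps.
Context (R : realType) (n : nat).
Local Notation V := (n.-tuple R).

Definition ebump (t : R) : R := (0 < t)%R%:R * expR (- t^-1).

Definition bump1 (c a b t : R) : R := ebump (c * (t - a)) * ebump (c * (b - t)).

(** A product of functions of type [exp(-1/t)], supported in the box. The parameter [c] steepens it: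
    as [c] tends to infinity every factor tends to 1 inside, so the bumps converge to the indicator
    of the open box. *)
Definition boxbump (c : R) (a b x : V) : R :=
  \prod_(i < n) bump1 c (tnth a i) (tnth b i) (tnth x i).

Lemma ebump_itv t : 0 <= ebump t <= 1.
Proof.
rewrite /ebump; case: ltP => [t0|_]; last by rewrite mul0r lexx ler01.
by rewrite mul1r expR_ge0/= -expR0 ler_expR oppr_le0 invr_ge0 ltW.
Qed.

Lemma bump1_itv c a b t : 0 <= bump1 c a b t <= 1.
Proof.
have /andP[h1 h2] := ebump_itv (c * (t - a)).
have /andP[h3 h4] := ebump_itv (c * (b - t)).
by rewrite /bump1 mulr_ge0//= mulr_ile1.
Qed.

Lemma bump_itv c a b x : 0 <= boxbump c a b x <= 1.
Proof.
apply: (big_ind (fun y : R => 0 <= y <= 1)) => [|y z|i _].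
- by rewrite ler01 lexx.
- by move=> /andP[y0 y1] /andP[z0 z1]; rewrite mulr_ge0// mulr_ile1.
- exact: bump1_itv.
Qed.

Lemma measurable_bump c a b : measurable_fun setT (boxbump c a b).
Proof.
apply: measurable_prod => i _; rewrite /bump1 /ebump.
apply: measurable_funM; apply: measurable_funM.
- by apply: measurable_natr; meas.
- by apply: (measurable_app (@measurable_expR R)); meas.
- by apply: measurable_natr; meas.
- by apply: (measurable_app (@measurable_expR R)); meas.
Qed.

Lemma ebump_cvg (t : R) : ebump (j.+1%:R * t) @[j --> \oo] --> ((0 < t)%R%:R : R).
Proof.
rewrite /ebump; have [t0|t0] := ltP 0 t; last first.
  apply: cvg_near_cst; apply: nearW => j.
  by rewrite pmulr_rgt0 ?ltr0n// ltNge t0/= mul0r.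
have : expR (- (j.+1%:R^-1 * t^-1)) @[j --> \oo] --> expR (- (0 * t^-1)).
  apply: (@continuous_cvg _ _ _ _ _ _ (@expR R)); first exact: continuous_expR.
  by apply: cvgN; apply: cvgM; [exact: cvg_harmonic|exact: cvg_cst].
rewrite mul0r oppr0 expR0; apply: cvg_trans; apply: near_eq_cvg; apply: nearW => j.
by rewrite pmulr_rgt0 ?ltr0n// t0 mul1r invfM.
Qed.

Lemma inboxE (a b x : V) :
  (inbox a b x)%:R = \prod_(i < n) ((0 < tnth x i - tnth a i)%R%:R * (0 < tnth b i - tnth x i)%R%:R) :> R.
Proof.
have [/inboxP h|] := boolP (inbox a b x).
  rewrite big1// => i _; have /andP[h1 h2] := h i.
  by rewrite !subr_gt0 h1 h2 mulr1.
rewrite negb_forall => /existsP[i hi]; rewrite (bigD1 i)//= !subr_gt0 -natrM mulnb.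
by rewrite (negbTE hi) mul0r.
Qed.

Lemma bump_cvg (a b x : V) : boxbump j.+1%:R a b x @[j --> \oo] --> ((inbox a b x)%:R : R).
Proof.
rewrite inboxE; apply: (@cvg_big _ _ _ _ xpredT (@mul_continuous R)) => i _.
by apply: cvgM; exact: ebump_cvg.
Qed.

Lemma bdsupp_inbox (a b : V) (phi : V -> R) (M : R) : 1 <= M ->
  (forall i, `|tnth a i| <= M) -> (forall i, `|tnth b i| <= M) ->
  (forall x, `|phi x| <= (inbox a b x)%:R) -> bdsupp M phi.
Proof.
move=> M1 aM bM h x; apply: le_trans (h x) _.
have [/inboxP hx|_] := boolP (inbox a b x); last by rewrite mulr_ge0// (le_trans ler01 M1).
rewrite (_ : incube M x) ?mulr1//; apply/incubeP => i; have /andP[h1 h2] := hx i.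
rewrite ler_norml; have := aM i; have := bM i; rewrite !ler_norml => /andP[b1 b2] /andP[a1 a2].
by rewrite (le_trans a1 (ltW h1)) (le_trans (ltW h2) b2).
Qed.

Lemma bump_inbox c (a b x : V) : 0 < c -> `|boxbump c a b x| <= (inbox a b x)%:R.
Proof.
move=> c0; have /andP[h0 h1] := bump_itv c a b x; rewrite ger0_norm//.
have [//|] := boolP (inbox a b x).
rewrite negb_forall => /existsP[i hi]; rewrite /boxbump (bigD1 i)//= /bump1 /ebump.
rewrite !pmulr_rgt0// !subr_gt0; case: (_ < tnth x i) hi => /=; last by rewrite !mul0r.
by move=> /negbTE ->; rewrite !(mul0r, mulr0).
Qed.

Section monotone_class.
Variable H : (V -> R) -> Prop.
Hypothesis Hlin : forall a b f g, nice f -> nice g -> H f -> H g ->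
  H (fun x => a * f x + b * g x).
Hypothesis Hlim : forall M (f_ : nat -> V -> R) f, 0 <= M ->
  (forall j, measurable_fun setT (f_ j)) -> (forall j, bdsupp M (f_ j)) ->
  (forall j, H (f_ j)) -> (forall x, f_ j x @[j --> \oo] --> f x) -> H f.
Hypothesis Hbump : forall j a b, H (boxbump j.+1%:R a b).

Let boxbound (a b : V) := 1 + \sum_(i < n) (`|tnth a i| + `|tnth b i|).

Let boxbound1 a b : 1 <= boxbound a b.
Proof. by rewrite lerDl sumr_ge0// => i _; rewrite addr_ge0. Qed.

Let boxboundP a b i : `|tnth a i| <= boxbound a b /\ `|tnth b i| <= boxbound a b.
Proof.
have h : `|tnth a i| + `|tnth b i| <= boxbound a b.
  rewrite /boxbound (bigD1 i)//= addrCA lerDl addr_ge0// sumr_ge0// => j _.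
by split; apply: le_trans h; rewrite ?lerDl ?lerDr.
Qed.

Lemma mclass_box a b : H (fun x => (inbox a b x)%:R).
Proof.
apply: (@Hlim (boxbound a b) (fun j => boxbump j.+1%:R a b)).
- exact: le_trans ler01 (boxbound1 a b).
- by move=> j; exact: measurable_bump.
- move=> j; apply: (@bdsupp_inbox a b) => //.
  + by move=> i; have [] := boxboundP a b i.
  + by move=> i; have [] := boxboundP a b i.
  + by move=> x; apply: bump_inbox.
- by move=> j; exact: Hbump.
- by move=> x; exact: bump_cvg.
Qed.

Variable M : R.
Hypothesis M1 : 1 <= M.
Let cb (x : V) := inbox [tuple - M | i < n] [tuple M | i < n] x.

Let M0 : 0 <= M. Proof. exact: le_trans ler01 M1. Qed.

Let mcb : measurable_fun setT cb.
Proof. exact: measurable_inbox. Qed.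

Let bdsupp_cb phi : (forall x, `|phi x| <= (cb x)%:R) -> bdsupp M phi.
Proof.
move=> h; apply: (bdsupp_inbox M1 _ _ h) => i; rewrite tnth_mktuple ?normrN;
by rewrite ger0_norm.
Qed.

Let nice_cb (A : set V) : measurable A -> nice (fun x => \1_A x * (cb x)%:R).
Proof.
move=> mA; split.
  by apply: measurable_funM; [exact: measurable_indic|exact: measurable_natr].
exists M => //; apply: bdsupp_cb => x; rewrite normrM indicE !normr_nat -[leRHS]mul1r.
by rewrite ler_wpM2r//; case: (_ \in _).
Qed.

(** Dynkin's theorem on the pi-system of boxes. The factor [cb] confines everything to a fixed cube,
    so that the common bound demanded by [Hlim] is available. *)
Lemma mclass_set A : measurable A -> H (fun x => \1_A x * (cb x)%:R).
Proof.
rewrite measurable_boxesE; move: A.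
apply: (dynkin_induction (measurable_boxesE R n) (@setI_closed_boxes R n)).
- rewrite (_ : (fun _ => _) = fun x => (cb x)%:R); first exact: mclass_box.
  by apply/funext => x; rewrite indicE in_setT mul1r.
- move=> _ [a [b ->]].
  have [a' [b' e]] : boxes ([set x : V | inbox a b x] `&` [set x : V | cb x]).
    by apply: setI_closed_boxes; do 2 eexists.
  rewrite (_ : (fun _ => _) = fun x => (inbox a' b' x)%:R); first exact: mclass_box.
  apply/funext => x; rewrite indicE -natrM mulnb; congr (_%:R); congr nat_of_bool.
  have /(congr1 (fun A => A x)) /= := e; move=> ee.
  apply/idP/idP => [/andP[/set_mem/= h1 h2]|h]; first by rewrite -ee.
  by move: h; rewrite -ee => -[h1 ->]; rewrite andbT mem_set.
- move=> A mA HA.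
  rewrite (_ : (fun _ => _) = fun x => 1 * (\1_setT x * (cb x)%:R) + (-1) * (\1_A x * (cb x)%:R)).
    apply: Hlin => //; [exact: nice_cb|exact: nice_cb|].
    rewrite (_ : (fun _ => _) = fun x => (cb x)%:R); first exact: mclass_box.
    by apply/funext => x; rewrite indicE in_setT mul1r.
  apply/funext => x; rewrite !indicE in_setT in_setC.
  by case: (x \in A) => /=; ring.
- move=> F mF tF HF.
  pose A j := \big[setU/set0]_(k < j) F k.
  have mA j : measurable (A j) by exact: bigsetU_measurable.
  have HA j : H (fun x => \1_(A j) x * (cb x)%:R).
    elim: j => [|j IH].
      rewrite (_ : (fun _ => _) = fun x => 0 * (\1_setT x * (cb x)%:R) + 0 * (\1_setT x * (cb x)%:R)).
        have HT : H (fun x => \1_setT x * (cb x)%:R).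
          rewrite (_ : (fun _ => _) = fun x => (cb x)%:R); first exact: mclass_box.
          by apply/funext => x; rewrite indicE in_setT mul1r.
        by apply: Hlin => //; exact: nice_cb.
      by apply/funext => x; rewrite /A big_ord0 indicE in_set0 !mul0r addr0.
    rewrite (_ : (fun _ => _) = fun x => 1 * (\1_(A j) x * (cb x)%:R) + 1 * (\1_(F j) x * (cb x)%:R)).
      by apply: Hlin => //; exact: nice_cb.
    apply/funext => x; rewrite /A big_ord_recr/= !indicE in_setU.
    have : A j `&` F j = set0.
      rewrite /A -bigcup_mkord; apply/seteqP; split => // y [[k /= kj Fk] Fj].
      have kE : k = j by apply: tF => //; exists y.
      by move: kj; rewrite kE ltnn.
    move=> /(congr1 (fun B => x \in B)); rewrite in_setI in_set0 /A.
    by case: (x \in _); case: (x \in F j) => //= _; ring.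
  apply: (@Hlim M (fun j x => \1_(A j) x * (cb x)%:R)) => //.
  + by move=> j; have [] := nice_cb (mA j).
  + move=> j; apply: bdsupp_cb => x; rewrite normrM indicE !normr_nat -[leRHS]mul1r.
    by rewrite ler_wpM2r//; case: (_ \in _).
  + move=> x; apply: cvg_near_cst; have [[k _ Fx]|nF] := pselect ((\bigcup_k F k) x).
      near=> j; rewrite !indicE !mem_set//; first by exists k.
      rewrite /A -bigcup_mkord; exists k => //=; near: j; exact: nbhs_infty_gt.
    apply: nearW => j; rewrite !indicE !memNset// /A -bigcup_mkord => -[k _ Fk].
    by apply: nF; exists k.
Unshelve. all: by end_near. Qed.

(** Greedy binary expansion of a function with values in [[0, 1]]: the partial sums are finite
    combinations of indicators and the remainder after [k] steps is at most [2^-k]. *)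
Let digit (phi : V -> R) := fix s (k : nat) (x : V) : R :=
  if k is k'.+1 then s k' x + 2^-1 ^+ k * \1_[set y | 2^-1 ^+ k <= phi y - s k' y] x else 0.

Lemma mclass_unit (phi : V -> R) : measurable_fun setT phi -> (forall x, 0 <= phi x <= (cb x)%:R) -> H phi.
Proof.
move=> mphi hphi.
have c1 x : (cb x)%:R <= 1 :> R by case: (cb x).
have inv k x : 0 <= digit phi k x /\ 0 <= phi x - digit phi k x <= 2^-1 ^+ k.
  have /andP[p0 p1] := hphi x.
  elim: k => [|k [IH0 /andP[IH1 IH2]]] /=; first by rewrite subr0 expr0 p0 (le_trans p1 (c1 x)).
  rewrite indicE; have h0 : 0 <= (2^-1 : R) ^+ k.+1 by rewrite exprn_ge0.
  have [/set_mem/= h|/negP h] := boolP (x \in _).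
    split; first by rewrite addr_ge0// mulr_ge0.
    rewrite mulr1 opprD addrA subr_ge0 h/= lerBlDr.
    by apply: le_trans IH2 _; rewrite exprS; lra.
  rewrite mulr0 addr0; split => //; rewrite IH1/=.
  by rewrite leNgt; apply/negP => lt; apply: h; rewrite mem_set//= ltW.
have ms k : measurable_fun setT (digit phi k).
  elim: k => [|k IH] /=; first by exact: measurable_cst.
  apply: measurable_funD => //; apply: measurable_funM => //.
  by apply: measurable_indic; apply: measurable_set_bool; meas.
have sc k x : `|digit phi k x| <= (cb x)%:R.
  have [h0 /andP[h1 h2]] := inv k x; rewrite ger0_norm//; have /andP[_] := hphi x.
  by apply: le_trans; rewrite -subr_ge0.
apply: (@Hlim M (digit phi)) => //.
- by move=> j; exact: bdsupp_cb.
- elim=> [|k IH] /=.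
    rewrite (_ : (fun _ => _) = fun x => 0 * (\1_setT x * (cb x)%:R) + 0 * (\1_setT x * (cb x)%:R)).
      by apply: Hlin; [exact: nice_cb|exact: nice_cb|exact: mclass_set|exact: mclass_set].
    by apply/funext => x; ring.
  pose A := [set y | 2^-1 ^+ k.+1 <= phi y - digit phi k y].
  have mA : measurable A.
    by have msk := ms k; apply: measurable_set_bool; meas.
  rewrite (_ : (fun _ => _) = fun x => 1 * digit phi k x + 2^-1 ^+ k.+1 * (\1_A x * (cb x)%:R)).
    apply: Hlin => //; [split => //; exists M => //; exact: bdsupp_cb|exact: nice_cb|exact: mclass_set].
  (* Outside the cube [phi] vanishes, the remainder is not positive and no digit is set, so the
     factor [cb] changes nothing. *)
  apply/funext => x; rewrite mul1r; congr (_ + _ * _); rewrite indicE.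
  have [/set_mem/= h|_] := boolP (x \in _); last by rewrite mul0r.
  rewrite mul1r; have /andP[p0] := hphi x; case: (cb x) => //= p1.
  have [s0 _] := inv k x; have : 0 < (2^-1 : R) ^+ k.+1 by rewrite exprn_gt0.
  by move: h; lra.
- move=> x; apply/cvgrPdist_le => e e0.
  have /cvgrPdist_le/(_ e e0) : (2^-1 : R) ^+ k @[k --> \oo] --> (0 : R).
    by apply: cvg_expr; rewrite ger0_norm// invf_lt1// ltr1n.
  apply: filterS => k; rewrite sub0r normrN ger0_norm ?exprn_ge0// => ke.
  by have [_ /andP[h1 h2]] := inv k x; rewrite ger0_norm// (le_trans h2 ke).
Qed.

End monotone_class.

(** It is used twice: to pass from Schwartz to bounded test functions in the weak form of the
    transform, and to identify the restriction operator on bounded functions of bounded support. *)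
Theorem monotone_class_nice (H : (V -> R) -> Prop) :
  (forall a b f g, nice f -> nice g -> H f -> H g -> H (fun x => a * f x + b * g x)) ->
  (forall M (f_ : nat -> V -> R) (f : V -> R), 0 <= M ->
    (forall j, measurable_fun setT (f_ j)) -> (forall j, bdsupp M (f_ j)) ->
    (forall j, H (f_ j)) -> (forall x, f_ j x @[j --> \oo] --> f x) -> H f) ->
  (forall j a b, H (boxbump j.+1%:R a b)) ->
  forall phi, nice phi -> H phi.
Proof.
move=> Hlin Hlim Hbump phi [mphi [M0 M00 hM]].
(* Adding 1 places the closed cube of half-side [M0] inside an open box, and gives [M >= 1]. *)
pose M := M0 + 1; have M1 : 1 <= M by rewrite lerDr.
have Mgt0 : 0 < M by exact: lt_le_trans ltr01 M1.
have unit (psi : V -> R) : measurable_fun setT psi -> (forall x, 0 <= psi x <= `|phi x|) ->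
    nice (fun x => psi x / M) /\ H (fun x => psi x / M).
  move=> mpsi hpsi.
  have h x : 0 <= psi x / M <= (inbox [tuple - M | i < n] [tuple M | i < n] x)%:R.
    have /andP[p0 p1] := hpsi x; rewrite divr_ge0// ?(ltW Mgt0)//= ler_pdivrMr//.
    apply: le_trans p1 _; apply: le_trans (hM x) _.
    have [/incubeP xM|_] := boolP (incube M0 x); last by rewrite mulr0 mulr_ge0// ltW.
    rewrite mulr1 (_ : inbox _ _ x) ?mul1r ?lerDl//; apply/inboxP => i; rewrite !tnth_mktuple.
    by rewrite -ltr_norml (le_lt_trans (xM i))// ltrDl.
  have mp : measurable_fun setT (fun x => psi x / M) by meas.
  split; last exact: (mclass_unit Hlin Hlim Hbump M1 mp h).
  split => //; exists M; first exact: ltW.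
  apply: (@bdsupp_inbox [tuple - M | i < n] [tuple M | i < n]) => // [i|i|x].
  - by rewrite tnth_mktuple normrN gtr0_norm.
  - by rewrite tnth_mktuple gtr0_norm.
  - by have /andP[h1 h2] := h x; rewrite ger0_norm.
have [||n1 H1] := unit (fun x => Num.max (phi x) 0).
- exact: measurable_maxr.
- move=> x; rewrite le_max lexx orbT ge_max normr_ge0 ler_norm //.
have [||n2 H2] := unit (fun x => Num.max (- phi x) 0).
- by apply: measurable_maxr => //; meas.
- by move=> x; rewrite le_max lexx orbT ge_max normr_ge0 andbT/= -normrN ler_norm.
rewrite (_ : phi = fun x => M * (Num.max (phi x) 0 / M) + (- M) * (Num.max (- phi x) 0 / M)).
  exact: Hlin.
apply/funext => x; have Mn : M != 0 by rewrite gt_eqF.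
rewrite mulrCA mulfV// mulr1 mulNr mulrCA mulfV// mulr1.
have [h|h] := leP 0 (phi x).
  by rewrite (_ : Num.max (- phi x) 0 = 0) ?subr0//; apply/max_idPr; rewrite oppr_le0.
rewrite (_ : Num.max (- phi x) 0 = - phi x) ?add0r ?opprK//.
by apply/max_idPl; rewrite oppr_ge0 ltW.
Qed.

End bumps.

(** * Bumps are Schwartz functions *)

Section flat_functions.
Context (R : realType).

Definition flat (P : {poly R}) (t : R) : R := (0 < t)%R%:R * (P.[t^-1] * expR (- t^-1)).

(** Since [(P(1/t) e^(-1/t))' = t^-2 (P - P')(1/t) e^(-1/t)], the functions [flat P] are closed
    under differentiation, and smoothness follows by iteration. *)
Definition flat_deriv (P : {poly R}) : {poly R} := 'X^2 * (P - P^`()).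

Lemma powers_le_expR (k : nat) : exists2 C : R, 0 <= C & forall s : R, 0 <= s -> s ^+ k * expR (- s) <= C.
Proof.
exists (k.+1%:R ^+ k); first by rewrite exprn_ge0.
move=> s s0; rewrite expRN ler_pdivrMr ?expR_gt0//.
(* From [t <= e^t] one gets [t^k <= e^(k t) <= e^s]; dividing by [k + 1] also makes sense for
   [k = 0]. *)
pose t := s / k.+1%:R; have sE : s = k.+1%:R * t by rewrite mulrC divfK// pnatr_eq0.
have t0 : 0 <= t by rewrite divr_ge0.
rewrite {1}sE exprMn ler_wpM2l ?exprn_ge0//.
apply: (@le_trans _ _ (expR t ^+ k)).
  rewrite lerXn2r ?nnegrE ?expR_ge0//; apply: le_trans (expR_ge1Dx t); by rewrite lerDr.
rewrite -expRM_natl ler_expR sE -mulr_natl ler_wpM2r//.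
by rewrite mulr1 ler_nat.
Qed.

Lemma poly_le_expR (P : {poly R}) (k : nat) :
  exists2 C : R, 0 <= C & forall s : R, 0 <= s -> `|P.[s]| * s ^+ k * expR (- s) <= C.
Proof.
elim/poly_ind: P k => [|P c IH] k.
  by exists 0 => // s _; rewrite horner0 normr0 !mul0r.
have [C1 C10 h1] := IH k.+1; have [C2 C20 h2] := powers_le_expR k.
exists (C1 + `|c| * C2); first by rewrite addr_ge0// mulr_ge0.
move=> s s0; rewrite !hornerE.
have e0 := expR_ge0 (- s); have sk : 0 <= s ^+ k by rewrite exprn_ge0.
apply: (@le_trans _ _ ((`|P.[s]| * s + `|c|) * s ^+ k * expR (- s))).
  rewrite ler_wpM2r// ler_wpM2r//; apply: le_trans (ler_normD _ _) _.
  by rewrite normrM (ger0_norm s0).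
rewrite !mulrDl; apply: lerD; last by rewrite -mulrA ler_wpM2l// h2.
by have := h1 s s0; rewrite exprS mulrA.
Qed.

Lemma flat_bounded (P : {poly R}) : exists2 C : R, 0 <= C & forall t, `|flat P t| <= C.
Proof.
have [C C0 h] := poly_le_expR P 0; exists C => // t; rewrite /flat.
have [t0|_] := ltP 0 t; last by rewrite mul0r normr0.
have := h t^-1; rewrite mul1r normrM (ger0_norm (expR_ge0 _)) expr0 mulr1.
by apply; rewrite invr_ge0 ltW.
Qed.

(** Quadratic vanishing makes the difference quotient at 0 tend to 0: this is the differentiability
    at the junction point. *)
Lemma flat_sqr (P : {poly R}) : exists2 C : R, 0 <= C & forall t, `|flat P t| <= C * t ^+ 2.
Proof.
have [C C0 h] := poly_le_expR P 2; exists C => // t; rewrite /flat.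
have [t0|_] := ltP 0 t; last by rewrite mul0r normr0 mulr_ge0// sqr_ge0.
have := h t^-1; rewrite mul1r normrM (ger0_norm (expR_ge0 _)) invr_ge0 (ltW t0) => /(_ isT).
by rewrite mulrAC exprVn ler_pdivrMr// exprn_gt0.
Qed.

Lemma flat_le0 P t : t <= 0 -> flat P t = 0.
Proof. by move=> t0; rewrite /flat ltNge t0 mul0r. Qed.

Lemma flatZ c P t : flat (c *: P) t = c * flat P t.
Proof. by rewrite /flat hornerZ; ring. Qed.

Lemma is_derive_flat (P : {poly R}) (t : R) : is_derive t 1 (flat P) (flat (flat_deriv P) t).
Proof.
have [t0|t0|->] := ltgtP t 0.
- apply: (@near_eq_is_derive _ _ _ (cst 0)).
    near=> y; rewrite flat_le0//; near: y; apply: filterS (lt_nbhsl t0) => y; exact: ltW.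
  by rewrite flat_le0 ?ltW//; exact: is_derive_cst.
- apply: (@near_eq_is_derive _ _ _ (fun y : R => P.[y^-1] * expR (- y^-1))).
    by near=> y; rewrite /flat (_ : 0 < y) ?mul1r//; near: y; exact: lt_nbhsr.
  have tn : t != 0 by rewrite gt_eqF.
  have dV : is_derive t 1 (fun y : R => y^-1) (- t ^- 2).
    apply: DeriveDef; first exact: derivableV.
    by rewrite deriveV// derive_id /GRing.scale/= mulr1.
  have d1 : is_derive t 1 (fun y : R => P.[y^-1]) (P^`().[t^-1] * - t ^- 2).
    by apply: (@is_derive1_comp _ (horner P) (fun y => y^-1)).
  have d2 : is_derive t 1 (fun y : R => expR (- y^-1)) (expR (- t^-1) * t ^- 2).
    have := @is_derive1_comp _ expR (fun y : R => - y^-1) t _ _ (is_derive_expR _) (is_deriveN dV).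
    by rewrite opprK.
  apply: is_derive_eq; rewrite /flat t0 mul1r /flat_deriv !hornerE /GRing.scale/= exprVn.
  ring.
rewrite flat_le0//.
have [C C0 h] := flat_sqr P; have C1 : 0 < C + 1 by rewrite ltr_wpDl.
have L : (fun h0 => h0^-1 *: ((flat P \o shift (0 : R)) (h0 *: (1 : R)) - flat P 0)) @ (0 : R)^' --> (0 : R).
  apply/cvgrPdist_le => e e0; near=> y.
  rewrite /= sub0r normrN addr0 /GRing.scale/= mulr1 (flat_le0 P (lexx 0)) subr0.
  have y0 : y != 0 by near: y; exact: nbhs_dnbhs_neq.
  rewrite normrM normfV ler_pdivrMl ?normr_gt0//; apply: le_trans (h y) _.
  rewrite -real_normK ?num_real// expr2 mulrCA ler_wpM2l//.
  apply: (@le_trans _ _ ((C + 1) * `|y|)); first by rewrite ler_wpM2r// lerDl.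
  rewrite mulrC -ler_pdivlMr//; near: y; apply: dnbhs0_le.
  by rewrite divr_gt0.
apply: DeriveDef; first by apply/cvg_ex; exists 0.
exact: cvg_lim L.
Unshelve. all: by end_near. Qed.

Variables c a b : R.

(** Derivatives of all orders of [bump1] as data: a list of pairs of polynomials, on which the
    Leibniz rule acts by [flat2_deriv]. *)
Definition flat2 (L : seq ({poly R} * {poly R})) (t : R) : R :=
  \sum_(PQ <- L) flat PQ.1 (c * (t - a)) * flat PQ.2 (c * (b - t)).

Definition flat2_deriv (L : seq ({poly R} * {poly R})) : seq ({poly R} * {poly R}) :=
  flatten [seq [:: (c *: flat_deriv PQ.1, PQ.2); (- c *: PQ.1, flat_deriv PQ.2)] | PQ <- L].

Lemma is_derive_flat2 L (t : R) : is_derive t 1 (flat2 L) (flat2 (flat2_deriv L) t).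
Proof.
elim: L => [|[P Q] L IH].
  rewrite (_ : flat2 [::] = cst 0); last by apply/funext => y; rewrite /flat2 big_nil.
  exact: is_derive_cst.
rewrite (_ : flat2 _ = (fun y => flat P (c * (y - a)) * flat Q (c * (b - y)) + flat2 L y)); last first.
  by apply/funext => y; rewrite /flat2 big_cons.
have -> : flat2 (flat2_deriv ((P, Q) :: L)) t =
    (c * flat (flat_deriv P) (c * (t - a))) * flat Q (c * (b - t)) +
    (- c * flat P (c * (t - a))) * flat (flat_deriv Q) (c * (b - t)) + flat2 (flat2_deriv L) t.
  by rewrite {1}/flat2 /flat2_deriv/= !big_cons/= !flatZ addrA.
have d1 : is_derive t 1 (fun y => flat P (c * (y - a))) (flat (flat_deriv P) (c * (t - a)) * c).
  apply: (@is_derive1_comp _ (flat P) (fun y => c * (y - a))); first exact: is_derive_flat.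
  by apply: is_derive_eq; rewrite /GRing.scale/=; ring.
have d2 : is_derive t 1 (fun y => flat Q (c * (b - y))) (flat (flat_deriv Q) (c * (b - t)) * - c).
  apply: (@is_derive1_comp _ (flat Q) (fun y => c * (b - y))); first exact: is_derive_flat.
  by apply: is_derive_eq; rewrite /GRing.scale/=; ring.
by apply: is_derive_eq; rewrite /GRing.scale/=; ring.
Qed.

Lemma flat2_bounded L : exists2 C : R, 0 <= C & forall t, `|flat2 L t| <= C.
Proof.
elim: L => [|[P Q] L [C C0 h]].
  by exists 0 => // t; rewrite /flat2 big_nil normr0.
have [C1 C10 h1] := flat_bounded P; have [C2 C20 h2] := flat_bounded Q.
exists (C1 * C2 + C); first by rewrite addr_ge0// mulr_ge0.
move=> t; rewrite /flat2 big_cons; apply: le_trans (ler_normD _ _) _; apply: lerD; last exact: h.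
by rewrite normrM ler_pM.
Qed.

Lemma flat2_supp L t : 0 < c -> ~~ (a < t < b) -> flat2 L t = 0.
Proof.
move=> c0; rewrite negb_and -!leNgt => h; rewrite /flat2 big1_seq// => PQ _.
case/orP: h => h.
  by rewrite (flat_le0 PQ.1) ?mul0r// pmulr_rle0// subr_le0.
by rewrite (flat_le0 PQ.2) ?mulr0// pmulr_rle0// subr_le0.
Qed.

End flat_functions.

Section schwartz_bumps.
Context (R : realType) (n : nat).
Local Notation V := (n.-tuple R).
Variables (c : R) (a b : V).
Hypothesis c0 : 0 < c.

Let u (i : 'I_n) (k : nat) : R -> R :=
  flat2 c (tnth a i) (tnth b i) (iter k (flat2_deriv c) [:: (1, 1)]).

(** Every iterated partial derivative of the bump has this form, [k i] being the number of
    derivatives in direction [i]; their order is irrelevant. *)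
Let prodf (k : 'I_n -> nat) (x : V) : R := \prod_(i < n) u i (k i) (tnth x i).

Let boxbumpE : boxbump c a b = prodf (fun=> 0%N).
Proof.
apply/funext => x; apply: eq_bigr => i _; rewrite /u /= /flat2 big_cons big_nil addr0.
by rewrite /bump1 /ebump /flat/= -polyC1 !hornerC !mul1r.
Qed.

Let is_derive_prodf i k x :
  is_derive (0 : R) 1 (fun h => prodf k (Defs.shift x i h)) (prodf (fun j => (k j + (j == i))%N) x).
Proof.
rewrite (_ : (fun h => _) = fun h => (\prod_(j < n | j != i) u j (k j) (tnth x j)) * u i (k i) (h + tnth x i)); last first.
  apply/funext => h; rewrite /prodf (bigD1 i)//= mulrC; congr (_ * _).
    by apply: eq_bigr => j ji; rewrite tnth_mktuple (negbTE ji) addr0.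
  by rewrite tnth_mktuple eqxx addrC.
have -> : prodf (fun j => (k j + (j == i))%N) x =
    (\prod_(j < n | j != i) u j (k j) (tnth x j)) * u i (k i).+1 (tnth x i).
  rewrite /prodf (bigD1 i)//= mulrC eqxx addn1; congr (_ * _).
  by apply: eq_bigr => j ji; rewrite (negbTE ji) addn0.
have du : is_derive (0 : R) 1 (fun h => u i (k i) (h + tnth x i)) (u i (k i).+1 (0 + tnth x i) * 1).
  apply: (@is_derive1_comp _ (u i (k i)) (fun h => h + tnth x i)).
    by rewrite /u iterS; exact: is_derive_flat2.
  by apply: is_derive_eq; rewrite addr0.
by apply: is_derive_eq; rewrite /GRing.scale/= add0r; ring.
Qed.

Let pders_prodf s : pders s (boxbump c a b) = prodf (fun j => count_mem j s).
Proof.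
elim: s => [|i s IH]; first exact: boxbumpE.
apply/funext => x /=; rewrite /pderiv IH derive1E.
have [_ ->] := is_derive_prodf i (fun j => count_mem j s) x.
by apply: eq_bigr => j _; congr (u j _ _); rewrite /= addnC eq_sym.
Qed.

(** All derivatives vanish off the box, and on it the polynomial weight is at most [(1 + S)^k]. *)
Lemma schwartzR_boxbump : schwartzR (boxbump c a b).
Proof.
move=> s; split.
  move=> i x; rewrite pders_prodf; by have [] := is_derive_prodf i (fun j => count_mem j s) x.
move=> k; rewrite pders_prodf.
have /choice[bnd hb] : forall i, exists C, forall t, `|u i (count_mem i s) t| <= C.
  move=> i; have [C _ hC] := flat2_bounded c (tnth a i) (tnth b i)
    (iter (count_mem i s) (flat2_deriv c) [:: (1, 1)]).
  by exists C.
pose S := \sum_(i < n) (`|tnth a i| + `|tnth b i|) ^+ 2.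
have S0 : 0 <= S by apply: sumr_ge0 => i _; exact: sqr_ge0.
have b0 i : 0 <= bnd i by exact: le_trans (normr_ge0 _) (hb i 0).
exists ((1 + S) ^+ k * \prod_(i < n) bnd i) => x.
have [/inboxP hx|] := boolP (inbox a b x); last first.
  rewrite negb_forall => /existsP[i hi]; rewrite /prodf (bigD1 i)//= /u flat2_supp// mul0r normr0 mulr0.
  by rewrite mulr_ge0 ?prodr_ge0// exprn_ge0// addr_ge0.
apply: ler_pM => //; first by rewrite exprn_ge0// addr_ge0 ?sqr_ge0.
- rewrite lerXn2r ?nnegrE ?addr_ge0 ?sqr_ge0// lerD2l enorm_sqr /dotp; apply: ler_sum => i _.
  rewrite -expr2 -real_normK ?num_real// lerXn2r ?nnegrE ?addr_ge0//.
  have /andP[h1 h2] := hx i; rewrite /Defs.coord ler_norml; apply/andP; split.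
    by apply: le_trans (ltW h1); rewrite lerNl (le_trans (ler_norm _))// normrN lerDl.
  by apply: le_trans (ltW h2) _; rewrite (le_trans (ler_norm _))// lerDr.
- by rewrite /prodf normr_prod; apply: ler_prod => i _; rewrite normr_ge0 hb.
Qed.

End schwartz_bumps.

Lemma pders0 (R : realType) n (s : seq 'I_n) : pders s (fun=> 0 : R) = fun=> 0.
Proof.
elim: s => [//|i s IH]; apply/funext => x /=; rewrite /pderiv IH.
by rewrite derive1E; exact: derive_cst.
Qed.

Lemma schwartzR0 (R : realType) n : schwartzR (fun _ : n.-tuple R => 0).
Proof.
move=> s; rewrite pders0; split; first by move=> i x; exact: derivable_cst.
by move=> k; exists 0 => x; rewrite normr0 mulr0.
Qed.

(** * The weak form of the Fourier transform *)

Lemma cvg_norm_le (R : realType) (u : nat -> R) (l B : R) :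
  (forall j, `|u j| <= B) -> u j @[j --> \oo] --> l -> `|l| <= B.
Proof.
move=> h ul; have cu : `|u j| @[j --> \oo] --> `|l| by exact: cvg_norm.
rewrite -(cvg_lim _ cu)//; apply: limr_le; last exact: nearW.
by apply/cvg_ex; exists (`|l|).
Qed.

Section real_dominated_convergence.
Context d (T : measurableType d) (R : realType) (m : {measure set T -> \bar R}).

Lemma Rintegral_dominated_cvg (f_ : nat -> T -> R) (f g : T -> R) :
  (forall j, measurable_fun setT (f_ j)) -> (forall x, f_ j x @[j --> \oo] --> f x) ->
  m.-integrable setT (EFin \o g) -> (forall j x, `|f_ j x| <= g x) ->
  (\int[m]_x f_ j x) @[j --> \oo] --> \int[m]_x f x.
Proof.
move=> mf_ cf ig fg.
have mf : measurable_fun setT f by apply: measurable_fun_cvg mf_ _ => x _; exact: cf.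
have fle x : `|f x| <= g x by apply: cvg_norm_le (cf x).
have fi : m.-integrable setT (EFin \o f).
  apply: le_integrable ig => //; first exact/measurable_EFinP.
  by move=> x _; rewrite /= lee_fin (le_trans (fle x))// ler_norm.
apply: fine_cvg; rewrite fineK; last exact: integrable_fin_num.
apply: (@dominated_cvg _ _ _ m setT measurableT _ _ (EFin \o g)) => //.
- by move=> j; exact/measurable_EFinP.
- by move=> x _; apply: cvg_EFin; [exact: nearW|exact: cf].
- by move=> j x _; rewrite lee_fin.
Qed.

End real_dominated_convergence.

(** * From smooth bumps to bounded test functions *)

Section weak_identity.
Context (R : realType) (n : nat).
Local Notation V := (n.-tuple R).
Local Notation mu := (lebn R n).

Lemma cosT_lin (a b : R) (f g : V -> R) xi :
  mu.-integrable setT (EFin \o f) -> mu.-integrable setT (EFin \o g) ->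
  cosT (fun x => a * f x + b * g x) xi = a * cosT f xi + b * cosT g xi.
Proof.
move=> fi gi.
have mc : measurable_fun setT (fun x : V => cos (2 * pi * dotp x xi)) by meas.
have bc (x : V) : `|cos (2 * pi * dotp x xi)| <= 1 by rewrite ler_norml cos_geN1 cos_le1.
have fi' := integrable_mul_bounded fi mc bc; have gi' := integrable_mul_bounded gi mc bc.
rewrite /cosT -!RintegralZl// -RintegralD//; last 2 first.
- by apply: (integrableZl _ a fi').
- by apply: (integrableZl _ b gi').
by apply: eq_Rintegral => x _; ring.
Qed.

Lemma sinT_lin (a b : R) (f g : V -> R) xi :
  mu.-integrable setT (EFin \o f) -> mu.-integrable setT (EFin \o g) ->
  sinT (fun x => a * f x + b * g x) xi = a * sinT f xi + b * sinT g xi.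
Proof.
move=> fi gi.
have mc : measurable_fun setT (fun x : V => sin (2 * pi * dotp x xi)) by meas.
have bc (x : V) : `|sin (2 * pi * dotp x xi)| <= 1 by rewrite ler_norml sin_geN1 sin_le1.
have fi' := integrable_mul_bounded fi mc bc; have gi' := integrable_mul_bounded gi mc bc.
rewrite /sinT -!RintegralZl// -RintegralD//; last 2 first.
- by apply: (integrableZl _ a fi').
- by apply: (integrableZl _ b gi').
by apply: eq_Rintegral => x _; ring.
Qed.

Definition locint (G : V -> R) := measurable_fun setT G /\
  forall M, 0 <= M -> mu.-integrable setT (EFin \o (fun x => G x * (incube M x)%:R)).

Lemma locint_mul_nice G phi : locint G -> nice phi ->
  mu.-integrable setT (EFin \o (fun x => G x * phi x)).
Proof.
move=> [mG iG] [mphi [M M0 h]].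
rewrite (_ : (fun x => _) = fun x => (G x * (incube M x)%:R) * phi x).
  by apply: (integrable_mul_bounded (M := M) (iG M M0) mphi) => x; exact: bdsupp_le.
apply/funext => x; have := h x; case: (incube M x) => [_|]; first by rewrite mulr1.
by rewrite mulr0 normr_le0 => /eqP ->; rewrite !mulr0.
Qed.

Lemma nice_norm1 (M : R) phi : 0 <= M -> measurable_fun setT phi -> bdsupp M phi ->
  (\int[mu]_x `|phi x|%:E = (norm1 phi)%:E)%E.
Proof.
move=> M0 mphi h; rewrite fineK//; apply: integrable_fin_num => //.
exact: (integrable_abse (integrable_bdsupp M0 mphi h)).
Qed.

Variables (p dl : R) (a : V -> R).
Hypotheses (p43 : 1 <= p <= 4 / 3) (ma : measurable_fun setT a) (a0 : forall x, 0 <= a x).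
Hypothesis adl : (\int[mu]_x (a x `^ p)%:E = dl%:E)%E.

Let dl0 : 0 <= dl.
Proof. by rewrite -lee_fin -adl; apply: integral_ge0 => x _; rewrite lee_fin powR_ge0. Qed.

(** The case [W = |phi|]. For fixed [M] the right side becomes small with [norm1 phi], once [k] has
    been chosen small; this is the continuity behind [pairing_cvg]. *)
Lemma duality_bdsupp (M k : R) phi : 0 <= M -> 0 < k -> measurable_fun setT phi -> bdsupp M phi ->
  (\int[mu]_x (a x * hnorm phi x)%:E <=
   (dl * (norm1 phi + k) + (k ^+ 3)^-1 * (M * norm1 phi ^+ 3))%:E)%E.
Proof.
move=> M0 k0 mphi h.
apply: (@duality_le _ _ (fun x => `|phi x|%:E) _ _ _ _ _ _ p43 k0) => //.
- by meas.
- exact: integrable_bdsupp h.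
apply: correl_sqr_le => //.
- exact: norm1_ge0.
- by meas.
- by move=> x; rewrite lee_fin; exact: bdsupp_le.
- by rewrite (nice_norm1 M0 mphi h).
Qed.

Variables (al be : V -> R).
Hypotheses (mal : measurable_fun setT al) (mbe : measurable_fun setT be).
Hypotheses (al_le : forall x, `|al x| <= a x) (be_le : forall x, `|be x| <= a x).

(* With [phi] real and [f = al + i be], the real part of [f * fourier phi]. *)
Definition pairing (phi : V -> R) (x : V) : R := al x * cosT phi x + be x * sinT phi x.

Lemma pairing_le phi x : `|pairing phi x| <= 2 * (a x * hnorm phi x).
Proof.
have hc : `|cosT phi x| <= hnorm phi x.
  by rewrite -sqrtr_sqr ler_wsqrtr// lerDl sqr_ge0.
have hs : `|sinT phi x| <= hnorm phi x.
  by rewrite -sqrtr_sqr ler_wsqrtr// lerDr sqr_ge0.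
apply: le_trans (ler_normD _ _) _; rewrite !normrM mulr_natl mulr2n.
by apply: lerD; exact: ler_pM.
Qed.

Lemma measurable_pairing phi : mu.-integrable setT (EFin \o phi) ->
  measurable_fun setT (pairing phi).
Proof.
move=> iphi; have mc := measurable_cosT iphi; have ms := measurable_sinT iphi.
by rewrite /pairing; meas.
Qed.

Lemma pairing_abs_le phi (Q : R) : mu.-integrable setT (EFin \o phi) ->
  (\int[mu]_x (a x * hnorm phi x)%:E <= Q%:E)%E ->
  mu.-integrable setT (EFin \o pairing phi) /\ `|\int[mu]_x pairing phi x| <= 2 * Q.
Proof.
move=> iphi hQ; have mp := measurable_pairing iphi; have mh := measurable_hnorm iphi.
have ah0 x : 0 <= a x * hnorm phi x by rewrite mulr_ge0 ?hnorm_ge0.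
have hI : (\int[mu]_x `|pairing phi x|%:E <= (2 * Q)%:E)%E.
  apply: (@le_trans _ _ (\int[mu]_x (2%:E * (a x * hnorm phi x)%:E))%E).
    apply: le_int.
    - by move=> x; rewrite lee_fin.
    - by apply: measurable_EFin'; meas.
    - by apply: emeasurable_funM; meas.
    - by move=> x; rewrite -EFinM lee_fin pairing_le.
  rewrite intZl//; first by rewrite EFinM; apply: lee_wpmul2l.
  by meas.
have ip : mu.-integrable setT (EFin \o pairing phi).
  apply/integrableP; split; first exact/measurable_EFinP.
  by apply: le_lt_trans hI _; rewrite ltry.
split => //; apply: le_trans (le_normr_Rintegral _ ip) _ => //.
rewrite -lee_fin; apply: le_trans hI; rewrite fineK//.
by apply: integrable_fin_num => //; exact: (integrable_abse ip).
Qed.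

Lemma pairing_nice phi : nice phi -> mu.-integrable setT (EFin \o pairing phi).
Proof.
move=> np; have ip := nice_integrable np; case: np => mphi [M M0 h].
by have [] := pairing_abs_le ip (duality_bdsupp M0 ltr01 mphi h).
Qed.

Variable G : V -> R.
Hypothesis lG : locint G.

Lemma norm1_cvg0 (M : R) (f_ : nat -> V -> R) (f : V -> R) : 0 <= M ->
  (forall j, measurable_fun setT (f_ j)) -> (forall j, bdsupp M (f_ j)) ->
  (forall x, f_ j x @[j --> \oo] --> f x) ->
  norm1 (fun x => 1 * f_ j x + (-1) * f x) @[j --> \oo] --> (0 : R).
Proof.
move=> M0 mf_ bf_ cf.
have mf : measurable_fun setT f by apply: measurable_fun_cvg mf_ _ => x _; exact: cf.
have bf : bdsupp M f by move=> x; apply: cvg_norm_le (cf x) => j; exact: bf_.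
pose M2 := (`|1| + `|-1| + 1) * M; have M20 : 0 <= M2 by rewrite mulr_ge0// !addr_ge0.
have -> : 0 = \int[mu]_x (cst 0 x) :> R by rewrite Rintegral_cst// mul0r.
apply: (@Rintegral_dominated_cvg _ _ _ mu _ _ (fun x => M2 * (incube M2 x)%:R)).
- by move=> j; have mj := mf_ j; meas.
- move=> x; rewrite -[X in _ --> X](normr0 R) ; apply: cvg_norm.
  have -> : 0 = 1 * f x + (-1) * f x by ring.
  by apply: cvgD; [apply: cvgM; [exact: cvg_cst|exact: cf]|exact: cvg_cst].
- exact: integrable_incube.
- by move=> j x; rewrite normr_id; apply: bdsupp_lin.
Qed.

(** The functions [al] and [be] are only dominated by an [L^p] function, so the products with
    transforms have no evident integrable majorant. Instead the differences tend to 0 in [L^1] with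
    a fixed [bdsupp] constant, and [duality_bdsupp] applies to them. *)
Lemma pairing_cvg (M : R) (f_ : nat -> V -> R) (f : V -> R) : 0 <= M ->
  (forall j, measurable_fun setT (f_ j)) -> (forall j, bdsupp M (f_ j)) ->
  (forall x, f_ j x @[j --> \oo] --> f x) ->
  (\int[mu]_x pairing (f_ j) x) @[j --> \oo] --> \int[mu]_x pairing f x.
Proof.
move=> M0 mf_ bf_ cf.
have mf : measurable_fun setT f by apply: measurable_fun_cvg mf_ _ => x _; exact: cf.
have bf : bdsupp M f by move=> x; apply: cvg_norm_le (cf x) => j; exact: bf_.
pose M2 := (`|1| + `|-1| + 1) * M; have M20 : 0 <= M2 by rewrite mulr_ge0// !addr_ge0.
pose psi j x := 1 * f_ j x + (-1) * f x.
have bpsi j : bdsupp M2 (psi j) by apply: bdsupp_lin.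
have mpsi j : measurable_fun setT (psi j) by have mj := mf_ j; rewrite /psi; meas.
have nf : nice f by split => //; exists M.
have nf_ j : nice (f_ j) by split => //; exists M.
have ipsi j := integrable_bdsupp M20 (mpsi j) (bpsi j).
have diff j : \int[mu]_x pairing (f_ j) x - \int[mu]_x pairing f x = \int[mu]_x pairing (psi j) x.
  rewrite -RintegralB//; [|exact: pairing_nice|exact: pairing_nice].
  apply: eq_Rintegral => x _; rewrite /pairing /psi cosT_lin ?sinT_lin; first ring;
  exact: nice_integrable.
have N0 : norm1 (psi j) @[j --> \oo] --> (0 : R) by exact: (norm1_cvg0 M0).
apply/cvgrPdist_le => e e0.
(* Chosen so that [2 dl k <= e / 2]; the [+ 1] guards against [dl = 0]. The remaining terms tend to
   0 with [norm1 (psi j)]. *)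
pose k := e / (4 * (dl + 1)).
have dl1 : 0 < dl + 1 by rewrite ltr_wpDl.
have k0 : 0 < k by rewrite divr_gt0// mulr_gt0.
have dk : 2 * (dl * k) <= e / 2.
  apply: (@le_trans _ _ (2 * ((dl + 1) * k))).
    by rewrite ler_wpM2l// ler_wpM2r ?(ltW k0)// lerDl.
  by rewrite /k le_eqVlt; apply/orP; left; apply/eqP; field; rewrite gt_eqF.
have t0 : 2 * (dl * norm1 (psi j) + (k ^+ 3)^-1 * (M2 * (norm1 (psi j) * (norm1 (psi j) * norm1 (psi j))))) @[j --> \oo] -->
    2 * (dl * 0 + (k ^+ 3)^-1 * (M2 * (0 * (0 * 0)))).
  apply: cvgM; first exact: cvg_cst.
  apply: cvgD; first by apply: cvgM; [exact: cvg_cst|exact: N0].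
  apply: cvgM; first exact: cvg_cst.
  apply: cvgM; first exact: cvg_cst.
  by apply: cvgM; [exact: N0|apply: cvgM; exact: N0].
have e2 : 0 < e / 2 by rewrite divr_gt0.
move/cvgrPdist_le: t0 => /(_ _ e2); apply: filterS => j.
rewrite !mulr0 addr0 mulr0 sub0r normrN => hj.
rewrite distrC diff.
have [_ h] := pairing_abs_le (ipsi j) (duality_bdsupp M20 k0 (mpsi j) (bpsi j)).
apply: le_trans h _.
have {}hj := le_trans (ler_norm _) hj.
rewrite (_ : e = e / 2 + e / 2); last by field.
apply: le_trans (lerD dk hj).
by rewrite le_eqVlt; apply/orP; left; apply/eqP; ring.
Qed.

Lemma weak_identity_limit (M : R) (f_ : nat -> V -> R) (f : V -> R) : 0 <= M ->
  (forall j, measurable_fun setT (f_ j)) -> (forall j, bdsupp M (f_ j)) ->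
  (forall j, \int[mu]_x (G x * f_ j x) = \int[mu]_x pairing (f_ j) x) ->
  (forall x, f_ j x @[j --> \oo] --> f x) ->
  \int[mu]_x (G x * f x) = \int[mu]_x pairing f x.
Proof.
move=> M0 mf_ bf_ Hf_ cf; have [mG iG] := lG.
have L2 := pairing_cvg M0 mf_ bf_ cf.
have L1 : (\int[mu]_x (G x * f_ j x)) @[j --> \oo] --> \int[mu]_x (G x * f x).
  apply: (@Rintegral_dominated_cvg _ _ _ mu _ _ (fun x => `|G x * (incube M x)%:R| * M)).
  - by move=> j; have mj := mf_ j; meas.
  - by move=> x; apply: cvgM; [exact: cvg_cst|exact: cf].
  - apply: (@integrable_mul_bounded _ _ _ mu (fun x => `|G x * (incube M x)%:R|) (cst M) M) => //.
    + exact: (integrable_abse (iG M M0)).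
    + by move=> x; rewrite /= ger0_norm.
  - move=> j x; rewrite !normrM -mulrA ler_wpM2l// mulrC normr_nat; exact: bf_.
move: L1; under eq_fun do rewrite Hf_.
by move=> L1; apply: (cvg_unique _ L1 L2).
Qed.

Theorem weak_identity_nice :
  (forall j b c, \int[mu]_x (G x * boxbump j.+1%:R b c x) = \int[mu]_x pairing (boxbump j.+1%:R b c) x) ->
  forall phi, nice phi -> \int[mu]_x (G x * phi x) = \int[mu]_x pairing phi x.
Proof.
move=> Hb; apply: monotone_class_nice; last exact: Hb.
- move=> c1 c2 f g nf ng Hf Hg.
  have fi := nice_integrable nf; have gi := nice_integrable ng.
  transitivity (\int[mu]_x (c1 * pairing f x + c2 * pairing g x)); last first.
    by apply: eq_Rintegral => x _; rewrite /pairing cosT_lin// sinT_lin//; ring.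
  transitivity (\int[mu]_x (c1 * (G x * f x) + c2 * (G x * g x))).
    by apply: eq_Rintegral => x _; ring.
  rewrite !RintegralD//.
  + by rewrite !RintegralZl ?Hf ?Hg//; first [exact: pairing_nice|exact: locint_mul_nice].
  + by apply: (integrableZl _ c1 (pairing_nice nf)).
  + by apply: (integrableZl _ c2 (pairing_nice ng)).
  + by apply: (integrableZl _ c1 (locint_mul_nice lG nf)).
  + by apply: (integrableZl _ c2 (locint_mul_nice lG ng)).
- move=> M f_ f M0 mf_ bf_ Hf_ cf; exact: weak_identity_limit M0 mf_ bf_ Hf_ cf.
Qed.

End weak_identity.

(** * Transforms of integrable functions *)

Section fourier_fubini.
Context (R : realType) (n : nat).
Local Notation V := (n.-tuple R).
Local Notation mu := (lebn R n).

(** The multiplication formula for transforms, with a bounded kernel [c] standing for cosine and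
    sine. *)
Lemma trig_fubini (c : R -> R) (f g : V -> R) : measurable_fun setT c ->
  (forall t, `|c t| <= 1) ->
  mu.-integrable setT (EFin \o f) -> mu.-integrable setT (EFin \o g) ->
  \int[mu]_x ((\int[mu]_y (f y * c (2 * pi * dotp y x))) * g x) =
  \int[mu]_x (f x * \int[mu]_y (g y * c (2 * pi * dotp y x))).
Proof.
move=> mc c1 fi gi.
have mcx (x : V) : measurable_fun setT (fun y : V => c (2 * pi * dotp y x)) by meas.
have fci x := integrable_mul_bounded (M := 1) fi (mcx x) (fun=> c1 _).
have gci x := integrable_mul_bounded (M := 1) gi (mcx x) (fun=> c1 _).
have mc2 : measurable_fun setT (fun p : V * V => c (2 * pi * dotp p.2 p.1)) by meas.
have ki : (prodm mu mu).-integrable setT (EFin \o (fun p : V * V => (g p.1 * f p.2) * c (2 * pi * dotp p.2 p.1))).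
  exact: (integrable_mul_bounded (M := 1) (integrable_prod gi fi) mc2 (fun=> c1 _)).
congr fine; transitivity (\int[mu]_x \int[mu]_y ((g x * f y) * c (2 * pi * dotp y x))%:E)%E.
  apply: eq_integral => x _; rewrite [LHS]EFinM fineK; last exact: (integrable_fin_num _ (fci x)).
  rewrite [LHS]muleC -(integralZl measurableT (fci x)).
  by apply: eq_integral => y _; rewrite -EFinM mulrA.
rewrite (Fubini ki); apply: eq_integral => y _.
rewrite [RHS]EFinM fineK; last exact: (integrable_fin_num _ (gci y)).
rewrite -(integralZl measurableT (gci y)).
by apply: eq_integral => x _; rewrite -EFinM /= (dotpC y x); congr (_%:E); ring.
Qed.

Lemma cosT_fubini f g : mu.-integrable setT (EFin \o f) -> mu.-integrable setT (EFin \o g) ->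
  \int[mu]_x (cosT f x * g x) = \int[mu]_x (f x * cosT g x).
Proof.
apply: (trig_fubini (c := @cos R)); first by apply: continuous_measurable_fun; exact: continuous_cos.
by move=> t; rewrite ler_norml cos_geN1 cos_le1.
Qed.

Lemma sinT_fubini f g : mu.-integrable setT (EFin \o f) -> mu.-integrable setT (EFin \o g) ->
  \int[mu]_x (sinT f x * g x) = \int[mu]_x (f x * sinT g x).
Proof.
apply: (trig_fubini (c := @sin R)); first by apply: continuous_measurable_fun; exact: continuous_sin.
by move=> t; rewrite ler_norml sin_geN1 sin_le1.
Qed.

Lemma cosT_le f x : mu.-integrable setT (EFin \o f) -> `|cosT f x| <= norm1 f.
Proof.
move=> fi; apply: le_trans (hnorm_le x fi).
by rewrite -sqrtr_sqr ler_wsqrtr// lerDl sqr_ge0.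
Qed.

Lemma sinT_le f x : mu.-integrable setT (EFin \o f) -> `|sinT f x| <= norm1 f.
Proof.
move=> fi; apply: le_trans (hnorm_le x fi).
by rewrite -sqrtr_sqr ler_wsqrtr// lerDr sqr_ge0.
Qed.

Lemma locint_bounded (G : V -> R) (M : R) : measurable_fun setT G -> (forall x, `|G x| <= M) -> locint G.
Proof.
move=> mG hG; split => // K K0.
have iK := integrable_incube n (le_trans K0 (_ : K <= K + 1)).
have i1 : mu.-integrable setT (EFin \o (fun x : V => (incube K x)%:R : R)).
  have K1 : 0 <= K + 1 by rewrite addr_ge0.
  apply: le_integrable (integrable_incube n K1) => //.
    by apply/measurable_EFinP; apply: measurable_natr; exact: measurable_incube.
  move=> x _; rewrite /= lee_fin normr_nat ger0_norm ?mulr_ge0//.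
  have [/incubeP h|_] := boolP (incube K x); last by rewrite mulr_ge0.
  rewrite (_ : incube (K + 1) x) ?mulr1 ?lerDr//; apply/incubeP => i.
  by apply: le_trans (h i) _; rewrite lerDl.
rewrite (_ : (fun x => _) = fun x => (incube K x)%:R * G x).
  exact: (integrable_mul_bounded i1 mG hG).
by apply/funext => x; rewrite mulrC.
Qed.

Lemma locintB (G1 G2 : V -> R) : locint G1 -> locint G2 -> locint (fun x => G1 x - G2 x).
Proof.
move=> [m1 i1] [m2 i2]; split; first by meas.
move=> M M0; rewrite (_ : (fun x => _) = fun x => G1 x * (incube M x)%:R - G2 x * (incube M x)%:R).
  by apply: (integrableB _ (i1 M M0) (i2 M M0)).
by apply/funext => x; rewrite mulrBl.
Qed.

(** Real and imaginary parts of the transform of [fR + i fI], from [e^(-i t) = cos t - i sin t]. *)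
Definition fourR (fR fI : V -> R) (x : V) : R := cosT fR x + sinT fI x.
Definition fourI (fR fI : V -> R) (x : V) : R := cosT fI x - sinT fR x.

Section transform.
Variables fR fI : V -> R.
Hypotheses (iR : mu.-integrable setT (EFin \o fR)) (iI : mu.-integrable setT (EFin \o fI)).

Lemma measurable_fourR : measurable_fun setT (fourR fR fI).
Proof.
have m1 := measurable_cosT iR; have m2 := measurable_sinT iI.
by rewrite /fourR; meas.
Qed.

Lemma measurable_fourI : measurable_fun setT (fourI fR fI).
Proof.
have m1 := measurable_cosT iI; have m2 := measurable_sinT iR.
by rewrite /fourI; meas.
Qed.

Lemma fourR_le x : `|fourR fR fI x| <= norm1 fR + norm1 fI.
Proof. by apply: le_trans (ler_normD _ _) _; apply: lerD; [exact: cosT_le|exact: sinT_le]. Qed.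

Lemma fourI_le x : `|fourI fR fI x| <= norm1 fI + norm1 fR.
Proof. by apply: le_trans (ler_normB _ _) _; apply: lerD; [exact: cosT_le|exact: sinT_le]. Qed.

Lemma locint_fourR : locint (fourR fR fI).
Proof. exact: locint_bounded measurable_fourR fourR_le. Qed.

Lemma locint_fourI : locint (fourI fR fI).
Proof. exact: locint_bounded measurable_fourI fourI_le. Qed.

Variable phi : V -> R.
Hypothesis nphi : nice phi.

Let ip := nice_integrable nphi.

Lemma integrable_trig_mul (c : V -> R) (f : V -> R) (M : R) : mu.-integrable setT (EFin \o f) ->
  measurable_fun setT c -> (forall x, `|c x| <= M) -> mu.-integrable setT (EFin \o (fun x => c x * f x)).
Proof.
move=> fi mc hc; rewrite (_ : (fun x => _) = fun x => f x * c x).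
  exact: (integrable_mul_bounded fi mc hc).
by apply/funext => x; rewrite mulrC.
Qed.

(** The transform of an integrable function obeys the same weak identity as [F]; subtracting the two
    gives the identity for the tail of a truncation. *)
Lemma fourR_weak : \int[mu]_x (fourR fR fI x * phi x) = \int[mu]_x pairing fR fI phi x.
Proof.
transitivity (\int[mu]_x (cosT fR x * phi x + sinT fI x * phi x)).
  by apply: eq_Rintegral => x _; rewrite /fourR mulrDl.
rewrite !RintegralD//.
- by rewrite cosT_fubini// sinT_fubini.
- exact: (integrable_mul_bounded iR (measurable_cosT ip) (fun x => cosT_le x ip)).
- exact: (integrable_mul_bounded iI (measurable_sinT ip) (fun x => sinT_le x ip)).
- exact: (integrable_trig_mul ip (measurable_cosT iR) (fun x => cosT_le x iR)).
- exact: (integrable_trig_mul ip (measurable_sinT iI) (fun x => sinT_le x iI)).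
Qed.

Lemma fourI_weak : \int[mu]_x (fourI fR fI x * phi x) = \int[mu]_x pairing fI (fun x => - fR x) phi x.
Proof.
transitivity (\int[mu]_x (cosT fI x * phi x - sinT fR x * phi x)).
  by apply: eq_Rintegral => x _; rewrite /fourI mulrBl.
transitivity (\int[mu]_x (fI x * cosT phi x - fR x * sinT phi x)); last first.
  by apply: eq_Rintegral => x _; rewrite /pairing mulNr.
rewrite !RintegralB//.
- by rewrite cosT_fubini// sinT_fubini.
- exact: (integrable_mul_bounded iI (measurable_cosT ip) (fun x => cosT_le x ip)).
- exact: (integrable_mul_bounded iR (measurable_sinT ip) (fun x => sinT_le x ip)).
- exact: (integrable_trig_mul ip (measurable_cosT iI) (fun x => cosT_le x iI)).
- exact: (integrable_trig_mul ip (measurable_sinT iR) (fun x => sinT_le x iR)).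
Qed.

End transform.

End fourier_fubini.

Section weak_bound.
Context (R : realType) (n : nat).
Local Notation V := (n.-tuple R).
Local Notation mu := (lebn R n).
Variables (p dl : R) (a al be G : V -> R).
Hypotheses (p43 : 1 <= p <= 4 / 3) (ma : measurable_fun setT a) (a0 : forall x, 0 <= a x).
Hypothesis adl : (\int[mu]_x (a x `^ p)%:E = dl%:E)%E.
Hypotheses (mal : measurable_fun setT al) (mbe : measurable_fun setT be).
Hypotheses (al_le : forall x, `|al x| <= a x) (be_le : forall x, `|be x| <= a x).
Hypothesis lG : locint G.
Hypothesis wG : forall phi, nice phi -> \int[mu]_x (G x * phi x) = \int[mu]_x pairing al be phi x.

(* Test the weak identity against [sgn(G) W]. *)
Lemma weak_bound (W : V -> R) (M k Q : R) : 0 <= M -> 0 < k -> measurable_fun setT W ->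
  (forall x, 0 <= W x) -> bdsupp M W ->
  (\int[mu]_z (correl (fun x => (W x)%:E) z * correl (fun x => (W x)%:E) z) <= Q%:E)%E ->
  (\int[mu]_x (`|G x| * W x)%:E <= (2 * (dl * (norm1 W + k) + (k ^+ 3)^-1 * Q))%:E)%E.
Proof.
move=> M0 k0 mW W0 bW hQ; have [mG _] := lG.
pose phi x := (if 0 <= G x then 1 else -1) * W x.
have mphi : measurable_fun setT phi.
  apply: measurable_funM => //; apply: measurable_fun_ifT => //.
  by apply: measurable_fun_ler => //; meas.
have phiW x : `|phi x| = W x.
  by rewrite /phi normrM (ger0_norm (W0 x)); case: ifP; rewrite ?normrN normr1 mul1r.
have bphi : bdsupp M phi by move=> x; rewrite phiW -[leLHS]ger0_norm.
have nphi : nice phi by split => //; exists M.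
have ip := nice_integrable nphi.
have hd : (\int[mu]_x (a x * hnorm phi x)%:E <= (dl * (norm1 phi + k) + (k ^+ 3)^-1 * Q)%:E)%E.
  apply: (@duality_le _ _ (fun x => (W x)%:E) _ _ _ _ _ _ p43 k0) => //.
  - by meas.
  - by move=> x; rewrite phiW.
have [_] := pairing_abs_le ma a0 mal mbe al_le be_le ip hd.
rewrite -(wG nphi).
have Gphi x : G x * phi x = `|G x| * W x.
  rewrite /phi; case: ifPn => [/ger0_norm->|]; first by rewrite mul1r.
  by rewrite -ltNge => /ltr0_norm ->; ring.
have -> : norm1 phi = norm1 W.
  by apply: eq_Rintegral => x _; rewrite phiW ger0_norm.
move=> h; have iG := locint_mul_nice lG nphi.
rewrite (_ : \int[mu]_x _ = (\int[mu]_x (G x * phi x))%:E)%E; last first.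
  rewrite fineK; last exact: integrable_fin_num.
  by apply: eq_integral => x _; rewrite Gphi.
by rewrite lee_fin; apply: le_trans h; exact: ler_norm.
Qed.

End weak_bound.

(** * The maximal estimate *)

Section maximal.
Context (R : realType) (n : nat).
Hypothesis n2 : (2 <= n)%N.
Local Notation V := (n.+1.-tuple R).
Local Notation mu := (lebn R n.+1).
Local Notation S := (@sphm R n.+1).
Local Notation om := (fine (omega R n.+1)).

Lemma om_gt0 : 0 < om.
Proof. by rewrite fine_gt0// omega_gt0 omega_lty. Qed.

Lemma omegaE : (omega R n.+1 = om%:E)%E.
Proof. by rewrite fineK// omega_fin. Qed.

Definition ballint (g : V -> R) (x : V) (r : R) : R :=
  \int[mu]_y (g y * (enorm (vsub x y) < r)%R%:R).

Lemma nice_ball (x : V) (r : R) : nice (fun y => (enorm (vsub x y) < r)%R%:R).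
Proof.
split; first by apply: measurable_natr; meas.
pose M := enorm x + `|r| + 1; have M1 : 1 <= M by rewrite lerDr addr_ge0// enorm_ge0.
exists M; first exact: le_trans ler01 M1.
move=> y; rewrite normr_nat.
have [h|_] := ltP (enorm (vsub x y)) r; last by rewrite mulr_ge0// (le_trans ler01 M1).
rewrite (_ : incube M y) ?mulr1//; apply/incubeP => i.
apply: le_trans (enorm_coord y i) _.
have := enorm_triangle x (vsub y x); rewrite (_ : vadd x (vsub y x) = y); last first.
  by apply: eq_from_tnth => j; rewrite !tnthE; ring.
rewrite (enorm_vsubC y); have := ler_norm r; rewrite /M; move: h; lra.
Qed.

Section levels.
Variables (g : V -> R) (eta : R).
Hypotheses (lg : locint g) (g0 : forall x, 0 <= g x) (eta0 : 0 < eta).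

Lemma ballint_integrable x r :
  mu.-integrable setT (EFin \o (fun y => g y * (enorm (vsub x y) < r)%R%:R)).
Proof. exact: locint_mul_nice (nice_ball x r). Qed.

Lemma ballintE x r :
  (\int[mu]_y ((g y)%:E * ind (enorm (vsub x y) < r)%R) = (ballint g x r)%:E)%E.
Proof.
rewrite fineK; first by apply: eq_integral => y _; rewrite -EFinM.
apply: integrable_fin_num => //; exact: ballint_integrable.
Qed.

Lemma measurable_ballint r : measurable_fun setT (fun x => ballint g x r).
Proof.
have [mg _] := lg.
apply: (@measurable_Rint1 _ _ _ _ _ mu (fun x y => g y * (enorm (vsub x y) < r)%R%:R)).
apply: measurable_funM; first by apply: (measurable_app mg); meas.
by apply: measurable_natr; meas.
Qed.

(** The average of [g] over [B(x, 2^-j)] exceeds [eta], with the volume of the ball multiplied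
    out. *)
Definition exceeds (j : nat) (x : V) : bool :=
  eta * om * (2^-1 ^+ j) ^+ n.+1 < ballint g x (2^-1 ^+ j).

Fixpoint exceeds_upto (j : nat) (x : V) : bool :=
  if j is j'.+1 then exceeds j x || exceeds_upto j' x else exceeds 0 x.

(** The smallest dyadic radius [2^-i], [i <= j], at which the average is large. A choice among
    finitely many radii is measurable and bounded below. The value 1 is also the default where no
    radius qualifies, and there [qweight] vanishes because of [e]. *)
Fixpoint exceeds_radius (j : nat) (x : V) : R :=
  if j is j'.+1 then (if exceeds j x then 2^-1 ^+ j else exceeds_radius j' x) else 1.

Lemma exceeds_uptoP j x : reflect (exists2 i, (i <= j)%N & exceeds i x) (exceeds_upto j x).
Proof.
elim: j => [|j IH] /=.
  apply: (iffP idP) => [h|[l]]; first by exists 0%N.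
  by rewrite leqn0 => /eqP ->.
apply: (iffP orP) => [[h|/IH[l lj h]]|[l]].
- by exists j.+1.
- by exists l => //; exact: leqW.
- rewrite leq_eqVlt => /orP[/eqP -> h|lj h]; first by left.
  by right; apply/IH; exists l.
Qed.

Lemma measurable_exceeds j : measurable_fun setT (exceeds j).
Proof.
have mb := measurable_ballint (2^-1 ^+ j).
by apply: measurable_fun_ltr.
Qed.

Lemma measurable_exceeds_upto j : measurable_fun setT (exceeds_upto j).
Proof.
elim: j => [|j IH] /=; first exact: measurable_exceeds.
by apply: measurable_or => //; exact: measurable_exceeds.
Qed.

Lemma measurable_exceeds_radius j : measurable_fun setT (exceeds_radius j).
Proof.
elim: j => [|j IH] /=; first exact: measurable_cst.
by apply: measurable_fun_ifT => //; exact: measurable_exceeds.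
Qed.

Lemma exceeds_radius_itv j x : 2^-1 ^+ j <= exceeds_radius j x <= 1.
Proof.
have h1 i : (2^-1 : R) ^+ i <= 1 by rewrite exprn_ile1// invf_le1// ler1n.
elim: j => [|j /andP[IH1 IH2]] /=; first by rewrite expr0 lexx.
case: ifP => _; first by rewrite lexx h1.
rewrite IH2 andbT (le_trans _ IH1)// exprS ler_piMl ?exprn_ge0//.
by rewrite invf_le1// ler1n.
Qed.

Lemma exceeds_radiusP j x : exceeds_upto j x ->
  eta * om * exceeds_radius j x ^+ n.+1 <= ballint g x (exceeds_radius j x).
Proof.
elim: j => [|j IH] /=; first by move=> /ltW.
by case: ifP => [/ltW //|_] /=; exact: IH.
Qed.

(** Exchanging the integrals in [g W], each point of the exceptional set contributes the integral of
    [g] over its ball times [r(x)^-d], which is at least [eta om]. *)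
Lemma exceeds_le j (B : R) :
  let W := Wfun (exceeds_radius j) (exceeds_upto j) in
  (\int[mu]_y ((g y)%:E * W y) <= B%:E)%E ->
  (S [set x | exceeds_upto j x] <= (B / (eta * om))%:E)%E.
Proof.
move=> W hB; have [mg _] := lg.
pose r := exceeds_radius j; pose e := exceeds_upto j.
have mr : measurable_fun setT r by exact: measurable_exceeds_radius.
have me : measurable_fun setT e by exact: measurable_exceeds_upto.
have r0 x : 0 < r x.
  by have /andP[h _] := exceeds_radius_itv j x; apply: lt_le_trans h; rewrite exprn_gt0.
have c0 : 0 < eta * om by rewrite mulr_gt0// om_gt0.
rewrite EFinM lee_pdivlMr// -integral_indE//.
rewrite -intZr//; [|by rewrite lee_fin ltW|exact: measurable_ind].
apply: le_trans hB; rewrite (integral_Wfun mr me r0); [|by move=> y; rewrite lee_fin|by meas].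
apply: le_int.
- by move=> x; apply: mule_ge0; [exact: ind_ge0|rewrite lee_fin ltW].
- by apply: emeasurable_funM; [exact: measurable_ind|meas].
- have mq := measurable_qweight mr me.
  apply: emeasurable_funM; first by meas.
  apply: (@measurable_int1 _ _ _ _ _ mu (fun x y => (g y)%:E * ind (enorm (vsub x y) < r x)%R)%E).
  by apply: emeasurable_funM; meas.
move=> x; rewrite ballintE -EFinM /qweight -/e lee_fin.
have := @exceeds_radiusP j x; rewrite -/e -/r; case: (e x) => h; last by rewrite !mul0r.
by rewrite !mul1r exprVn ler_pdivlMl ?exprn_gt0// mulrC; exact: h.
Qed.

End levels.

(** [N0] and [Q0] depend on the dimension only, in particular not on [j], so the bound survives the
    passage to all dyadic radii. [G1] and [G2] stand for the real and imaginary parts of a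
    transform. *)
Theorem maximal_estimate : exists N0 Q0 : R, [/\ 0 <= N0, 0 <= Q0 &
  forall (p dl : R) (a al be G1 G2 : V -> R) (eta k : R) (j : nat),
  1 <= p <= 4 / 3 -> measurable_fun setT a -> (forall x, 0 <= a x) ->
  (\int[mu]_x (a x `^ p)%:E = dl%:E)%E ->
  measurable_fun setT al -> measurable_fun setT be ->
  (forall x, `|al x| <= a x) -> (forall x, `|be x| <= a x) ->
  locint G1 -> locint G2 ->
  (forall phi, nice phi -> \int[mu]_x (G1 x * phi x) = \int[mu]_x pairing al be phi x) ->
  (forall phi, nice phi -> \int[mu]_x (G2 x * phi x) = \int[mu]_x pairing be (fun x => - al x) phi x) ->
  0 < eta -> 0 < k ->
  (S [set x | exceeds_upto (fun y => (`|G1 y| + `|G2 y|)%R) eta j x] <=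
   (4 * (dl * (N0 + k) + (k ^+ 3)^-1 * Q0) / (eta * om))%:E)%E].
Proof.
have [C C0 hC] := triple_sphere R n2.
pose sT := fine (S setT).
have sE : (S setT = sT%:E)%E by rewrite fineK// sphm_fin.
have sT0 : 0 <= sT by rewrite fine_ge0.
have om0 := om_gt0.
pose Q0 := om ^+ 2 * 2 * (4 * pair_energy_const n C).
(* [om * sT] bounds the mass of [W] and [Q0] its energy; the absolute value provides the sign
   required of the witness. *)
exists (om * sT), `|Q0|; split => //; first by rewrite mulr_ge0// ltW.
move=> p dl a al be G1 G2 eta k j p43 ma a0 adl mal mbe al_le be_le l1 l2 w1 w2 eta0 k0.
pose g y := `|G1 y| + `|G2 y|.
have lg : locint g.
  have [m1 i1] := l1; have [m2 i2] := l2; split; first by rewrite /g; meas.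
  move=> M M0; rewrite (_ : (fun x => _) = fun x => `|G1 x * (incube M x)%:R| + `|G2 x * (incube M x)%:R|).
    exact: (integrableD _ (integrable_abse (i1 M M0)) (integrable_abse (i2 M M0))).
  by apply/funext => x; rewrite !normrM normr_nat mulrDl.
have g0 x : 0 <= g x by rewrite addr_ge0.
pose r := exceeds_radius g eta j; pose e := exceeds_upto g eta j.
have mr : measurable_fun setT r by exact: measurable_exceeds_radius.
have me : measurable_fun setT e by exact: measurable_exceeds_upto.
pose dlt : R := 2^-1 ^+ j; have dlt0 : 0 < dlt by rewrite exprn_gt0.
have rl x : dlt <= r x by have /andP[] := exceeds_radius_itv g eta j x.
have ru x : r x <= 1 by have /andP[] := exceeds_radius_itv g eta j x.
have r0 x : 0 < r x by exact: lt_le_trans (rl x).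
pose W := Wfun r e.
have W0 x : (0 <= W x)%E by exact: Wfun_ge0.
have mW : measurable_fun setT W by exact: measurable_Wfun.
(* Depends on [j] through the smallest radius; it only shows that [W] is bounded, and disappears
   from the estimate. *)
pose B := dlt^-1 ^+ n.+1 * sT.
have B0 : 0 <= B by rewrite mulr_ge0// exprn_ge0// invr_ge0 ltW.
have WB x : (W x <= B%:E)%E.
  by have := Wfun_le mr me r0 x dlt0 rl; rewrite sE -EFinM.
pose w x := fine (W x).
have wE x : W x = (w x)%:E.
  rewrite fineK// ge0_fin_numE//; exact: le_lt_trans (WB x) (ltry _).
have mw : measurable_fun setT w by apply/measurable_EFinP; rewrite (_ : EFin \o w = W)//; apply/funext => x; rewrite wE.
have w0 x : 0 <= w x by rewrite -lee_fin -wE.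
pose M := B + 2; have M0 : 0 <= M by rewrite addr_ge0.
have bw : bdsupp M w.
  move=> x; rewrite ger0_norm//; have [x2|x2] := leP 2 (enorm x).
    by rewrite -lee_fin -wE /W (Wfun_supp mr me r0 ru x2) lee_fin mulr_ge0.
  rewrite (_ : incube M x) ?mulr1; first by rewrite -lee_fin -wE (le_trans (WB x))// lee_fin lerDl.
  apply/incubeP => i; apply: le_trans (enorm_coord x i) _; apply: le_trans (ltW x2) _.
  by rewrite lerDr.
have WE : W = fun x => (w x)%:E by apply/funext => x; exact: wE.
have hQ : (\int[mu]_z (correl (fun x => (w x)%:E) z * correl (fun x => (w x)%:E) z) <= `|Q0|%:E)%E.
  rewrite -WE; apply: le_trans (correl_energy mr me r0 C0 hC) _.
  by rewrite lee_fin ler_norm.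
have nw : norm1 w <= om * sT.
  rewrite -lee_fin EFinM -sE -omegaE; apply: le_trans (Wfun_mass mr me r0).
  rewrite -(nice_norm1 M0 mw bw) -/W WE le_eqVlt; apply/orP; left; apply/eqP.
  by apply: eq_integral => x _; rewrite ger0_norm.
have dl0 : 0 <= dl.
  by rewrite -lee_fin -adl; apply: integral_ge0 => x _; rewrite lee_fin powR_ge0.
have [m1 _] := l1; have [m2 _] := l2.
have b1 := weak_bound p43 ma a0 adl mal mbe al_le be_le l1 w1 M0 k0 mw w0 bw hQ.
have mal' : measurable_fun setT (fun x => - al x) by meas.
have al_le' x : `|- al x| <= a x by rewrite normrN.
have b2 := weak_bound p43 ma a0 adl mbe mal' be_le al_le' l2 w2 M0 k0 mw w0 bw hQ.
apply: (exceeds_le lg g0 eta0); rewrite -/r -/e -/W.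
under eq_integral do rewrite wE -EFinM mulrDl EFinD.
rewrite ge0_integralD//; last 4 first.
- by move=> x _; rewrite lee_fin mulr_ge0.
- by meas.
- by move=> x _; rewrite lee_fin mulr_ge0.
- by meas.
apply: le_trans (leeD b1 b2) _; rewrite -EFinD lee_fin.
rewrite -mulrDl -natrD ler_wpM2l// lerD2r ler_wpM2l// lerD2r//.
Qed.

End maximal.

(** * The restriction operator *)

Section complex_modulus.
Context (R : realType).
Local Notation C := R[i].
Local Notation Re := (@complex.Re R).
Local Notation Im := (@complex.Im R).

Lemma cabsE (z : C) : cabs z = complex.ComplexField.Normc.normc z.
Proof. by case: z. Qed.

Lemma cabs_ge0 (z : C) : 0 <= cabs z.
Proof. exact: sqrtr_ge0. Qed.

Lemma cabsD (z w : C) : cabs (z + w) <= cabs z + cabs w.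
Proof. by rewrite !cabsE; exact: le_normcD. Qed.

Lemma cabsM (z w : C) : cabs (z * w) = cabs z * cabs w.
Proof. by rewrite !cabsE; exact: complex.ComplexField.Normc.normcM. Qed.

Lemma cabsN (z : C) : cabs (- z) = cabs z.
Proof. by rewrite !cabsE; exact: normcN. Qed.

Lemma cabs_eq0 (z : C) : cabs z = 0 -> z = 0.
Proof. by rewrite cabsE; exact: complex.ComplexField.Normc.eq0_normc. Qed.

Lemma cabs0 : cabs (0 : C) = 0.
Proof. by rewrite cabsE complex.ComplexField.Normc.normc0. Qed.

Lemma Re_le_cabs (z : C) : `|Re z| <= cabs z.
Proof. by rewrite -sqrtr_sqr ler_wsqrtr// lerDl sqr_ge0. Qed.

Lemma Im_le_cabs (z : C) : `|Im z| <= cabs z.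
Proof. by rewrite -sqrtr_sqr ler_wsqrtr// lerDr sqr_ge0. Qed.

Lemma cabs_le_ReIm (z : C) : cabs z <= `|Re z| + `|Im z|.
Proof.
rewrite -(@ler_pXn2r _ 2)// ?nnegrE ?cabs_ge0 ?addr_ge0// sqr_sqrtr ?addr_ge0 ?sqr_ge0//.
rewrite sqrrD !real_normK ?num_real// -addrA lerD2l lerDr.
by rewrite mulrn_wge0// mulr_ge0.
Qed.

Lemma cReD (z w : C) : Re (z + w) = Re z + Re w.
Proof. by case: z w => [a b] [c d]. Qed.

Lemma cImD (z w : C) : Im (z + w) = Im z + Im w.
Proof. by case: z w => [a b] [c d]. Qed.

Lemma cReN (z : C) : Re (- z) = - Re z.
Proof. by case: z. Qed.

Lemma cImN (z : C) : Im (- z) = - Im z.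
Proof. by case: z. Qed.

Lemma cReM (z w : C) : Re (z * w) = Re z * Re w - Im z * Im w.
Proof. by case: z w => [a b] [c d]. Qed.

Lemma cImM (z w : C) : Im (z * w) = Re z * Im w + Im z * Re w.
Proof. by case: z w => [a b] [c d]. Qed.

Definition ReImE := (cReD, cImD, cReN, cImN, cReM, cImM).

Lemma complex_ext (z w : C) : Re z = Re w -> Im z = Im w -> z = w.
Proof. by case: z w => [a b] [c d] /= -> ->. Qed.

End complex_modulus.

Section sphere_ae.
Context (R : realType) (d : nat).
Local Notation V := (d.-tuple R).
Local Notation S := (@sphm R d).

Lemma measurable_cabs d' (T : measurableType d') (f : T -> R[i]) :
  measurable_fun setT (fun x => complex.Re (f x)) ->
  measurable_fun setT (fun x => complex.Im (f x)) ->
  measurable_fun setT (fun x => cabs (f x)).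
Proof. by move=> m1 m2; rewrite /cabs; meas. Qed.

Definition onsphere (x : V) : bool := dotp x x == 1.

Lemma measurable_onsphere : measurable_fun setT onsphere.
Proof. by apply: measurable_fun_eqr => //; meas. Qed.

Lemma sphereE : @sphere R d = [set x | onsphere x].
Proof. by apply/seteqP; split => x /eqP. Qed.

Lemma measurable_sphere : measurable (@sphere R d : set V).
Proof. by rewrite sphereE; apply: measurable_set_bool; exact: measurable_onsphere. Qed.

Lemma sphm_set (A : set V) : measurable A -> (S A = \int[S]_x (\1_A x)%:E)%E.
Proof. by move=> mA; rewrite integral_indic// setIT. Qed.

Lemma sphm_compl_sphere : S (~` (@sphere R d)) = 0%E.
Proof.
have mC := measurableC measurable_sphere.
rewrite sphm_set// integral_sphm; last 2 first.
- by apply/measurable_EFinP; exact: measurable_indic.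
- by move=> x; rewrite lee_fin.
rewrite integral0_eq// => x _; have [px|_] := boolP (pball x); last by rewrite mul0e.
by rewrite indicE memNset ?mule0//= => /(_ (sphere_sproj px)).
Qed.

Hypothesis d0 : (0 < d)%N.

(** The two notions differ off the sphere, whose complement is null for [sphm], and by the factor
    [d], which is nonzero. *)
Lemma sigma_aeE (P : V -> Prop) : sigma_ae P <-> {ae S, forall x, P x}.
Proof.
have dn0 : (d%:R%:E != 0 :> \bar R)%E by rewrite eqe pnatr_eq0 -lt0n.
have sE (N : set V) : measurable N -> (sint (fun x => (\1_N x)%:E) = d%:R%:E * S N)%E.
  move=> mN; rewrite sint_sphm; first by rewrite sphm_set.
  - by apply/measurable_EFinP; exact: measurable_indic.
  - by move=> x; rewrite lee_fin.
split.
  move=> [N [[mN]]]; rewrite sE// => /eqP; rewrite mule_eq0 (negbTE dn0)/= => /eqP SN hN.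
  exists (N `|` ~` (@sphere R d)); split.
  - by apply: measurableU => //; exact: (measurableC measurable_sphere).
  - rewrite measureU0//; last exact: sphm_compl_sphere.
    exact: (measurableC measurable_sphere).
  - move=> x /= nP; apply: contrapT => /not_orP[nN] /contrapT sx.
    by apply: nP; exact: hN.
move=> [N [mN SN hN]]; exists N; split; first by split => //; rewrite sE// SN mule0.
by move=> x _ nN; apply: contrapT => nP; apply: nN; exact: hN.
Qed.

End sphere_ae.

Section fourier_real.
Context (R : realType) (n : nat).
Local Notation V := (n.-tuple R).
Local Notation mu := (lebn R n).

Definition cpx (fR fI : V -> R) : V -> R[i] := fun x => Complex (fR x) (fI x).

Lemma cintE (f : V -> R[i]) :
  mu.-integrable setT (EFin \o (fun x => complex.Re (f x))) ->
  mu.-integrable setT (EFin \o (fun x => complex.Im (f x))) ->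
  cint f = Complex (\int[mu]_x complex.Re (f x)) (\int[mu]_x complex.Im (f x)).
Proof. by move=> iR iI; rewrite /cint (iint_integrableE iR) (iint_integrableE iI). Qed.

Lemma fourierE fR fI xi : mu.-integrable setT (EFin \o fR) -> mu.-integrable setT (EFin \o fI) ->
  fourier (cpx fR fI) xi = Complex (fourR fR fI xi) (fourI fR fI xi).
Proof.
move=> iR iI.
have mc : measurable_fun setT (fun x : V => cos (2 * pi * dotp x xi)) by meas.
have bc (x : V) : `|cos (2 * pi * dotp x xi)| <= 1 by rewrite ler_norml cos_geN1 cos_le1.
have ms : measurable_fun setT (fun x : V => sin (2 * pi * dotp x xi)) by meas.
have bs (x : V) : `|sin (2 * pi * dotp x xi)| <= 1 by rewrite ler_norml sin_geN1 sin_le1.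
have iRc := integrable_mul_bounded iR mc bc; have iRs := integrable_mul_bounded iR ms bs.
have iIc := integrable_mul_bounded iI mc bc; have iIs := integrable_mul_bounded iI ms bs.
rewrite /fourier.
have -> : (fun x => cpx fR fI x * cexpi (- (2 * pi * dotp x xi))) =
   cpx (fun x => fR x * cos (2 * pi * dotp x xi) + fI x * sin (2 * pi * dotp x xi))
     (fun x => fI x * cos (2 * pi * dotp x xi) - fR x * sin (2 * pi * dotp x xi)).
  by apply/funext => x; apply: complex_ext; rewrite ReImE /= cosN sinN; ring.
rewrite cintE /=.
- by rewrite RintegralD// RintegralB.
- exact: (integrableD _ iRc iIs).
- exact: (integrableB _ iIc iRs).
Qed.

End fourier_real.

Section operator.
Context (R : realType) (d : nat).
Local Notation V := (d.-tuple R).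
Local Notation mu := (lebn R d).
Local Notation S := (@sphm R d).
Hypothesis d0 : (0 < d)%N.
Variables (p : R) (T : (V -> R[i]) -> V -> R[i]).
Hypothesis p1 : 1 <= p.
Hypothesis hT : is_restriction_operator p T.

(* [T f] is only measurable on the sphere; [sphT f] is a measurable extension. *)
Definition sphT (f : V -> R[i]) (x : V) : R[i] := if onsphere x then T f x else 0.

Lemma sphT_sphere f x : @sphere R d x -> sphT f x = T f x.
Proof. by rewrite sphereE /sphT /= => ->. Qed.

Lemma ae_sphT (P : V -> Prop) : {ae S, forall x, @sphere R d x -> P x} -> {ae S, forall x, P x}.
Proof.
move=> [N [mN SN hN]]; exists (N `|` ~` (@sphere R d)); split.
- by apply: measurableU => //; exact: (measurableC (@measurable_sphere R d)).
- rewrite measureU0//; last exact: sphm_compl_sphere.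
  exact: (measurableC (@measurable_sphere R d)).
- move=> x /= nP; apply: contrapT => /not_orP[nN] /contrapT sx.
  by apply: nN; apply: hN => /= h; apply: nP; exact: h.
Qed.

Lemma measurable_sphT f : Lp p f ->
  measurable_fun setT (fun x => complex.Re (sphT f x)) /\
  measurable_fun setT (fun x => complex.Im (sphT f x)).
Proof.
have [mT _] := hT; move=> /mT [m1 m2].
have key (c : V -> R) : measurable_fun (@sphere R d : set V) c ->
    measurable_fun setT (fun x => if onsphere x then c x else 0).
  move=> mc; rewrite (_ : (fun x => _) = c \_ (@sphere R d)).
    exact: (measurable_restrictT c (@measurable_sphere R d)).1.
  apply/funext => x; rewrite patchE sphereE; case: ifPn => [h|h].
    by rewrite mem_set.
  by rewrite memNset//=; exact/negP.
split.
- rewrite (_ : (fun x => _) = fun x => if onsphere x then complex.Re (T f x) else 0); first exact: key.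
  by apply/funext => x; rewrite /sphT; case: ifP.
- rewrite (_ : (fun x => _) = fun x => if onsphere x then complex.Im (T f x) else 0); first exact: key.
  by apply/funext => x; rewrite /sphT; case: ifP.
Qed.

Lemma sphTD f g : Lp p f -> Lp p g ->
  {ae S, forall x, sphT (fun y => f y + g y) x = sphT f x + sphT g x}.
Proof.
have [_ [h _]] := hT => lf lg; have /(sigma_aeE d0) := h f g lf lg.
by apply: filterS => x e; rewrite /sphT; case: ifP => // _; rewrite addr0.
Qed.

Lemma sphTZ c f : Lp p f -> {ae S, forall x, sphT (fun y => c * f y) x = c * sphT f x}.
Proof.
have [_ [_ [h _]]] := hT => lf; have /(sigma_aeE d0) := h c f lf.
by apply: filterS => x e; rewrite /sphT; case: ifP => // _; rewrite mulr0.
Qed.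

Lemma sphT_schwartz phi : schwartz phi ->
  {ae S, forall x, @sphere R d x -> sphT phi x = fourier phi x}.
Proof.
have [_ [_ [_ [_ h]]]] := hT => /h /(sigma_aeE d0).
by apply: filterS => x e sx; rewrite sphT_sphere.
Qed.

(** Since [d >= 1], dropping the factor [d] of [sint] only decreases the integral; [|K|] replaces
    [K] to have a nonnegative constant. *)
Lemma sphT_bounded : exists2 K : R, 0 <= K & forall f, Lp p f ->
  (\int[S]_x (cabs (sphT f x))%:E <= (K * Lpnorm p f)%:E)%E.
Proof.
have [_ [_ [_ [[K hK] _]]]] := hT.
have d1 : 1 <= d%:R :> R by rewrite ler1n.
exists `|K| => // f lf; have [m1 m2] := measurable_sphT lf.
have mc := measurable_cabs m1 m2.
have I0 : (0 <= \int[S]_x (cabs (sphT f x))%:E)%E.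
  by apply: integral_ge0 => x _; rewrite lee_fin cabs_ge0.
apply: (@le_trans _ _ (sint (fun x => (cabs (sphT f x))%:E))).
  rewrite sint_sphm; last 2 first.
  - exact/measurable_EFinP.
  - by move=> x; rewrite lee_fin cabs_ge0.
  by rewrite -[leLHS]mul1e; apply: lee_wpmul2r => //; rewrite lee_fin.
rewrite (_ : sint _ = sint (fun x => (cabs (T f x))%:E)); last first.
  rewrite /sint; congr (_ * iint _)%E; apply/funext => x; case: ifP => // px.
  by rewrite sphT_sphere//; exact: sphere_sproj.
apply: le_trans (hK f lf) _; rewrite lee_fin ler_wpM2r ?ler_norm//.
exact: powR_ge0.
Qed.

End operator.

(** * Membership and convergence in [L^p] *)

Section lebesgue_spaces.
Context (R : realType) (d : nat).
Local Notation V := (d.-tuple R).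
Local Notation mu := (lebn R d).
Variable p : R.
Hypothesis p1 : 1 <= p.

Let p0 : 0 < p. Proof. exact: lt_le_trans ltr01 p1. Qed.
Let pn0 : p != 0. Proof. by rewrite gt_eqF. Qed.

Lemma measurable_powR_cabs (f : V -> R[i]) : cmeasurable setT f ->
  measurable_fun setT (fun x => powR (cabs (f x)) p).
Proof. by move=> [m1 m2]; have mc := measurable_cabs m1 m2; meas. Qed.

Lemma iint_powR_cabs (f : V -> R[i]) : cmeasurable setT f ->
  (iint (fun x => (powR (cabs (f x)) p)%:E) = \int[mu]_x (powR (cabs (f x)) p)%:E)%E.
Proof.
move=> mf; apply: iint_ge0E; first by apply/measurable_EFinP; exact: measurable_powR_cabs.
by move=> x; rewrite lee_fin powR_ge0.
Qed.

Lemma Lp_integrable (f : V -> R[i]) : Lp p f ->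
  mu.-integrable setT (EFin \o (fun x => powR (cabs (f x)) p)).
Proof.
move=> [mf]; rewrite iint_powR_cabs// => h; apply/integrableP; split.
  by apply/measurable_EFinP; exact: measurable_powR_cabs.
by under eq_integral do rewrite /= ger0_norm ?powR_ge0//.
Qed.

Lemma integrable_Lp (f : V -> R[i]) : cmeasurable setT f ->
  mu.-integrable setT (EFin \o (fun x => powR (cabs (f x)) p)) -> Lp p f.
Proof.
move=> mf /integrableP[_ h]; split => //; rewrite iint_powR_cabs//.
by move: h; under eq_integral do rewrite /= ger0_norm ?powR_ge0//.
Qed.

Lemma Lp_dominated (f g : V -> R[i]) : Lp p f -> cmeasurable setT g ->
  (forall x, cabs (g x) <= cabs (f x)) -> Lp p g.
Proof.
move=> lf mg gf; apply: integrable_Lp => //; apply: le_integrable (Lp_integrable lf) => //.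
  by apply/measurable_EFinP; exact: measurable_powR_cabs.
move=> x _; rewrite /= lee_fin !ger0_norm ?powR_ge0//.
by apply: ge0_ler_powR; rewrite ?nnegrE ?cabs_ge0 ?(ltW p0).
Qed.

Lemma powR_incube (B M : R) (x : V) : 0 <= B ->
  powR (B * (incube M x)%:R) p = powR B p * (incube M x)%:R.
Proof. by move=> B0; case: (incube M x); rewrite ?mulr1// !mulr0 powR0. Qed.

Lemma Lp_bounded (B M : R) (f : V -> R[i]) : 0 <= B -> 0 <= M -> cmeasurable setT f ->
  (forall x, cabs (f x) <= B * (incube M x)%:R) -> Lp p f.
Proof.
move=> B0 M0 mf h; apply: integrable_Lp => //.
have lc : locint (fun _ : V => powR B p).
  by apply: (@locint_bounded _ _ _ (powR B p)) => // x; rewrite ger0_norm ?powR_ge0.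
have [_ /(_ M M0) ib] := lc.
apply: le_integrable ib => //; first by apply/measurable_EFinP; exact: measurable_powR_cabs.
move=> x _; rewrite /= lee_fin !ger0_norm ?mulr_ge0 ?powR_ge0// -powR_incube//.
by apply: ge0_ler_powR; rewrite ?nnegrE ?cabs_ge0 ?mulr_ge0 ?(ltW p0).
Qed.

Lemma cabs_cpx_le (M : R) (fR fI : V -> R) x : bdsupp M fR -> bdsupp M fI ->
  cabs (cpx fR fI x) <= (2 * M) * (incube M x)%:R.
Proof.
move=> bR bI; apply: le_trans (cabs_le_ReIm _) _.
by rewrite -mulrA mulr_natl mulr2n; apply: lerD; [exact: bR|exact: bI].
Qed.

Lemma Lp_nice (fR fI : V -> R) : nice fR -> nice fI -> Lp p (cpx fR fI).
Proof.
move=> [mR [M1 M10 b1]] [mI [M2 M20 b2]].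
have M0 : 0 <= M1 + M2 by rewrite addr_ge0.
apply: (@Lp_bounded (2 * (M1 + M2)) (M1 + M2)) => //; first by rewrite mulr_ge0.
move=> x; apply: cabs_cpx_le.
- by apply: le_bdsupp b1; rewrite ?lerDl.
- by apply: le_bdsupp b2; rewrite ?lerDr.
Qed.

Lemma LpZ (c : R[i]) (f : V -> R[i]) : Lp p f -> Lp p (fun x => c * f x).
Proof.
move=> lf; have [[m1 m2] _] := lf.
have mg : cmeasurable setT (fun x => c * f x).
  split.
    rewrite (_ : (fun x => _) = fun x => complex.Re c * complex.Re (f x) - complex.Im c * complex.Im (f x)).
      by meas.
    by apply/funext => x; rewrite cReM.
  rewrite (_ : (fun x => _) = fun x => complex.Re c * complex.Im (f x) + complex.Im c * complex.Re (f x)).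
    by meas.
  by apply/funext => x; rewrite cImM.
apply: integrable_Lp => //.
rewrite (_ : (fun x => _) = fun x => powR (cabs c) p * powR (cabs (f x)) p).
  exact: (integrableZl _ _ (Lp_integrable lf)).
by apply/funext => x; rewrite cabsM powRM ?cabs_ge0.
Qed.

Lemma powR_cvg0 (q : R) (u : nat -> R) : 0 < q -> (forall j, 0 <= u j) ->
  u j @[j --> \oo] --> (0 : R) -> powR (u j) q @[j --> \oo] --> (0 : R).
Proof.
move=> q0 u0 h; apply/cvgrPdist_le => e e0.
have ep : 0 < powR e q^-1 by rewrite powR_gt0.
move/cvgrPdist_le: h => /(_ _ ep); apply: filterS => j.
rewrite !sub0r !normrN !ger0_norm ?powR_ge0// => hu.
apply: (@le_trans _ _ (powR (powR e q^-1) q)).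
  by apply: ge0_ler_powR; rewrite ?nnegrE ?powR_ge0 ?(ltW q0).
by rewrite -powRrM mulVf ?gt_eqF// powRr1// ltW.
Qed.

Lemma Lpnorm_cvg0 (g_ : nat -> V -> R[i]) : (forall j, cmeasurable setT (g_ j)) ->
  (\int[mu]_x powR (cabs (g_ j x)) p) @[j --> \oo] --> (0 : R) ->
  Lpnorm p (g_ j) @[j --> \oo] --> (0 : R).
Proof.
move=> mg h; rewrite /Lpnorm; under eq_fun do rewrite iint_powR_cabs//.
apply: powR_cvg0 h; first by rewrite invr_gt0.
by move=> j; apply: Rintegral_ge0 => x _; exact: powR_ge0.
Qed.

End lebesgue_spaces.

(** * The restriction operator on bounded functions of bounded support *)

Section restriction_nice.
Context (R : realType) (d : nat).
Local Notation V := (d.-tuple R).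
Local Notation mu := (lebn R d).
Local Notation S := (@sphm R d).
Local Notation zero := (fun _ : V => 0 : R).
Hypothesis d0 : (0 < d)%N.
Variables (p : R) (T : (V -> R[i]) -> V -> R[i]).
Hypothesis p1 : 1 <= p.
Hypothesis hT : is_restriction_operator p T.

Let p0 : 0 < p. Proof. exact: lt_le_trans ltr01 p1. Qed.

Lemma nice0 : nice zero.
Proof.
by split => //; exists 0 => // x; rewrite normr0 mul0r.
Qed.

(** [T] is prescribed on Schwartz functions only. The property is extended to real bounded functions
    by the monotone class theorem, then to complex ones by linearity of [T]. *)
Definition restricts (fR fI : V -> R) : Prop :=
  {ae S, forall x, @sphere R d x -> sphT T (cpx fR fI) x = fourier (cpx fR fI) x}.

Lemma fourier_real phi xi : nice phi ->
  fourier (cpx phi zero) xi = Complex (cosT phi xi) (- sinT phi xi).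
Proof.
move=> np; have ip := nice_integrable np; have i0 := nice_integrable nice0.
have c0 : cosT zero xi = 0.
  by rewrite /cosT (eq_Rintegral _ (g := cst 0)) ?Rintegral_cst ?mul0r// => x _; rewrite mul0r.
have s0 : sinT zero xi = 0.
  by rewrite /sinT (eq_Rintegral _ (g := cst 0)) ?Rintegral_cst ?mul0r// => x _; rewrite mul0r.
by rewrite fourierE// /fourR /fourI c0 s0 addr0 sub0r.
Qed.

Lemma restricts_lin (a b : R) f g : nice f -> nice g ->
  restricts f zero -> restricts g zero -> restricts (fun x => a * f x + b * g x) zero.
Proof.
move=> nf ng Hf Hg.
have lf := Lp_nice p1 nf nice0; have lg := Lp_nice p1 ng nice0.
pose ca := Complex a 0 : R[i]; pose cb := Complex b 0 : R[i].
have E : cpx (fun x => a * f x + b * g x) zero = fun y => ca * cpx f zero y + cb * cpx g zero y.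
  by apply/funext => y; apply: complex_ext; rewrite !ReImE /=; ring.
have A1 := sphTD d0 hT (LpZ ca lf) (LpZ cb lg).
have A2 := sphTZ d0 hT ca lf; have A3 := sphTZ d0 hT cb lg.
apply: filterS (filterI (filterI A1 (filterI A2 A3)) (filterI Hf Hg)) => x [[e1 [e2 e3]] [e4 e5]] sx.
rewrite [in LHS]E e1 e2 e3 e4// e5// !fourier_real//; last exact: nice_lin.
rewrite cosT_lin ?sinT_lin; [|exact: nice_integrable..].
by apply: complex_ext; rewrite !ReImE /=; ring.
Qed.

Lemma restricts_bump j (a b : V) : restricts (boxbump j.+1%:R a b) zero.
Proof.
apply: (sphT_schwartz d0 hT); split.
- by apply: schwartzR_boxbump; rewrite ltr0n.
- exact: schwartzR0.
Qed.

Lemma cabs_real (a : R) : cabs (Complex a 0) = `|a|.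
Proof. by rewrite /cabs /= expr0n addr0 sqrtr_sqr. Qed.

Lemma trig_cvg (c : V -> R) (M : R) (f_ : nat -> V -> R) (f : V -> R) : measurable_fun setT c ->
  (forall x, `|c x| <= 1) -> 0 <= M ->
  (forall j, measurable_fun setT (f_ j)) -> (forall j, bdsupp M (f_ j)) ->
  (forall x, f_ j x @[j --> \oo] --> f x) ->
  (\int[mu]_x (f_ j x * c x)) @[j --> \oo] --> \int[mu]_x (f x * c x).
Proof.
move=> mc c1 M0 mf_ bf_ cf.
apply: (Rintegral_dominated_cvg _ _ (integrable_incube d M0)).
- by move=> j; have mj := mf_ j; meas.
- by move=> x; apply: cvgM; [exact: cf|exact: cvg_cst].
- by move=> j x; rewrite normrM -[leRHS]mulr1; apply: ler_pM => //; exact: bf_.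
Qed.

Lemma cosT_cvg (M : R) (f_ : nat -> V -> R) (f : V -> R) xi : 0 <= M ->
  (forall j, measurable_fun setT (f_ j)) -> (forall j, bdsupp M (f_ j)) ->
  (forall x, f_ j x @[j --> \oo] --> f x) ->
  cosT (f_ j) xi @[j --> \oo] --> cosT f xi.
Proof.
apply: trig_cvg; first by meas.
by move=> x; rewrite ler_norml cos_geN1 cos_le1.
Qed.

Lemma sinT_cvg (M : R) (f_ : nat -> V -> R) (f : V -> R) xi : 0 <= M ->
  (forall j, measurable_fun setT (f_ j)) -> (forall j, bdsupp M (f_ j)) ->
  (forall x, f_ j x @[j --> \oo] --> f x) ->
  sinT (f_ j) xi @[j --> \oo] --> sinT f xi.
Proof.
apply: trig_cvg; first by meas.
by move=> x; rewrite ler_norml sin_geN1 sin_le1.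
Qed.

(** Bounded convergence with bounded support gives convergence in [L^p], hence [T (f - f_j)] tends
    to 0 in [L^1] of the sphere, while the transforms of [f_j] converge pointwise. Fatou's lemma
    then shows that [T f] minus the transform of [f] has integral 0 in modulus. *)
Lemma restricts_lim (M : R) (f_ : nat -> V -> R) (f : V -> R) : 0 <= M ->
  (forall j, measurable_fun setT (f_ j)) -> (forall j, bdsupp M (f_ j)) ->
  (forall j, restricts (f_ j) zero) -> (forall x, f_ j x @[j --> \oo] --> f x) ->
  restricts f zero.
Proof.
move=> M0 mf_ bf_ Hf_ cf.
have mf : measurable_fun setT f by apply: measurable_fun_cvg mf_ _ => x _; exact: cf.
have bf : bdsupp M f by move=> x; apply: cvg_norm_le (cf x) => j; exact: bf_.
have nf : nice f by split => //; exists M.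
have nf_ j : nice (f_ j) by split => //; exists M.
have lf := Lp_nice p1 nf nice0; have lf_ j := Lp_nice p1 (nf_ j) nice0.
pose psi j x := 1 * f x + (-1) * f_ j x.
have npsi j : nice (psi j) by exact: nice_lin.
have lpsi j := Lp_nice p1 (npsi j) nice0.
have [K K0 hK] := sphT_bounded d0 hT.
have E j : cpx (psi j) zero = fun y => cpx f zero y + (-1) * cpx (f_ j) zero y.
  by apply/funext => y; apply: complex_ext; rewrite !ReImE /= /psi; ring.
have Tpsi j : {ae S, forall x, sphT T (cpx (psi j) zero) x = sphT T (cpx f zero) x - sphT T (cpx (f_ j) zero) x}.
  have A1 := sphTD d0 hT lf (LpZ (-1) (lf_ j)).
  have A2 := sphTZ d0 hT (-1) (lf_ j).
  by apply: filterS (filterI A1 A2) => x [e1 e2]; rewrite E e1 e2 mulN1r.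
have Lp0 : Lpnorm p (cpx (psi j) zero) @[j --> \oo] --> (0 : R).
  apply: Lpnorm_cvg0 => //; first by move=> j; have [] := lpsi j.
  have I0 : \int[mu]_x (cst 0 x) = 0 :> R by rewrite Rintegral_cst// mul0r.
  rewrite -[X in _ --> X]I0.
  pose M2 := (`|1| + `|-1| + 1) * M; have M20 : 0 <= M2 by rewrite mulr_ge0// !addr_ge0.
  have [_ /(_ M2 M20) ib] : locint (fun _ : V => powR M2 p).
    by apply: (@locint_bounded _ _ _ (powR M2 p)) => // x; rewrite ger0_norm ?powR_ge0.
  apply: (Rintegral_dominated_cvg _ _ ib).
  - by move=> j; apply: measurable_powR_cabs; have [] := lpsi j.
  - move=> x; apply: powR_cvg0 => //; first by move=> j; exact: cabs_ge0.
    have : `|psi j x| @[j --> \oo] --> `|1 * f x + (-1) * f x|.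
      by apply: cvg_norm; apply: cvgD; [exact: cvg_cst|apply: cvgM; [exact: cvg_cst|exact: cf]].
    rewrite mul1r mulN1r subrr normr0; apply: cvg_trans; apply: near_eq_cvg.
    by apply: nearW => j; rewrite cabs_real.
  - move=> j x; rewrite ger0_norm ?powR_ge0// -powR_incube// cabs_real.
    apply: ge0_ler_powR; rewrite ?nnegrE ?mulr_ge0 ?(ltW p0)//.
    exact: bdsupp_lin.
(* Cut off to the sphere, because the hypotheses identify [T (f_ j)] with a transform only there. *)
pose g x := (if onsphere x then cabs (sphT T (cpx f zero) x - fourier (cpx f zero) x) else 0)%:E.
pose h_ j x := (cabs (sphT T (cpx (psi j) zero) x))%:E.
have h0 j x : (0 <= h_ j x)%E by rewrite lee_fin cabs_ge0.
have mh_ j : measurable_fun setT (h_ j).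
  have [m1 m2] := measurable_sphT hT (lpsi j).
  by apply/measurable_EFinP; exact: measurable_cabs.
have fi := nice_integrable nf.
have mg : measurable_fun setT g.
  apply/measurable_EFinP; apply: measurable_fun_ifT => //; first exact: measurable_onsphere.
  have [m1 m2] := measurable_sphT hT lf.
  have mc := measurable_cosT fi; have ms := measurable_sinT fi.
  apply: measurable_cabs.
  - rewrite [X in measurable_fun _ X](_ : _ = fun x => complex.Re (sphT T (cpx f zero) x) - cosT f x); first exact: (measurable_funB m1 mc).
    by apply/funext => x; rewrite cReD cReN fourier_real.
  - rewrite [X in measurable_fun _ X](_ : _ = fun x => complex.Im (sphT T (cpx f zero) x) + sinT f x); first exact: (measurable_funD m2 ms).
    by apply/funext => x; rewrite cImD cImN fourier_real//= opprK.
(* Off one null set, a countable union over [j], [T (psi j)] equals [T f] minus the transform of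
   [f_ j] at points of the sphere. *)
have h_cvg : {ae S, forall x, h_ j x @[j --> \oo] --> g x}.
  apply: filterS (filterI (ae_foralln Tpsi) (ae_foralln Hf_)) => x [e1 e2].
  have [sx|sx] := boolP (onsphere x); last first.
    rewrite /g (negbTE sx) /h_; apply: cvg_near_cst; apply: nearW => j.
    by rewrite /sphT (negbTE sx) cabs0.
  rewrite /g sx; apply: cvg_EFin; first exact: nearW.
  have sx' : @sphere R d x by rewrite sphereE.
  rewrite /cabs; apply: (@continuous_cvg _ _ _ _ _ _ (@Num.sqrt R)); first exact: sqrt_continuous.
  have cR : complex.Re (sphT T (cpx (psi j) zero) x) @[j --> \oo] -->
      complex.Re (sphT T (cpx f zero) x - fourier (cpx f zero) x).
    rewrite cReD cReN fourier_real//=.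
    have : complex.Re (sphT T (cpx f zero) x) - cosT (f_ j) x @[j --> \oo] -->
        complex.Re (sphT T (cpx f zero) x) - cosT f x.
      by apply: cvgB; [exact: cvg_cst|exact: (cosT_cvg M0)].
    apply: cvg_trans; apply: near_eq_cvg; apply: nearW => j.
    by rewrite e1 e2// cReD cReN fourier_real.
  have cI : complex.Im (sphT T (cpx (psi j) zero) x) @[j --> \oo] -->
      complex.Im (sphT T (cpx f zero) x - fourier (cpx f zero) x).
    rewrite cImD cImN fourier_real//=.
    have : complex.Im (sphT T (cpx f zero) x) - (- sinT (f_ j) x) @[j --> \oo] -->
        complex.Im (sphT T (cpx f zero) x) - (- sinT f x).
      by apply: cvgB; [exact: cvg_cst|apply: cvgN; exact: (sinT_cvg M0)].
    apply: cvg_trans; apply: near_eq_cvg; apply: nearW => j.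
    by rewrite e1 e2// cImD cImN fourier_real.
  by rewrite !expr2; apply: cvgD; apply: cvgM.
have KL : K * Lpnorm p (cpx (psi j) zero) @[j --> \oo] --> (0 : R).
  have : K * Lpnorm p (cpx (psi j) zero) @[j --> \oo] --> K * 0.
    by apply: cvgM; [exact: cvg_cst|exact: Lp0].
  by rewrite mulr0.
have g0 : (\int[S]_x g x <= 0)%E.
  apply: (@le_trans _ _ (\int[S]_x limn_einf (h_ ^~ x))%E).
    apply: ae_ge0_le_integral => //.
    - by move=> x _; rewrite /g lee_fin; case: ifP => // _; exact: cabs_ge0.
    - move=> x _; rewrite limn_einf_lim; apply: lime_ge; first exact: is_cvg_einfs.
      by apply: nearW => j; apply: le_ereal_inf_tmp => _ [k /= jk <-]; exact: h0.
    - apply: (@emeasurable_fun_cvg _ _ _ _ (fun j x => einfs (h_ ^~ x) j)).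
        by move=> j; exact: measurable_fun_einfs.
      by move=> x _; rewrite limn_einf_lim; exact: is_cvg_einfs.
    - by apply: filterS h_cvg => x /cvg_limn_einf_sup[-> _] _.
  apply: le_trans (fatou S measurableT mh_ (fun j x _ => h0 j x)) _.
  have : (\int[S]_x h_ j x)%E @[j --> \oo] --> 0%E.
    apply: (@squeeze_cvge _ _ _ _ (fun=> 0%E) _ (fun j => (K * Lpnorm p (cpx (psi j) zero))%:E)).
    - apply: nearW => j; rewrite (hK _ (lpsi j)) andbT; apply: integral_ge0 => x _; exact: h0.
    - exact: cvg_cst.
    - apply: cvg_EFin; first exact: nearW.
      exact: KL.
  by move=> /cvg_limn_einf_sup[-> _].
have gn x : (0 <= g x)%E by rewrite /g lee_fin; case: ifP => // _; exact: cabs_ge0.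
have : (\int[S]_x `|g x| = 0)%E.
  apply/eqP; rewrite eq_le integral_ge0// andbT.
  by under eq_integral do rewrite gee0_abs//.
move/(ae_eq_integral_abs S measurableT mg).1; apply: filterS => x /(_ I).
rewrite /g => -[h] sx; move: h; rewrite (_ : onsphere x); last by move: sx; rewrite sphereE.
by move=> /cabs_eq0 /eqP; rewrite subr_eq0 => /eqP.
Qed.

Lemma restricts_real phi : nice phi -> restricts phi zero.
Proof.
move: phi; apply: monotone_class_nice.
- by move=> a b f g; exact: restricts_lin.
- by move=> M f_ f; exact: restricts_lim.
- exact: restricts_bump.
Qed.

Theorem restricts_nice fR fI : nice fR -> nice fI -> restricts fR fI.
Proof.
move=> nR nI; have HR := restricts_real nR; have HI := restricts_real nI.
have lR := Lp_nice p1 nR nice0; have lI := Lp_nice p1 nI nice0.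
pose ci := Complex 0 1 : R[i].
have E : cpx fR fI = fun y => cpx fR zero y + ci * cpx fI zero y.
  by apply/funext => y; apply: complex_ext; rewrite !ReImE /=; ring.
have A1 := sphTD d0 hT lR (LpZ ci lI); have A2 := sphTZ d0 hT ci lI.
apply: filterS (filterI (filterI A1 A2) (filterI HR HI)) => x [[e1 e2] [e3 e4]] sx.
rewrite [in LHS]E e1 e2 e3// e4// !fourier_real// fourierE; [|exact: nice_integrable..].
by apply: complex_ext; rewrite !ReImE /= /fourR /fourI; ring.
Qed.

End restriction_nice.

(** * Lebesgue points *)

Section fourier_lipschitz.
Context (R : realType) (n : nat).
Local Notation V := (n.-tuple R).
Local Notation mu := (lebn R n).

Lemma derive_lipschitz (f df : R -> R) : (forall x : R, is_derive x (1 : R) f (df x)) ->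
  (forall x, `|df x| <= 1) -> forall u v, `|f u - f v| <= `|u - v|.
Proof.
move=> hf hdf.
have key u v : u <= v -> `|f v - f u| <= `|v - u|.
  move=> uv; have cf : {within `[u, v], continuous f}.
    apply: continuous_subspaceT => y; apply: differentiable_continuous.
    by apply/derivable1_diffP; have [] := hf y.
  have [x _ ->] := MVT_segment uv (fun x _ => hf x) cf.
  by rewrite normrM -[leRHS]mul1r ler_wpM2r.
move=> u v; have [uv|/ltW vu] := leP u v; last exact: key.
by rewrite distrC (distrC u); exact: key.
Qed.

Lemma dotp_incube_le (M : R) (z w : V) : incube M z -> `|dotp z w| <= n%:R * M * enorm w.
Proof.
move=> /incubeP hz; apply: le_trans (ler_norm_sum _ _ _) _.
apply: (@le_trans _ _ (\sum_(i < n) M * enorm w)).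
  by apply: ler_sum => i _; rewrite normrM; apply: ler_pM => //; [exact: hz|exact: enorm_coord].
by rewrite sumr_const card_ord -mulrA mulr_natl.
Qed.

Lemma trig_lipschitz (c : R -> R) (f : V -> R) (M : R) (x y : V) : measurable_fun setT c ->
  (forall t, `|c t| <= 1) -> (forall u v, `|c u - c v| <= `|u - v|) -> 0 <= M ->
  measurable_fun setT f -> bdsupp M f ->
  `|\int[mu]_z (f z * c (2 * pi * dotp z x)) - \int[mu]_z (f z * c (2 * pi * dotp z y))| <=
  2 * pi * (n%:R * M) * norm1 f * enorm (vsub x y).
Proof.
move=> mc c1 cl M0 mf bf; have fi := integrable_bdsupp M0 mf bf.
have ic w : mu.-integrable setT (EFin \o (fun z => f z * c (2 * pi * dotp z w))).
  by apply: (integrable_mul_bounded (M := 1) fi); [meas|move=> z; exact: c1].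
have id := integrableB measurableT (ic x) (ic y).
have p2 : 0 <= 2 * pi :> R by rewrite mulr_ge0// pi_ge0.
rewrite -RintegralB//; apply: le_trans (le_normr_Rintegral _ id) _ => //.
rewrite mulrAC /norm1 -RintegralZl//; last exact: (integrable_abse fi).
apply: le_Rintegral => //.
- exact: (integrable_abse id).
- apply: (integrableZl _ _ (integrable_abse fi)) => //.
move=> z _; rewrite -mulrBr normrM mulrC.
have [hz|hz] := boolP (incube M z); last first.
  by have := bf z; rewrite (negbTE hz) mulr0 normr_le0 => /eqP ->; rewrite normr0 !mulr0.
apply: ler_wpM2r => //; apply: le_trans (cl _ _) _.
rewrite -mulrBr -dotpBr normrM (ger0_norm p2) -!mulrA; apply: ler_wpM2l => //.
by rewrite ler_wpM2l ?pi_ge0// mulrA; exact: dotp_incube_le.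
Qed.

Lemma cosT_lipschitz f : nice f -> exists2 L : R, 0 <= L &
  forall x y : V, `|cosT f x - cosT f y| <= L * enorm (vsub x y).
Proof.
move=> [mf [M M0 bf]]; exists (2 * pi * (n%:R * M) * norm1 f).
  by rewrite !mulr_ge0 ?pi_ge0 ?norm1_ge0.
move=> x y; apply: (trig_lipschitz (c := @cos R)) => //.
- by apply: continuous_measurable_fun; exact: continuous_cos.
- by move=> t; rewrite ler_norml cos_geN1 cos_le1.
- apply: (derive_lipschitz (df := fun t => - sin t)) => t.
  by rewrite normrN ler_norml sin_geN1 sin_le1.
Qed.

Lemma sinT_lipschitz f : nice f -> exists2 L : R, 0 <= L &
  forall x y : V, `|sinT f x - sinT f y| <= L * enorm (vsub x y).
Proof.
move=> [mf [M M0 bf]]; exists (2 * pi * (n%:R * M) * norm1 f).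
  by rewrite !mulr_ge0 ?pi_ge0 ?norm1_ge0.
move=> x y; apply: (trig_lipschitz (c := @sin R)) => //.
- by apply: continuous_measurable_fun; exact: continuous_sin.
- by move=> t; rewrite ler_norml sin_geN1 sin_le1.
- apply: (derive_lipschitz (df := @cos R)) => t.
  by rewrite ler_norml cos_geN1 cos_le1.
Qed.

Lemma fourier_lipschitz fR fI : nice fR -> nice fI -> exists2 L : R, 0 <= L &
  forall x y : V, cabs (fourier (cpx fR fI) x - fourier (cpx fR fI) y) <= L * enorm (vsub x y).
Proof.
move=> nR nI; have iR := nice_integrable nR; have iI := nice_integrable nI.
have [L1 L10 h1] := cosT_lipschitz nR; have [L2 L20 h2] := sinT_lipschitz nI.
have [L3 L30 h3] := cosT_lipschitz nI; have [L4 L40 h4] := sinT_lipschitz nR.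
exists ((L1 + L2) + (L3 + L4)); first by rewrite !addr_ge0.
move=> x y; rewrite !fourierE//; apply: le_trans (cabs_le_ReIm _) _.
rewrite !ReImE /= /fourR /fourI mulrDl; apply: lerD.
- rewrite opprD addrACA mulrDl; apply: le_trans (ler_normD _ _) _; exact: lerD.
- rewrite mulrDl (_ : _ - _ - _ = (cosT fI x - cosT fI y) + - (sinT fR x - sinT fR y)); last by ring.
  by apply: le_trans (ler_normD _ _) _; rewrite normrN; exact: lerD.
Qed.

End fourier_lipschitz.

(** * Criterion for Lebesgue points and uniqueness of the value *)

Section lebesgue_points.
Context (R : realType) (n : nat).
Local Notation V := (n.+1.-tuple R).
Local Notation mu := (lebn R n.+1).
Local Notation om := (fine (omega R n.+1)).
Variable F : V -> R[i].
Hypotheses (mFR : measurable_fun setT (fun x => complex.Re (F x)))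
  (mFI : measurable_fun setT (fun x => complex.Im (F x))).

Lemma eballE (x : V) (r : R) y : \1_(eball x r) y = (enorm (vsub x y) < r)%R%:R :> R.
Proof.
rewrite indicE; congr (_%:R); congr nat_of_bool; apply/idP/idP => [/set_mem|h].
  by rewrite /eball/= edist_enorm.
by apply: mem_set; rewrite /eball/= edist_enorm.
Qed.

Lemma lebd_eball (x : V) (r : R) : 0 < r -> lebd (eball x r) = (r ^+ n.+1 * om)%:E.
Proof.
move=> r0; rewrite /lebd iint_ge0E; last 2 first.
- rewrite (_ : (fun y => _) = fun y => ind (enorm (vsub x y) < r)%R); first by meas.
  by apply/funext => y; rewrite eballE.
- by move=> y; rewrite lee_fin.
rewrite EFinM -omegaE -(ball_volume x r0); apply: eq_integral => y _.
by rewrite eballE enorm_vsubC.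
Qed.

Lemma measurable_cabs_sub (c : R[i]) : measurable_fun setT (fun y => cabs (F y - c)).
Proof.
apply: measurable_cabs.
- rewrite [X in measurable_fun _ X](_ : _ = fun x => complex.Re (F x) - complex.Re c).
    exact: measurable_funB.
  by apply/funext => x; rewrite !ReImE.
- rewrite [X in measurable_fun _ X](_ : _ = fun x => complex.Im (F x) - complex.Im c).
    exact: measurable_funB.
  by apply/funext => x; rewrite !ReImE.
Qed.

Lemma measurable_ball_cabs x r c :
  measurable_fun setT (fun y => (\1_(eball x r) y * cabs (F y - c))%:E).
Proof.
apply: measurable_EFin'; apply: measurable_funM; last exact: measurable_cabs_sub.
rewrite [X in measurable_fun _ X](_ : _ = fun y => (enorm (vsub x y) < r)%R%:R).
  by apply: measurable_natr; meas.
by apply/funext => y; rewrite eballE.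
Qed.

Lemma iint_ball_cabs x r c :
  (iint (fun y => (\1_(eball x r) y * cabs (F y - c))%:E) =
   \int[mu]_y (\1_(eball x r) y * cabs (F y - c))%:E)%E.
Proof.
apply: iint_ge0E; first exact: measurable_ball_cabs.
by move=> y; rewrite lee_fin mulr_ge0// cabs_ge0.
Qed.

(** On one small ball both averages are at most [e / 2], and [|c - c'| <= |F - c| + |F - c'|]
    pointwise. *)
Lemma lebesgue_point_unique x c c' : lebesgue_point F x c -> lebesgue_point F x c' -> c = c'.
Proof.
move=> h h'; have om0 := om_gt0 R n.
suff : cabs (c - c') = 0 by move=> /cabs_eq0 /eqP; rewrite subr_eq0 => /eqP.
apply/eqP; rewrite eq_le cabs_ge0 andbT; apply/ler_addgt0Pl => e e0; rewrite addr0.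
have e2 : 0 < e / 2 by rewrite divr_gt0.
have [dl dl0 hd] := h _ e2; have [dl' dl0' hd'] := h' _ e2.
pose r := Num.min dl dl' / 2.
have mn0 : 0 < Num.min dl dl' by rewrite lt_min dl0.
have r0 : 0 < r by rewrite divr_gt0.
have rm : r < Num.min dl dl' by rewrite ltr_pdivrMr// ltr_pMr// ltr1n.
have rd : r < dl by apply: lt_le_trans rm _; rewrite ge_min lexx.
have rd' : r < dl' by apply: lt_le_trans rm _; rewrite ge_min lexx orbT.
have h1 := hd r; have h2 := hd' r; rewrite r0 rd in h1; rewrite r0 rd' in h2.
have := leeD (h1 isT) (h2 isT).
rewrite !iint_ball_cabs lebd_eball// -!EFinM -EFinD -mulrDl -splitr.
rewrite -ge0_integralD//; last 4 first.
- by move=> y _; rewrite lee_fin mulr_ge0// cabs_ge0.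
- exact: measurable_ball_cabs.
- by move=> y _; rewrite lee_fin mulr_ge0// cabs_ge0.
- exact: measurable_ball_cabs.
move=> hh.
have : ((cabs (c - c'))%:E * lebd (eball x r) <= (e * (r ^+ n.+1 * om))%:E)%E.
  apply: le_trans hh; rewrite lebd_eball// EFinM -omegaE -(ball_volume x r0).
  have mi : measurable_fun setT (fun y : V => ind (enorm (vsub y x) < r)%R : \bar R) by meas.
  rewrite -intZl; [|by rewrite lee_fin cabs_ge0|by move=> y; exact: ind_ge0|exact: mi].
  apply: le_int.
  - by move=> y; apply: mule_ge0; [rewrite lee_fin cabs_ge0|exact: ind_ge0].
  - by apply: emeasurable_funM; [meas|exact: mi].
  - by apply: emeasurable_funD; exact: measurable_ball_cabs.
  move=> y; rewrite -EFinM -EFinD -mulrDr lee_fin eballE enorm_vsubC mulrC ler_wpM2l//.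
  rewrite (_ : c - c' = (F y - c') - (F y - c)); last by ring.
  by apply: le_trans (cabsD _ _) _; rewrite cabsN addrC.
by rewrite lebd_eball// -EFinM lee_fin ler_pM2r// mulr_gt0// exprn_gt0.
Qed.

Lemma dyadic_bracket (r : R) : 0 < r < 1 -> exists k, 2^-1 ^+ k.+1 <= r < 2^-1 ^+ k.
Proof.
move=> /andP[r0 r1].
have ex : exists k, (2^-1 : R) ^+ k.+1 <= r.
  have : (2^-1 : R) ^+ k @[k --> \oo] --> (0 : R).
    by apply: cvg_expr; rewrite ger0_norm// invf_lt1// ltr1n.
  move/cvgrPdist_le => /(_ r r0) /filter_ex[k]; rewrite sub0r normrN ger0_norm ?exprn_ge0// => hk.
  exists k; apply: le_trans hk; rewrite exprS ler_piMl ?exprn_ge0//.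
  by rewrite invf_le1// ler1n.
have [k hk kmin] := ex_minnP ex; exists k; rewrite hk/=.
case: k hk kmin => [|k] hk kmin; first by rewrite expr0.
by rewrite ltNge; apply/negP => /kmin; rewrite ltnn.
Qed.

(** [g] and [L] may depend on [eta]: the Lipschitz term disappears for small radii, and smallness of
    the averages of [g] is only asked at dyadic radii. *)
Lemma lebesgue_point_intro (x : V) (c : R[i]) :
  (forall eta : R, 0 < eta -> exists (g : V -> R) (L : R),
    [/\ locint g, forall y, 0 <= g y, 0 <= L,
      forall y, cabs (F y - c) <= g y + L * enorm (vsub x y) + eta &
      forall k, ballint g x (2^-1 ^+ k) <= eta * om * (2^-1 ^+ k) ^+ n.+1]) ->
  lebesgue_point F x c.
Proof.
move=> H e e0; have om0 := om_gt0 R n.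
(* [2^(n+1)] pays for enlarging [B(x, r)] to a dyadic ball of radius at most [2 r]; the summand 2
   pays for the Lipschitz term and for the constant [eta]. *)
pose A : R := 2 ^+ n.+1 + 2; have A0 : 0 < A by rewrite addr_gt0// exprn_gt0.
pose eta := e / A; have eta0 : 0 < eta by rewrite divr_gt0.
have [g [L [lg g0 L0 hF hb]]] := H _ eta0; have [mg _] := lg.
have L1 : 0 < L + 1 by rewrite ltr_wpDl.
(* The first bound allows a dyadic bracket around [r], the second gives [L r <= eta]. *)
exists (Num.min 1 (eta / (L + 1))); first by rewrite lt_min ltr01 divr_gt0.
move=> r /andP[r0]; rewrite lt_min => /andP[r1 rL].
have [k /andP[kr rk]] : exists k, 2^-1 ^+ k.+1 <= r < 2^-1 ^+ k by apply: dyadic_bracket; rewrite r0.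
rewrite iint_ball_cabs lebd_eball// -EFinM.
pose b y : R := (enorm (vsub x y) < r)%R%:R.
have mb : measurable_fun setT b by apply: measurable_natr; meas.
have b0 y : 0 <= b y by [].
have Lr : L * r <= eta.
  apply: (@le_trans _ _ ((L + 1) * r)); first by rewrite ler_wpM2r ?(ltW r0)// lerDl.
  by rewrite mulrC -ler_pdivlMr// ltW.
apply: (@le_trans _ _ (\int[mu]_y ((g y * b y)%:E + (2 * eta)%:E * (b y)%:E))%E).
  apply: le_int.
  - by move=> y; rewrite lee_fin mulr_ge0// cabs_ge0.
  - exact: measurable_ball_cabs.
  - by apply: emeasurable_funD; meas.
  move=> y; rewrite -EFinM -EFinD lee_fin eballE -/(b y) mulrC -mulrDl.
  rewrite /b; case: ltP => [xy|_]; last by rewrite !mulr0.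
  rewrite !mulr1; apply: le_trans (hF y) _; rewrite -addrA lerD2l mulr_natl mulr2n lerD2r.
  by apply: le_trans Lr; rewrite ler_wpM2l// ltW.
have bE : (\int[mu]_y (b y)%:E = (r ^+ n.+1 * om)%:E)%E.
  rewrite EFinM -omegaE -(ball_volume x r0); apply: eq_integral => y _.
  by rewrite /b enorm_vsubC.
rewrite ge0_integralD//; last 4 first.
- by move=> y _; rewrite lee_fin mulr_ge0.
- by meas.
- by move=> y _; apply: mule_ge0; rewrite lee_fin; [exact: (mulr_ge0 _ (ltW eta0))|exact: b0].
- by meas.
rewrite intZl; [|by rewrite lee_fin mulr_ge0// ltW|by move=> y; rewrite lee_fin|by meas].
rewrite bE.
have h1 : (\int[mu]_y (g y * b y)%:E <= (eta * om * (2^-1 ^+ k) ^+ n.+1)%:E)%E.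
  apply: le_trans (_ : _ <= (ballint g x (2^-1 ^+ k))%:E)%E _; last by rewrite lee_fin.
  rewrite -ballintE//; apply: le_int.
  - by move=> y; rewrite lee_fin mulr_ge0.
  - by meas.
  - by apply: emeasurable_funM; meas.
  move=> y; rewrite -EFinM lee_fin ler_wpM2l// /b ler_nat.
  case: ltP => // h; case: ltP => // h'; move: (lt_le_trans h (ltW rk)) h'.
  by rewrite ltNge => /negP h2 h3; case: h2.
apply: le_trans (leeD h1 (lexx _)) _; rewrite -EFinM -EFinD lee_fin.
have h2 : (2^-1 ^+ k) ^+ n.+1 <= 2 ^+ n.+1 * r ^+ n.+1.
  rewrite -exprMn lerXn2r ?nnegrE ?exprn_ge0 ?mulr_ge0 ?(ltW r0)//.
  by move: kr; rewrite exprS; lra.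
apply: (@le_trans _ _ (eta * om * (2 ^+ n.+1 * r ^+ n.+1) + 2 * eta * (r ^+ n.+1 * om))).
  by rewrite lerD2r ler_wpM2l// mulr_ge0// ltW.
rewrite (_ : e = eta * A); last by rewrite /eta divfK// gt_eqF.
by rewrite /A le_eqVlt; apply/orP; left; apply/eqP; ring.
Qed.

End lebesgue_points.

(** * Truncation and conclusion *)

Section weak_fourier.
Context (R : realType) (n : nat).
Local Notation V := (n.+1.-tuple R).
Local Notation mu := (lebn R n.+1).
Local Notation zero := (fun _ : V => 0 : R).

Lemma nice_boxbump j (a b : V) : nice (boxbump j.+1%:R a b).
Proof.
have e0 := @enorm_ge0 R n.+1.
have M1 : 1 <= 1 + (enorm a + enorm b) by rewrite lerDl addr_ge0.
split; first exact: measurable_bump.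
exists (1 + (enorm a + enorm b)); first exact: le_trans ler01 M1.
apply: (@bdsupp_inbox _ _ a b) => //.
- by move=> i; apply: le_trans (enorm_coord a i) _; rewrite addrCA lerDl addr_ge0.
- by move=> i; apply: le_trans (enorm_coord b i) _; rewrite addrA lerDr addr_ge0.
- by move=> x; apply: bump_inbox.
Qed.

Lemma enorm_incube (M : R) (x : V) : incube M x -> enorm x <= n.+1%:R * M.
Proof.
move=> hx; have M0 : 0 <= M by move/incubeP: hx => /(_ ord0); exact: le_trans.
have [e0|e0] := eqVneq (enorm x) 0; first by rewrite e0 mulr_ge0.
have ep : 0 < enorm x by rewrite lt_def e0 enorm_ge0.
rewrite -(ler_pM2r ep) -expr2 enorm_sqr.
exact: le_trans (ler_norm _) (dotp_incube_le x hx).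
Qed.

Variables (f F : V -> R[i]).
Hypothesis hF : is_fourier_transform f F.

Lemma locint_transform (G : V -> R) : measurable_fun setT G ->
  (forall y, `|G y| <= cabs (F y)) -> locint G.
Proof.
have [[mFR mFI] [hb _]] := hF; have mF := measurable_cabs mFR mFI.
move=> mG GF; split => // M M0.
have mi : measurable_fun setT (fun y : V => (incube M y)%:R : R).
  by apply: measurable_natr; exact: measurable_incube.
apply/integrableP; split; first by apply/measurable_EFinP; exact: measurable_funM.
(* The cube of half-side [M] lies in the closed ball of radius [(n+1) M] about 0; adding 1 puts it
   inside an open ball, where local integrability of [F] is given. *)
pose x0 : V := [tuple 0 | i < n.+1]; pose r := n.+1%:R * M + 1.
have mb : measurable_fun setT (fun y => (\1_(eball x0 r) y * cabs (F y))%:E).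
  apply: measurable_EFin'; apply: measurable_funM => //.
  rewrite [X in measurable_fun _ X](_ : _ = fun y => (enorm (vsub x0 y) < r)%R%:R).
    by apply: measurable_natr; meas.
  by apply/funext => y; rewrite eballE.
apply: le_lt_trans (hb x0 r).
rewrite iint_ge0E; [|exact: mb|by move=> y; rewrite lee_fin mulr_ge0// cabs_ge0].
apply: le_int.
- by move=> y; exact: abse_ge0.
- apply: measurableT_comp => //; apply/measurable_EFinP; exact: measurable_funM.
- exact: mb.
move=> y; rewrite /= lee_fin normrM normr_nat mulrC; apply: ler_pM => //.
rewrite eballE ler_nat; have [hy|//] := boolP (incube M y).
rewrite (_ : (_ < _)%R) //; apply: le_lt_trans (_ : _ <= n.+1%:R * M) _; last by rewrite ltrDl.
apply: enorm_incube; apply/incubeP => i; rewrite tnth_vsub tnth_mktuple sub0r normrN.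
by move: i; apply/incubeP.
Qed.

Variables (p : R).
Hypotheses (p43 : 1 <= p <= 4 / 3) (lf : Lp p f).
Local Notation fR := (fun x => complex.Re (f x)).
Local Notation fI := (fun x => complex.Im (f x)).
Local Notation FR := (fun x => complex.Re (F x)).
Local Notation FI := (fun x => complex.Im (F x)).

Lemma locint_Re : locint FR.
Proof.
have [[mFR mFI] _] := hF.
by apply: locint_transform => // y; exact: Re_le_cabs.
Qed.

Lemma locint_Im : locint FI.
Proof.
have [[mFR mFI] _] := hF.
by apply: locint_transform => // y; exact: Im_le_cabs.
Qed.

Lemma Lp_dl (g : V -> R[i]) : Lp p g ->
  (\int[mu]_x (cabs (g x) `^ p)%:E = (\int[mu]_x (cabs (g x) `^ p))%:E)%E.
Proof. by move=> lg; rewrite fineK//; apply: integrable_fin_num => //; exact: Lp_integrable. Qed.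

(** Tests the defining identity against a real bump and separates real and imaginary parts. [cint]
    takes [fine] of iterated integrals, so integrability of both products has to be known first; for
    [f] times the transform of the bump it comes from [pairing_nice]. *)
Lemma weak_fourier_bump j b c (phi := boxbump j.+1%:R b c) :
  \int[mu]_x (FR x * phi x) = \int[mu]_x pairing fR fI phi x /\
  \int[mu]_x (FI x * phi x) = \int[mu]_x pairing fI (fun x => - fR x) phi x.
Proof.
have [_ [_ hw]] := hF; have [[mR mI] _] := lf; have np : nice phi by exact: nice_boxbump.
have mN : measurable_fun setT (fun x => - fR x) by exact: measurable_funN.
have ma := measurable_cabs mR mI; have a0 x := cabs_ge0 (f x).
have leR x := Re_le_cabs (f x); have leI x := Im_le_cabs (f x).
have leN x : `|- complex.Re (f x)| <= cabs (f x) by rewrite normrN; exact: Re_le_cabs.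
have sch : schwartz (cpx phi zero).
  by split; [apply: schwartzR_boxbump; rewrite ltr0n|exact: schwartzR0].
have := hw (cpx phi zero) sch.
have -> : (fun x => F x * cpx phi zero x) = cpx (fun x => FR x * phi x) (fun x => FI x * phi x).
  by apply/funext => x; apply: complex_ext; rewrite !ReImE /=; ring.
have -> : (fun x => f x * fourier (cpx phi zero) x) =
    cpx (pairing fR fI phi) (pairing fI (fun x => - fR x) phi).
  by apply/funext => x; rewrite fourier_real//; apply: complex_ext; rewrite !ReImE /= /pairing; ring.
rewrite !cintE /=.
- by case.
- exact: (pairing_nice p43 ma a0 (Lp_dl lf) mR mI leR leI np).
- exact: (pairing_nice p43 ma a0 (Lp_dl lf) mI mN leI leN np).
- exact: (locint_mul_nice locint_Re np).
- exact: (locint_mul_nice locint_Im np).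
Qed.

Lemma weak_fourier_nice phi : nice phi ->
  \int[mu]_x (FR x * phi x) = \int[mu]_x pairing fR fI phi x /\
  \int[mu]_x (FI x * phi x) = \int[mu]_x pairing fI (fun x => - fR x) phi x.
Proof.
have [[mR mI] _] := lf; move=> np.
have mN : measurable_fun setT (fun x => - fR x) by exact: measurable_funN.
have ma := measurable_cabs mR mI; have a0 x := cabs_ge0 (f x).
have leR x := Re_le_cabs (f x); have leI x := Im_le_cabs (f x).
have leN x : `|- complex.Re (f x)| <= cabs (f x) by rewrite normrN; exact: Re_le_cabs.
split.
- apply: (weak_identity_nice p43 ma a0 (Lp_dl lf) mR mI leR leI locint_Re) np => j b c.
  by have [] := weak_fourier_bump j b c.
- apply: (weak_identity_nice p43 ma a0 (Lp_dl lf) mI mN leI leN locint_Im) np => j b c.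
  by have [] := weak_fourier_bump j b c.
Qed.

End weak_fourier.

(** The order of the limits matters: [C1 k] may grow with [k], so [j] goes to infinity first. *)
Lemma measure_eq0_approx d (X : measurableType d) (R : realType) (m : {measure set X -> \bar R})
    (A : set X) (e C1 : nat -> R) (C2 : R) : e j @[j --> \oo] --> (0 : R) ->
  (forall k j, (m A <= (C1 k * e j + C2 * k.+1%:R^-1)%:E)%E) -> m A = 0%E.
Proof.
move=> e0 h; apply/eqP; rewrite eq_le measure_ge0 andbT.
have h1 k : (m A <= (C2 * k.+1%:R^-1)%:E)%E.
  have : C1 k * e j + C2 * k.+1%:R^-1 @[j --> \oo] --> C1 k * 0 + C2 * k.+1%:R^-1.
    by apply: cvgD; [apply: cvgM; [exact: cvg_cst|exact: e0]|exact: cvg_cst].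
  rewrite mulr0 add0r => hc.
  have /cvge_to_ge : (C1 k * e j + C2 * k.+1%:R^-1)%:E @[j --> \oo] --> (C2 * k.+1%:R^-1)%:E.
    by apply: cvg_EFin; [exact: nearW|exact: hc].
  by apply; apply: nearW => j; exact: h.
have : C2 * k.+1%:R^-1 @[k --> \oo] --> C2 * 0.
  by apply: cvgM; [exact: cvg_cst|exact: cvg_harmonic].
rewrite mulr0 => hc.
have /cvge_to_ge : (C2 * k.+1%:R^-1)%:E @[k --> \oo] --> (0 : R)%:E.
  by apply: cvg_EFin; [exact: nearW|exact: hc].
by apply; apply: nearW => k; exact: h1.
Qed.

Lemma markov_measure d (X : measurableType d) (R : realType) (m : {measure set X -> \bar R})
    (h : X -> R) (eta B : R) : measurable_fun setT h -> (forall x, 0 <= h x) -> 0 < eta ->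
  (\int[m]_x (h x)%:E <= B%:E)%E -> (m [set x | (eta < h x)%R] <= (B / eta)%:E)%E.
Proof.
move=> mh h0 eta0 hB.
have mA : measurable [set x | (eta < h x)%R].
  by apply: measurable_set_bool; apply: measurable_fun_ltr.
rewrite -[X in m X]setIT -integral_indic//.
apply: (@le_trans _ _ (\int[m]_x ((eta^-1)%:E * (h x)%:E))%E).
  apply: le_int.
  - by move=> x; rewrite lee_fin.
  - by apply/measurable_EFinP; exact: measurable_indic.
  - by apply/measurable_EFinP; apply: measurable_funM.
  move=> x; rewrite -EFinM lee_fin indicE; have [/set_mem/= hx|_] := boolP (x \in _).
    by rewrite mulrC ler_pdivlMr// mul1r ltW.
  by rewrite mulr_ge0// invr_ge0 ltW.
rewrite intZl; [|by rewrite lee_fin invr_ge0 ltW|by move=> x; rewrite lee_fin|exact/measurable_EFinP].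
by rewrite mulrC EFinM; apply: lee_wpmul2l => //; rewrite lee_fin invr_ge0 ltW.
Qed.

(** * Truncation in space and in height *)

Section truncation.
Context (R : realType) (n : nat).
Local Notation V := (n.-tuple R).
Local Notation mu := (lebn R n).
Variables (p : R) (f : V -> R[i]).
Hypotheses (p1 : 1 <= p) (lf : Lp p f).

(** Cutting at the same level in space and in height makes the truncation [nice] with constant [m],
    and exact at each point for all large [m], so the tail tends to 0 by dominated convergence. *)
Definition low (m : nat) (x : V) : bool := incube m%:R x && (cabs (f x) <= m%:R).
Definition truncR (m : nat) (x : V) : R := complex.Re (f x) * (low m x)%:R.
Definition truncI (m : nat) (x : V) : R := complex.Im (f x) * (low m x)%:R.
Definition tail (m : nat) (x : V) : R[i] := f x - cpx (truncR m) (truncI m) x.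

Let mR : measurable_fun setT (fun x => complex.Re (f x)). Proof. by have [[]] := lf. Qed.
Let mI : measurable_fun setT (fun x => complex.Im (f x)). Proof. by have [[]] := lf. Qed.

Let mlow m : measurable_fun setT (fun x => (low m x)%:R : R).
Proof.
apply: measurable_natr; apply: measurable_and; first exact: measurable_incube.
by apply: measurable_fun_ler => //; exact: measurable_cabs.
Qed.

Lemma nice_truncR m : nice (truncR m).
Proof.
split; first exact: measurable_funM.
exists m%:R => // x; rewrite normrM normr_nat /low.
case: (incube _ x) => /=; last by rewrite !mulr0.
rewrite mulr1; have [h|_] := leP (cabs (f x)) m%:R; last by rewrite mulr0.
by rewrite mulr1 (le_trans (Re_le_cabs _)).
Qed.

Lemma nice_truncI m : nice (truncI m).
Proof.
split; first exact: measurable_funM.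
exists m%:R => // x; rewrite normrM normr_nat /low.
case: (incube _ x) => /=; last by rewrite !mulr0.
rewrite mulr1; have [h|_] := leP (cabs (f x)) m%:R; last by rewrite mulr0.
by rewrite mulr1 (le_trans (Im_le_cabs _)).
Qed.

Lemma truncR_le m x : `|truncR m x| <= cabs (f x).
Proof.
rewrite normrM normr_nat (le_trans _ (Re_le_cabs _))// ler_piMr//.
by case: (low m x).
Qed.

Lemma truncI_le m x : `|truncI m x| <= cabs (f x).
Proof.
rewrite normrM normr_nat (le_trans _ (Im_le_cabs _))// ler_piMr//.
by case: (low m x).
Qed.

Lemma tailE m x : tail m x = if low m x then 0 else f x.
Proof.
by apply: complex_ext; rewrite /tail !ReImE /= /truncR /truncI; case: ifP => _;
  rewrite ?mulr1 ?mulr0 ?subrr ?subr0.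
Qed.

Lemma cabs_tail_le m x : cabs (tail m x) <= cabs (f x).
Proof. by rewrite tailE; case: ifP => // _; rewrite cabs0 cabs_ge0. Qed.

Lemma cmeasurable_tail m : cmeasurable setT (tail m).
Proof.
have [m1 _] := nice_truncR m; have [m2 _] := nice_truncI m; split.
- rewrite [X in measurable_fun _ X](_ : _ = fun x => complex.Re (f x) - truncR m x).
    exact: measurable_funB.
  by apply/funext => x; rewrite /tail !ReImE.
- rewrite [X in measurable_fun _ X](_ : _ = fun x => complex.Im (f x) - truncI m x).
    exact: measurable_funB.
  by apply/funext => x; rewrite /tail !ReImE.
Qed.

Lemma Lp_tail m : Lp p (tail m).
Proof. exact: (Lp_dominated p1 lf (cmeasurable_tail m) (cabs_tail_le m)). Qed.

Lemma tail_cvg0 : (\int[mu]_x powR (cabs (tail m x)) p) @[m --> \oo] --> (0 : R).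
Proof.
have I0 : \int[mu]_x (cst 0 x) = 0 :> R by rewrite Rintegral_cst// mul0r.
rewrite -[X in _ --> X]I0; have p0 := lt_le_trans ltr01 p1.
apply: (Rintegral_dominated_cvg _ _ (Lp_integrable lf)).
- by move=> m; apply: measurable_powR_cabs; exact: cmeasurable_tail.
- move=> x; apply: cvg_near_cst.
  near=> m; rewrite tailE (_ : low m x) ?cabs0 ?powR0 ?gt_eqF//.
  apply/andP; split.
    apply/incubeP => i; apply: le_trans (enorm_coord x i) _.
    near: m; exact: nbhs_infty_ger.
  near: m; exact: nbhs_infty_ger.
- move=> m x; rewrite ger0_norm ?powR_ge0//.
  by apply: ge0_ler_powR; rewrite ?nnegrE ?cabs_ge0 ?(ltW p0)// cabs_tail_le.
Unshelve. all: by end_near. Qed.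

End truncation.

(** * Exceptional sets on the sphere and conclusion *)

Section lebesgue_points_sphere.
Context (R : realType) (n : nat).
Hypothesis n2 : (2 <= n)%N.
Local Notation V := (n.+1.-tuple R).
Local Notation mu := (lebn R n.+1).
Local Notation S := (@sphm R n.+1).
Local Notation om := (fine (omega R n.+1)).
Variables (p : R) (T : (V -> R[i]) -> V -> R[i]) (f F : V -> R[i]).
Hypotheses (p43 : 1 <= p <= 4 / 3) (hT : is_restriction_operator p T).
Hypotheses (lf : Lp p f) (hF : is_fourier_transform f F).

Let p1 : 1 <= p. Proof. by case/andP: p43. Qed.
Let d0 : (0 < n.+1)%N. Proof. by []. Qed.

Local Notation fm m := (cpx (truncR f m) (truncI f m)).
Let nR := nice_truncR lf.
Let nI := nice_truncI lf.
Let iR m := nice_integrable (nR m).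
Let iI m := nice_integrable (nI m).

(** With [errI] as imaginary part, this is in the weak sense the transform of the tail, see
    [err_weak]; hence the maximal estimate applies to it. *)
Definition errR (m : nat) (y : V) : R := complex.Re (F y) - fourR (truncR f m) (truncI f m) y.
Definition errI (m : nat) (y : V) : R := complex.Im (F y) - fourI (truncR f m) (truncI f m) y.
Definition err (m : nat) (y : V) : R := `|errR m y| + `|errI m y|.

Lemma locint_errR m : locint (errR m).
Proof. exact: (locintB (locint_Re hF) (locint_fourR (iR m) (iI m))). Qed.

Lemma locint_errI m : locint (errI m).
Proof. exact: (locintB (locint_Im hF) (locint_fourI (iR m) (iI m))). Qed.

Lemma locint_err m : locint (err m).
Proof.
have [m1 i1] := locint_errR m; have [m2 i2] := locint_errI m; split; first by rewrite /err; meas.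
move=> M M0; rewrite (_ : (fun x => _) =
    fun x => `|errR m x * (incube M x)%:R| + `|errI m x * (incube M x)%:R|).
  exact: (integrableD _ (integrable_abse (i1 M M0)) (integrable_abse (i2 M M0))).
by apply/funext => x; rewrite !normrM normr_nat mulrDl.
Qed.

Lemma err_weak m phi : nice phi ->
  \int[mu]_x (errR m x * phi x) =
    \int[mu]_x pairing (fun x => complex.Re (tail f m x)) (fun x => complex.Im (tail f m x)) phi x /\
  \int[mu]_x (errI m x * phi x) =
    \int[mu]_x pairing (fun x => complex.Im (tail f m x)) (fun x => - complex.Re (tail f m x)) phi x.
Proof.
move=> np; have [w1 w2] := weak_fourier_nice hF p43 lf np.
have v1 := fourR_weak (iR m) (iI m) np; have v2 := fourI_weak (iR m) (iI m) np.
have [[mfR mfI] _] := lf; have ma := measurable_cabs mfR mfI; have a0 x := cabs_ge0 (f x).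
have leR x := Re_le_cabs (f x); have leI x := Im_le_cabs (f x).
have leN x : `|- complex.Re (f x)| <= cabs (f x) by rewrite normrN; exact: Re_le_cabs.
have leN' x : `|- truncR f m x| <= cabs (f x) by rewrite normrN; exact: truncR_le.
have mN : measurable_fun setT (fun x => - complex.Re (f x)) by exact: measurable_funN.
have [mtR _] := nR m; have [mtI _] := nI m.
have mN' : measurable_fun setT (fun x => - truncR f m x) by exact: measurable_funN.
have P1 := pairing_nice p43 ma a0 (Lp_dl lf) mfR mfI leR leI np.
have P2 := pairing_nice p43 ma a0 (Lp_dl lf) mfI mN leI leN np.
have P3 := pairing_nice p43 ma a0 (Lp_dl lf) mtR mtI (truncR_le f m) (truncI_le f m) np.
have P4 := pairing_nice p43 ma a0 (Lp_dl lf) mtI mN' (truncI_le f m) leN' np.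
split.
- transitivity (\int[mu]_x (complex.Re (F x) * phi x - fourR (truncR f m) (truncI f m) x * phi x)).
    by apply: eq_Rintegral => x _; rewrite mulrBl.
  rewrite RintegralB//; last 2 first.
  + exact: (locint_mul_nice (locint_Re hF) np).
  + exact: (locint_mul_nice (locint_fourR (iR m) (iI m)) np).
  rewrite w1 v1 -RintegralB//; apply: eq_Rintegral => x _.
  by rewrite /pairing /tail !ReImE /=; ring.
- transitivity (\int[mu]_x (complex.Im (F x) * phi x - fourI (truncR f m) (truncI f m) x * phi x)).
    by apply: eq_Rintegral => x _; rewrite mulrBl.
  rewrite RintegralB//; last 2 first.
  + exact: (locint_mul_nice (locint_Im hF) np).
  + exact: (locint_mul_nice (locint_fourI (iR m) (iI m)) np).
  rewrite w2 v2 -RintegralB//; apply: eq_Rintegral => x _.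
  by rewrite /pairing /tail !ReImE /=; ring.
Qed.

(** Off this set the truncation at level [m] is accurate up to [eta] in both respects: all dyadic
    averages of the error about [x] are small, and so is [T] of the tail at [x]. *)
Definition bad (eta : R) (m : nat) : set V :=
  (\bigcup_j [set x | exceeds_upto (err m) eta j x]) `|`
  [set x | (eta < cabs (sphT T (tail f m) x))%R].

Lemma measurable_bad eta m : measurable (bad eta m).
Proof.
apply: measurableU.
  apply: bigcupT_measurable => j; apply: measurable_set_bool.
  exact: (measurable_exceeds_upto _ (locint_err m)).
have [m1 m2] := measurable_sphT hT (Lp_tail p1 lf m).
apply: measurable_set_bool; apply: measurable_fun_ltr => //; exact: measurable_cabs.
Qed.

Let dl m : R := \int[mu]_x (cabs (tail f m x) `^ p).

(** The parameter [k] of the duality inequality is exposed as an integer. Neither [C1] nor [C2]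
    depends on [m], so the first term vanishes as [m] grows and the second afterwards as [k]
    grows. *)
Lemma bad_le (eta : R) : 0 < eta -> exists (C1 : nat -> R) (C2 : R), forall k m,
  (S (bad eta m) <= (C1 k * (dl m + Lpnorm p (tail f m)) + C2 * k.+1%:R^-1)%:E)%E.
Proof.
move=> eta0; have om0 := om_gt0 R n.
have [N0 [Q0 [N00 Q00 hM]]] := maximal_estimate R n2.
have [K K0 hK] := sphT_bounded d0 hT.
exists (fun k => 4 * (N0 + k.+1%:R) / (eta * om) + K / eta), (4 * Q0 / (eta * om)) => k m.
have dl0 : 0 <= dl m by apply: Rintegral_ge0 => x _; exact: powR_ge0.
have L0 : 0 <= Lpnorm p (tail f m) by exact: powR_ge0.
have lt := Lp_tail p1 lf m; have [[m1 m2] _] := lt.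
have k0 : (0 : R) < k.+1%:R by [].
have eo : 0 < eta * om by exact: mulr_gt0.
have mE j : measurable [set x | exceeds_upto (err m) eta j x].
  apply: measurable_set_bool; exact: (measurable_exceeds_upto _ (locint_err m)).
have h1 : (S (\bigcup_j [set x | exceeds_upto (err m) eta j x]) <=
    (4 * (dl m * (N0 + k.+1%:R) + (k.+1%:R ^+ 3)^-1 * Q0) / (eta * om))%:E)%E.
  (* The sets increase with [j] and the maximal estimate is uniform in [j], so continuity from below
     bounds the union. *)
  have hc := @nondecreasing_cvg_mu _ _ _ S _ mE (bigcupT_measurable _ mE).
  apply: (cvge_to_le (hc _)).
    move=> i j ij; apply/subsetPset => x /= /exceeds_uptoP[l li hl].
    by apply/exceeds_uptoP; exists l => //; exact: leq_trans ij.
  apply: nearW => j /=.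
  apply: (hM p (dl m) (fun x => cabs (tail f m x)) (fun x => complex.Re (tail f m x))
    (fun x => complex.Im (tail f m x)) (errR m) (errI m) eta k.+1%:R j) => //.
  - exact: measurable_cabs.
  - by move=> x; exact: cabs_ge0.
  - exact: Lp_dl.
  - by move=> x; exact: Re_le_cabs.
  - by move=> x; exact: Im_le_cabs.
  - exact: locint_errR.
  - exact: locint_errI.
  - by move=> phi np; have [] := err_weak m np.
  - by move=> phi np; have [] := err_weak m np.
have h2 : (S [set x | (eta < cabs (sphT T (tail f m) x))%R] <= (K * Lpnorm p (tail f m) / eta)%:E)%E.
  have [t1 t2] := measurable_sphT hT lt.
  apply: markov_measure (hK _ lt) => //; first exact: measurable_cabs.
  by move=> x; exact: cabs_ge0.
have mD : measurable [set x | (eta < cabs (sphT T (tail f m) x))%R].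
  have [t1 t2] := measurable_sphT hT lt.
  apply: measurable_set_bool; apply: measurable_fun_ltr => //; exact: measurable_cabs.
apply: le_trans (measureU2 S (bigcupT_measurable _ mE) mD) _.
apply: le_trans (leeD h1 h2) _; rewrite -EFinD lee_fin.
have kk : ((k.+1%:R : R) ^+ 3)^-1 <= k.+1%:R^-1.
  by rewrite lef_pV2 ?posrE ?exprn_gt0// -natrX ler_nat -[leqLHS]expn1 leq_pexp2l.
have e1 : 0 <= 4 * Q0 / (eta * om) by rewrite divr_ge0 ?(ltW eo)// mulr_ge0.
have e2 : 0 <= 4 * (N0 + k.+1%:R) / (eta * om).
  by rewrite divr_ge0 ?(ltW eo)// mulr_ge0 ?addr_ge0.
have e3 : 0 <= K / eta by rewrite divr_ge0 ?(ltW eta0).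
have := ler_wpM2l e1 kk.
have := mulr_ge0 e2 L0; have := mulr_ge0 e3 dl0.
move: ((eta * om)^-1) (k.+1%:R ^- 3) (k.+1%:R^-1) (N0 + k.+1%:R) (dl m) (Lpnorm _ _) eta^-1.
by move=> a b c c' e' g h; lra.
Qed.

(** Only one good [m] is needed at each point, so the exceptional set is the intersection of the bad
    sets; its measure is at most that of each of them, and no subsequence has to be extracted. *)
Lemma ae_good (eta : R) : 0 < eta -> {ae S, forall x, exists m, ~ bad eta m x}.
Proof.
move=> eta0; have [C1 [C2 hC]] := bad_le eta0.
exists (\bigcap_m bad eta m); split.
- by apply: bigcapT_measurable => m; exact: measurable_bad.
- have ce : dl m + Lpnorm p (tail f m) @[m --> \oo] --> (0 : R).
    have : dl m + Lpnorm p (tail f m) @[m --> \oo] --> 0 + (0 : R).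
      apply: cvgD; first exact: (tail_cvg0 p1 lf).
      apply: (Lpnorm_cvg0 p1); last exact: (tail_cvg0 p1 lf).
      by move=> m; exact: (cmeasurable_tail lf).
    by rewrite addr0.
  apply: (measure_eq0_approx ce) => k m; apply: le_trans (hC k m).
  apply: le_measure; rewrite ?inE; [|exact: measurable_bad|by apply: bigcap_inf].
  by apply: bigcapT_measurable => j; exact: measurable_bad.
- move=> x /= h m _; apply: contrapT => hm; apply: h; by exists m.
Qed.

Lemma sphT_tail m : {ae S, forall x, sphT T (tail f m) x = sphT T f x - sphT T (fm m) x}.
Proof.
have lm := Lp_nice p1 (nR m) (nI m).
have A1 := sphTD d0 hT lf (LpZ (-1) lm); have A2 := sphTZ d0 hT (-1) lm.
have E : tail f m = fun y => f y + (-1) * fm m y by apply/funext => y; rewrite /tail mulN1r.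
by apply: filterS (filterI A1 A2) => x [e1 e2]; rewrite [in LHS]E e1 e2 mulN1r.
Qed.

(** At a good point, [F y - T f x] is the sum of the error of the truncation at [y], the increment
    of a Lipschitz transform between [x] and [y], and minus the value at [x] of [T] of the tail:
    exactly the three terms of [lebesgue_point_intro]. *)
Theorem ae_lebesgue_point : {ae S, forall x, lebesgue_point F x (T f x)}.
Proof.
have [[mFR mFI] _] := hF; have om0 := om_gt0 R n.
have A1 := ae_foralln (fun m => sphT_tail m).
have A2 := ae_foralln (fun m => restricts_nice d0 p1 hT (nR m) (nI m)).
(* Taking [eta] along [1/(k+1)] keeps the union of null sets countable. *)
have A3 := ae_foralln (fun k => ae_good (_ : 0 < (k.+1%:R : R)^-1)).
apply: ae_sphT.
apply: filterS (filterI (A3 _) (filterI A1 A2)) => [x [hg [h1 h2]] sx|k]; last by rewrite invr_gt0.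
rewrite -(sphT_sphere T f sx); apply: (lebesgue_point_intro mFR mFI) => eta eta0.
have [k hk] : exists k, (k.+1%:R : R)^-1 <= eta.
  have /cvgrPdist_le /(_ eta eta0) /filter_ex[k] := @cvg_harmonic R.
  by rewrite sub0r normrN ger0_norm ?harmonic_ge0// => hk; exists k.
have [m hm] := hg k; have [L L0 hL] := fourier_lipschitz (nR m) (nI m).
exists (err m), L; split => //; first exact: locint_err.
- by move=> y; rewrite addr_ge0.
- move=> y.
  have -> : F y - sphT T f x = (F y - fourier (fm m) y) + (fourier (fm m) y - fourier (fm m) x)
      + (- sphT T (tail f m) x) by rewrite h1 h2//; ring.
  apply: le_trans (cabsD _ _) _; apply: lerD; last first.
    rewrite cabsN; apply: le_trans hk; rewrite leNgt; apply/negP => hh; apply: hm; by right.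
  apply: le_trans (cabsD _ _) _; apply: lerD; last by rewrite enorm_vsubC; exact: hL.
  by apply: le_trans (cabs_le_ReIm _) _; rewrite fourierE// !ReImE.
- move=> j; apply: (@le_trans _ _ ((k.+1%:R : R)^-1 * om * (2^-1 ^+ j) ^+ n.+1)).
    rewrite leNgt; apply/negP => hh; apply: hm; left; exists j => //=.
    by apply/exceeds_uptoP; exists j.
  by rewrite ler_wpM2r ?exprn_ge0// ler_wpM2r// ltW.
Qed.

End lebesgue_points_sphere.

Theorem theorem1p3 (R : realType) (d : nat) (p : R)
    (T : (Rd R d -> R[i]) -> Rd R d -> R[i]) (f F : Rd R d -> R[i]) :
  (3 <= d)%N ->
  1 <= p <= 4 / 3 ->
  is_restriction_operator p T ->
  Lp p f ->
  is_fourier_transform f F ->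
  sigma_ae (fun x => exists c : R[i], lebesgue_point F x c) /\
  sigma_ae (fun x => forall c : R[i], lebesgue_point F x c -> c = T f x).
Proof.
case: d T f F => [//|n] T f F n2 p43 hT lf hF; have [[mFR mFI] _] := hF.
have A := ae_lebesgue_point n2 p43 hT lf hF.
(* Both claims hold at the same points: [T f x] is a regularised value there, and regularised values
   are unique. *)
split; apply/sigma_aeE => //; apply: filterS A => x hx; first by exists (T f x).
by move=> c hc; exact: (lebesgue_point_unique mFR mFI hc hx).
Qed.
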